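(* Let $0<a<b<\infty$, let $n$ be a non-negative integer, and let $q\in C^2(\mathbb{R})$ be a real-valued function supported on the interval $[a,b]$ for which there exist constants $q_0,q_1$ with $-1<q_0\le q(r)\le q_1<\infty$ for all $r\in[a,b]$. Let $\phi_n(r,k)$ be the impedance associated with $q$ and $n$. Then for all $r\in[a,b]$, $$\frac{q'(r)}{1+q(r)}=\frac{4}{\pi}\int_{-\infty}^{\infty}\left(\phi_n(r,k)-\frac{(\sqrt{r}\,H_n(kr))'}{ik\sqrt{r}\,H_n(kr)}+1-\sqrt{1+q(r)}\right)\mathrm{d}k,$$ where $'$ denotes differentiation with respect to $r$ and the integral over the real line is understood as the limit $\lim_{\Omega\to\infty}\int_{-\Omega}^{\Omega}$.
   Context: $H_n=J_n+iY_n$ denotes the Hankel function of the first kind of order $n$, where $J_n$ and $Y_n$ are the Bessel functions of the first and second kind; the branch cut of the logarithm in $Y_n$ is taken along the negative imaginary axis, so that $H_n(z)$ is defined for all $z\neq0$ with $\operatorname{Im}z\ge0$ (in particular on the negative real axis). For $k\in\mathbb{C}\setminus\{0\}$ with $\operatorname{Im}k\ge0$, let $\psi_n(r)=\psi_n(r,k)$ be the solution on $(0,\infty)$ of $$\psi_n''(r)+k^2(1+q(r))\psi_n(r)-\frac{n^2-\frac14}{r^2}\psi_n(r)=0$$ with $\psi_n(r)=\sqrt{r}\,H_n(kr)$ for all $r\ge b$ (equivalently, $\psi_n=\sqrt{r}\,u_n$, where $u_n''+\frac1r u_n'+k^2(1+q)u_n-\frac{n^2}{r^2}u_n=0$ on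 $(0,\infty)$ and $u_n(r)=H_n(kr)$ for $r\ge b$). The function $\psi_n$ has no zeros on $(0,\infty)$. The impedance is $$\phi_n(r,k)=\frac{\psi_n'(r)}{ik\,\psi_n(r)},$$ with $'$ denoting $\mathrm{d}/\mathrm{d}r$. *)

(* Defs.v *)
From Stdlib Require Import Reals Factorial.
From Coquelicot Require Import Coquelicot.
Open Scope R_scope.

(** * Bessel and Hankel functions of non-negative integer order *)

Definition CSeries (u : nat -> C) : C :=
  (Series (fun m => Re (u m)), Series (fun m => Im (u m))).

(** Argument with values in (-pi/2, 3pi/2): the half-angle formula
    arg w = 2 atan (Im w / (|w| + Re w)) for the principal argument, applied to
    w = z / i, plus pi/2.  In particular [Arg z = 0] for z > 0 and
    [Arg z = PI] for z < 0.  The value on the negative imaginary axis (the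
    branch cut) carries no meaning. *)
Definition Arg (z : C) : R := PI / 2 - 2 * atan (Re z / (Cmod z + Im z)).

Definition Clog (z : C) : C := (ln (Cmod z), Arg z).

Definition harmonic (m : nat) : R := sum_n_m (fun j => / INR j) 1 m.

Definition euler_gamma : R :=
  real (Lim_seq (fun m => harmonic m - ln (INR m))).

(** The digamma function at the positive integer m + 1. *)
Definition digammaS (m : nat) : R := harmonic m - euler_gamma.

Definition BesselJ (n : nat) (z : C) : C :=
  CSeries (fun m =>
    RtoC ((-1) ^ m / (INR (fact m) * INR (fact (n + m)))) *
    (z / 2) ^ (2 * m + n))%C.

(** The principal part of [BesselY], a sum of n terms (empty for n = 0). *)
Definition BesselY_principal (n : nat) (z : C) : C :=
  match n with
  | O => RtoC 0
  | S p =>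
      (sum_n (fun m => RtoC (INR (fact (p - m)) / INR (fact m)) *
                       (z / 2) ^ (2 * m)) p / (z / 2) ^ n)%C
  end.

(** The classical expansion of Y_n for integer n (NIST DLMF 10.8.1). *)
Definition BesselY (n : nat) (z : C) : C :=
  (RtoC (2 / PI) * Clog (z / 2) * BesselJ n z
   - RtoC (/ PI) * BesselY_principal n z
   - RtoC (/ PI) * CSeries (fun m =>
       RtoC ((digammaS m + digammaS (n + m)) * (-1) ^ m /
             (INR (fact m) * INR (fact (n + m)))) *
       (z / 2) ^ (2 * m + n)))%C.

Definition HankelH (n : nat) (z : C) : C := (BesselJ n z + Ci * BesselY n z)%C.

(** * Complex-valued functions of a real variable *)

(** Total derivative; like [Derive], meaningful where [f] is differentiable. *)
Definition CDerive (f : R -> C) (r : R) : C :=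
  (Derive (fun t => Re (f t)) r, Derive (fun t => Im (f t)) r).

Definition ex_CDerive (f : R -> C) (r : R) : Prop :=
  ex_derive (K := R_AbsRing) (V := C_R_NormedModule) f r.

Definition is_C2 (q : R -> R) : Prop :=
  forall m : nat, (m <= 2)%nat ->
  forall r : R, ex_derive_n q m r /\ continuous (Derive_n q m) r.

(** [l] is the limit of the integrals of [f] over [-Omega, Omega] as Omega
    tends to infinity. *)
Definition is_RInt_symmetric (f : R -> C) (l : C) : Prop :=
  exists F : R -> C,
    (forall Omega : R, 0 < Omega ->
       is_RInt (V := C_R_NormedModule) f (- Omega) Omega (F Omega)) /\
    filterlim F (Rbar_locally p_infty) (locally (T := C_R_NormedModule) l).

(** * The scattering problem *)

Definition free_psi (n : nat) (k : C) (r : R) : C :=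
  (RtoC (sqrt r) * HankelH n (k * RtoC r))%C.

(** [f] solves the radial equation on (0, oo) for the wave number [k] and
    coincides with the free outgoing wave for r >= b. *)
Definition is_psi (n : nat) (q : R -> R) (b : R) (k : C) (f : R -> C) : Prop :=
  (forall r : R, 0 < r ->
     ex_CDerive f r /\ ex_CDerive (CDerive f) r /\
     (CDerive (CDerive f) r + k ^ 2 * RtoC (1 + q r) * f r
      - RtoC ((INR n ^ 2 - 1 / 4) / r ^ 2) * f r = 0)%C) /\
  (forall r : R, b <= r -> f r = free_psi n k r).

Definition impedance (k : C) (f : R -> C) (r : R) : C :=
  (CDerive f r / (Ci * k * f r))%C.

(* Main.v *)
Require Import Defs.
From Stdlib Require Import Reals Factorial Lra Lia Psatz.
From Coquelicot Require Import Coquelicot.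
Open Scope R_scope.

(** Write [m = psi' / psi], let [m0] be the same quotient for the free wave, and
    put [F k = - i (m - m0) + k (1 - sqrt (1 + q))], so that the integrand is
    [F k / k].  The function [F] is holomorphic in the upper half-plane, has
    boundary derivatives on the real line away from [0], and
    [m - m0 = O(k^2)] near [0].  For large [k] the WKB ansatz
    [m ~ i k sqrt (1 + q) - q' / (4 (1 + q))] gives [F -> L] with
    [L = i q' / (4 (1 + q))]: boundedly on the closed half-plane and at rate
    [1 / Im k] inside it.  By Cauchy's theorem the integral over
    [[- Omega, Omega]] is minus the integral of [F k / k] over the upper
    half-circle, which tends to [- i PI L].

    That [psi] has no zeros, and lower bounds for [|psi|], come from the
    monotonicity in [r] of the flux
    [Im (conj psi (psi' - psi / (2 r)) / k)], which is positive for large [r].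
    Positivity there, and [m0 = i k + O(1 / (k r^2))], require
    [H_n (z) ~ exp (i z) / sqrt z], which has to be extracted from the power
    series: on the positive imaginary axis the weights of the series for [I_n]
    concentrate where the digamma values cancel the logarithm, so that
    [H_n (i x) = O(exp x / x)]; a solution of Bessel's equation that is
    [o(exp y)] along vertical lines [x + i y] is the recessive one there. *)

(** Subtracting [m0] makes the integral meaningful at the origin: [m / (i k)] alone is of order
    [1 / k] there.

    The obstacle is a bound uniform in [k]. Writing [psi = E g] with the WKB exponential [E], the
    error of the ansatz is [g' / g]. Gronwall estimates bound [g] and [g'] from above only, so a
    lower bound for [g] is needed that does not degenerate as [Im k] grows. The flux provides it:
    its growth rate towards smaller [r] is [2 Im k sqrt (1 + q)], exactly the rate at which [|E|^2]
    grows, so all exponentials cancel.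

    Every comparison runs from [b] down to [r]. The data at [b] are explicit in [k], and for
    [Im k > 0] this is the direction in which the other WKB solution is damped; the damping gives
    the rate [1 / Im k]. It is lost on the real axis, where boundedness is enough because the arcs
    next to the axis subtend a small angle.

    No contour is deformed. The integral of [F] over a half-circle, taken in the angle, is
    differentiated in the radius; its derivative consists of the values of [F (k) / k] at the two
    real end points, and integration in the radius gives Cauchy's theorem. *)

Lemma C_ext (z w : C) : Re z = Re w -> Im z = Im w -> z = w.
Proof. destruct z, w; simpl; congruence. Qed.

Lemma Im_minus (z w : C) : Im (z - w) = Im z - Im w.
Proof. reflexivity. Qed.

Lemma Re_le_Cmod (z : C) : Re z <= Cmod z.
Proof. eapply Rle_trans; [apply Rle_abs | apply re_le_Cmod]. Qed.

Lemma Im_abs_le_Cmod (z : C) : Rabs (Im z) <= Cmod z.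
Proof. eapply Rle_trans; [apply Rmax_r | apply (Rmax_Cmod z)]. Qed.

Lemma Im_le_Cmod (z : C) : Im z <= Cmod z.
Proof. eapply Rle_trans; [apply Rle_abs | apply Im_abs_le_Cmod]. Qed.

Lemma Cmod_le_Re_Im (z : C) : Cmod z <= Rabs (Re z) + Rabs (Im z).
Proof.
  replace z with (RtoC (Re z) + Ci * RtoC (Im z))%C at 1
    by (apply C_ext; simpl; ring).
  eapply Rle_trans; [apply Cmod_triangle|].
  rewrite Cmod_mult, Cmod_Ci, !Cmod_R; lra.
Qed.

Lemma Cmod_minus_sym (z w : C) : Cmod (z - w) = Cmod (w - z).
Proof. rewrite <- Cmod_opp; f_equal; ring. Qed.

Lemma Cmod_triangle_inv (z w : C) : Cmod z - Cmod w <= Cmod (z - w).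
Proof.
  assert (H := Cmod_triangle (z - w) w).
  replace (z - w + w)%C with z in H by ring; lra.
Qed.

Lemma Cmod_triangle_minus (z w : C) : Cmod (z - w) <= Cmod z + Cmod w.
Proof.
  replace (z - w)%C with (z + - w)%C by ring.
  rewrite <- (Cmod_opp w); apply Cmod_triangle.
Qed.

Lemma Cmod_mult_le (z w : C) (a b : R) :
  Cmod z <= a -> Cmod w <= b -> Cmod (z * w) <= a * b.
Proof. intros; rewrite Cmod_mult; apply Rmult_le_compat; auto using Cmod_ge_0. Qed.

Lemma Cmod_plus_le (z w : C) (a b : R) :
  Cmod z <= a -> Cmod w <= b -> Cmod (z + w) <= a + b.
Proof. intros; eapply Rle_trans; [apply Cmod_triangle | lra]. Qed.

Lemma Cmod_minus_le (z w : C) (a b : R) :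
  Cmod z <= a -> Cmod w <= b -> Cmod (z - w) <= a + b.
Proof. intros; eapply Rle_trans; [apply Cmod_triangle_minus | lra]. Qed.

Lemma Cmod_neq_0 (z : C) : 0 < Cmod z -> z <> 0%C.
Proof. now rewrite Cmod_gt_0. Qed.

Lemma Cmod_le_of_sqr (z : C) (x : R) : 0 <= x -> Cmod z ^ 2 <= x ^ 2 -> Cmod z <= x.
Proof. intros Hx H; assert (Hz := Cmod_ge_0 z); nra. Qed.

Lemma Re_mult_conj_le (z w : C) : Rabs (Re (z * Cconj w)) <= Cmod z * Cmod w.
Proof.
  rewrite <- (Cmod_conj w), <- Cmod_mult; apply re_le_Cmod.
Qed.

(** * Complex-valued functions of a real variable *)

Definition is_CDerive (f : R -> C) (t : R) (l : C) : Prop :=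
  is_derive (fun s => Re (f s)) t (Re l) /\ is_derive (fun s => Im (f s)) t (Im l).

Lemma is_CDerive_unique (f : R -> C) (t : R) (l : C) :
  is_CDerive f t l -> CDerive f t = l.
Proof.
  intros [H1 H2]; unfold CDerive.
  apply C_ext; simpl; now apply is_derive_unique.
Qed.

Lemma ex_CDerive_is_CDerive (f : R -> C) (t : R) :
  ex_CDerive f t -> is_CDerive f t (CDerive f t).
Proof.
  intros [l Hl].
  enough (H : is_CDerive f t l) by (now rewrite (is_CDerive_unique _ _ _ H)).
  split.
  - generalize (filterdiff_comp' (K := R_AbsRing) f (fun z : C => fst z) t _ _ Hl
      (filterdiff_linear _ is_linear_fst)).
    intros H; eapply filterdiff_ext_lin; [exact H|].
    intros y; reflexivity.
  - generalize (filterdiff_comp' (K := R_AbsRing) f (fun z : C => snd z) t _ _ Hl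
      (filterdiff_linear _ is_linear_snd)).
    intros H; eapply filterdiff_ext_lin; [exact H|].
    intros y; reflexivity.
Qed.

Lemma is_CDerive_eq (f : R -> C) (t : R) (l l' : C) :
  is_CDerive f t l -> l = l' -> is_CDerive f t l'.
Proof. now intros H <-. Qed.

Lemma is_CDerive_ext_loc (f g : R -> C) (t : R) (l : C) :
  locally t (fun s => f s = g s) -> is_CDerive f t l -> is_CDerive g t l.
Proof.
  intros He [H1 H2]; split.
  - eapply is_derive_ext_loc; [|exact H1].
    revert He; apply filter_imp; intros s ->; reflexivity.
  - eapply is_derive_ext_loc; [|exact H2].
    revert He; apply filter_imp; intros s ->; reflexivity.
Qed.

Lemma is_CDerive_const (c : C) (t : R) : is_CDerive (fun _ => c) t 0%C.
Proof. split; exact (is_derive_const (V := R_NormedModule) _ t). Qed.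

Lemma is_CDerive_RtoC (f : R -> R) (t l : R) :
  is_derive f t l -> is_CDerive (fun s => RtoC (f s)) t (RtoC l).
Proof. intros H; split; [exact H | exact (is_derive_const (V := R_NormedModule) _ t)]. Qed.

Lemma is_CDerive_id (t : R) : is_CDerive (fun s => RtoC s) t 1%C.
Proof. apply (is_CDerive_RtoC (fun s => s) t 1), @is_derive_id. Qed.

Lemma is_CDerive_plus (f g : R -> C) (t : R) (l m : C) :
  is_CDerive f t l -> is_CDerive g t m -> is_CDerive (fun s => f s + g s)%C t (l + m)%C.
Proof.
  intros [F1 F2] [G1 G2]; split; apply @is_derive_plus; assumption.
Qed.

Lemma is_CDerive_opp (f : R -> C) (t : R) (l : C) :
  is_CDerive f t l -> is_CDerive (fun s => - f s)%C t (- l)%C.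
Proof. intros [F1 F2]; split; apply @is_derive_opp; assumption. Qed.

Lemma is_CDerive_minus (f g : R -> C) (t : R) (l m : C) :
  is_CDerive f t l -> is_CDerive g t m -> is_CDerive (fun s => f s - g s)%C t (l - m)%C.
Proof. intros F G; apply is_CDerive_plus; [|apply is_CDerive_opp]; assumption. Qed.

Lemma is_derive_Rmult (f g : R -> R) (t l m : R) :
  is_derive f t l -> is_derive g t m ->
  is_derive (fun s => f s * g s) t (l * g t + f t * m).
Proof. intros F G; apply (is_derive_mult f g t l m F G Rmult_comm). Qed.

Lemma is_CDerive_mult (f g : R -> C) (t : R) (l m : C) :
  is_CDerive f t l -> is_CDerive g t m ->
  is_CDerive (fun s => f s * g s)%C t (l * g t + f t * m)%C.
Proof.
  intros [F1 F2] [G1 G2]; split.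
  - replace (Re (l * g t + f t * m)) with
      (minus (Re l * Re (g t) + Re (f t) * Re m) (Im l * Im (g t) + Im (f t) * Im m))
      by (unfold minus, plus, opp, Re, Im; simpl; ring).
    apply (is_derive_minus (fun s => Re (f s) * Re (g s)) (fun s => Im (f s) * Im (g s)));
      apply is_derive_Rmult; assumption.
  - replace (Im (l * g t + f t * m)) with
      (plus (Re l * Im (g t) + Re (f t) * Im m) (Im l * Re (g t) + Im (f t) * Re m))
      by (unfold plus, Re, Im; simpl; ring).
    apply (is_derive_plus (fun s => Re (f s) * Im (g s)) (fun s => Im (f s) * Re (g s)));
      apply is_derive_Rmult; assumption.
Qed.

Lemma is_CDerive_scal (c : C) (f : R -> C) (t : R) (l : C) :
  is_CDerive f t l -> is_CDerive (fun s => c * f s)%C t (c * l)%C.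
Proof.
  intros F; eapply is_CDerive_eq.
  - apply (is_CDerive_mult (fun _ => c)); [apply is_CDerive_const | exact F].
  - ring.
Qed.

Lemma Cmod_sqr_pos (z : C) : z <> 0%C -> 0 < Re z ^ 2 + Im z ^ 2.
Proof.
  intros H; rewrite <- Cmod2_alt; apply Cmod_gt_0 in H; nra.
Qed.

Lemma is_CDerive_inv (f : R -> C) (t : R) (l : C) :
  f t <> 0%C -> is_CDerive f t l -> is_CDerive (fun s => / f s)%C t (- l / (f t * f t))%C.
Proof.
  intros Hf [F1 F2].
  assert (Hp := Cmod_sqr_pos _ Hf).
  set (x := fun s => Re (f s)) in *; set (y := fun s => Im (f s)) in *.
  change (Re (f t)) with (x t) in *; change (Im (f t)) with (y t) in *.
  assert (E1 : Derive (fun s => x s) t = Re l) by now apply is_derive_unique.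
  assert (E2 : Derive (fun s => y s) t = Im l) by now apply is_derive_unique.
  assert (X1 : ex_derive (fun s => x s) t) by now eexists; apply F1.
  assert (X2 : ex_derive (fun s => y s) t) by now eexists; apply F2.
  assert (N1 : x t * (x t * 1) + y t * (y t * 1) <> 0) by (simpl in Hp; lra).
  assert (E : (- l / (f t * f t))%C =
    ((- Re l * (x t ^ 2 - y t ^ 2) - Im l * (2 * x t * y t)) / (x t ^ 2 + y t ^ 2) ^ 2,
     (- Im l * (x t ^ 2 - y t ^ 2) + Re l * (2 * x t * y t)) / (x t ^ 2 + y t ^ 2) ^ 2)).
  { replace (f t) with ((x t, y t) : C) by (now apply C_ext).
    assert (N2 : (x t * x t - y t * y t) ^ 2 + (x t * y t + y t * x t) ^ 2 <> 0).
    { replace (_ + _) with ((x t * (x t * 1) + y t * (y t * 1)) ^ 2) by ring.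
      now apply pow_nonzero. }
    apply C_ext; unfold Re, Im in *; simpl; field; simpl in N1, N2; rewrite ?Rmult_1_r in N1, N2;
      split; assumption || lra. }
  rewrite E; split.
  - apply (is_derive_ext (fun s => x s / (x s * (x s * 1) + y s * (y s * 1)))); [reflexivity|].
    auto_derive; [now repeat split|].
    rewrite E1, E2; unfold Re, Im; cbn [fst snd]; field; lra.
  - apply (is_derive_ext (fun s => - y s / (x s * (x s * 1) + y s * (y s * 1)))); [reflexivity|].
    auto_derive; [now repeat split|].
    rewrite E1, E2; unfold Re, Im; cbn [fst snd]; field; lra.
Qed.

Lemma is_CDerive_div (f g : R -> C) (t : R) (l m : C) :
  g t <> 0%C -> is_CDerive f t l -> is_CDerive g t m ->
  is_CDerive (fun s => f s / g s)%C t ((l * g t - f t * m) / (g t * g t))%C.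
Proof.
  intros Hg F G; eapply is_CDerive_eq.
  - apply is_CDerive_mult; [exact F | apply is_CDerive_inv; eassumption].
  - cbv beta; field; exact Hg.
Qed.

Lemma is_derive_Re_scal (c : C) (f : R -> C) (t : R) (l : C) :
  is_CDerive f t l -> is_derive (fun s => Re (c * f s)) t (Re (c * l)).
Proof. intros F; apply (is_CDerive_scal c f t l F). Qed.

Lemma is_CDerive_conj (f : R -> C) (t : R) (l : C) :
  is_CDerive f t l -> is_CDerive (fun s => Cconj (f s)) t (Cconj l).
Proof. intros [F1 F2]; split; [exact F1 | apply @is_derive_opp, F2]. Qed.

Lemma is_derive_Cmod_sqr (f : R -> C) (t : R) (l : C) :
  is_CDerive f t l -> is_derive (fun s => Cmod (f s) ^ 2) t (2 * Re (l * Cconj (f t))).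
Proof.
  intros F.
  apply (is_derive_ext (fun s => Re (f s * Cconj (f s)))).
  - intros s; rewrite Cmod2_alt; unfold Re, Im; simpl; ring.
  - replace (2 * Re (l * Cconj (f t))) with (Re (l * Cconj (f t) + f t * Cconj l))
      by (unfold Re, Im; simpl; ring).
    apply (is_CDerive_mult f (fun s => Cconj (f s))); [exact F | now apply is_CDerive_conj].
Qed.

(** * Differential inequalities *)

Lemma derive_nonneg_le (f df : R -> R) (a b : R) :
  a <= b -> (forall t, a <= t <= b -> is_derive f t (df t)) ->
  (forall t, a <= t <= b -> 0 <= df t) -> f a <= f b.
Proof.
  intros Hab Hf Hd.
  destruct (MVT_gen f a b df) as (c & Hc & E).
  - intros x Hx; apply Hf; rewrite Rmin_left, Rmax_right in Hx by lra; lra.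
  - intros x Hx; rewrite Rmin_left, Rmax_right in Hx by lra.
    apply derivable_continuous_pt; exists (df x); apply is_derive_Reals, Hf; lra.
  - rewrite Rmin_left, Rmax_right in Hc by lra.
    specialize (Hd c Hc); nra.
Qed.

(** A variable majorant of the speed, not just a constant, is allowed for the sake of
    [recessive_log_derivative], where the speed decays like [exp (- s)] on an unbounded interval. *)
Lemma Cmod_increment_le (f df : R -> C) (phi dphi : R -> R) (a b : R) :
  a <= b ->
  (forall t, a <= t <= b -> is_CDerive f t (df t)) ->
  (forall t, a <= t <= b -> is_derive phi t (dphi t)) ->
  (forall t, a <= t <= b -> Cmod (df t) <= dphi t) ->
  Cmod (f b - f a) <= phi b - phi a.
Proof.
  intros Hab Hf Hphi Hle.
  set (w := (f b - f a)%C).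
  destruct (Req_dec (Cmod w) 0) as [E|E].
  - rewrite E.
    enough (phi a <= phi b) by lra.
    apply (derive_nonneg_le phi dphi); auto.
    intros t Ht; eapply Rle_trans; [apply Cmod_ge_0 | now apply Hle].
  - assert (Hw : 0 < Cmod w) by (assert (H := Cmod_ge_0 w); lra).
    (* Project onto the direction of the increment. *)
    assert (H : phi a - / Cmod w * Re (Cconj w * f a) <= phi b - / Cmod w * Re (Cconj w * f b)).
    { apply (derive_nonneg_le (fun t => phi t - / Cmod w * Re (Cconj w * f t))
        (fun t => dphi t - / Cmod w * Re (Cconj w * df t))); auto.
      - intros t Ht; apply @is_derive_minus; [now apply Hphi|].
        apply (is_derive_scal (fun s => Re (Cconj w * f s)) t (/ Cmod w)).
        now apply is_derive_Re_scal, Hf.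
      - intros t Ht.
        assert (H1 : Re (Cconj w * df t) <= Cmod w * dphi t).
        { eapply Rle_trans; [apply Re_le_Cmod|].
          rewrite Cmod_mult, Cmod_conj; apply Rmult_le_compat_l; auto; lra. }
        apply (Rmult_le_compat_l (/ Cmod w)) in H1; [|left; now apply Rinv_0_lt_compat].
        rewrite <- Rmult_assoc, Rinv_l, Rmult_1_l in H1 by exact E; lra. }
    assert (H2 : Re (Cconj w * f b) - Re (Cconj w * f a) = Cmod w ^ 2).
    { rewrite Cmod2_alt; unfold w, Re, Im; simpl; ring. }
    assert (H3 : / Cmod w * (Re (Cconj w * f b) - Re (Cconj w * f a)) = Cmod w)
      by (rewrite H2; field; exact E).
    lra.
Qed.

Lemma Cmod_increment_le_lin (f df : R -> C) (K a b : R) :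
  a <= b ->
  (forall t, a <= t <= b -> is_CDerive f t (df t)) ->
  (forall t, a <= t <= b -> Cmod (df t) <= K) ->
  Cmod (f b - f a) <= K * (b - a).
Proof.
  intros Hab Hf HK.
  replace (K * (b - a)) with (K * b - K * a) by ring.
  apply (Cmod_increment_le f df (fun t => K * t) (fun _ => K)); auto.
  intros t _; auto_derive; auto; ring.
Qed.

(** The function [exp (A (t - a)) e(t) + B exp (A (b - a)) t] is nondecreasing: the second summand
    pays for [- B] at its largest possible weight. The left end is estimated by the right one
    because the scattering data are given at [b]. *)
Lemma gronwall_backward (e de : R -> R) (A B a b : R) :
  0 <= A -> 0 <= B -> a <= b ->
  (forall t, a <= t <= b -> is_derive e t (de t)) ->
  (forall t, a <= t <= b -> - A * e t - B <= de t) ->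
  e a <= exp (A * (b - a)) * (e b + B * (b - a)).
Proof.
  intros HA HB Hab He Hle.
  assert (H : exp (A * (a - a)) * e a + B * exp (A * (b - a)) * a <=
              exp (A * (b - a)) * e b + B * exp (A * (b - a)) * b).
  { apply (derive_nonneg_le
      (fun t => exp (A * (t - a)) * e t + B * exp (A * (b - a)) * t)
      (fun t => exp (A * (t - a)) * (A * e t + de t) + B * exp (A * (b - a)))); auto.
    - intros t Ht; assert (Ht' := He t Ht).
      auto_derive; [now eexists; apply Ht'|].
      replace (Derive (fun x => e x) t) with (de t)
        by (symmetry; apply is_derive_unique, Ht').
      unfold zero; simpl; unfold Rminus; ring.
    - intros t Ht.
      assert (H1 := exp_pos (A * (t - a))).
      assert (H2 : exp (A * (t - a)) <= exp (A * (b - a))).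
      { destruct (Req_dec (A * (t - a)) (A * (b - a))) as [->|Hn]; [lra|].
        left; apply exp_increasing; nra. }
      specialize (Hle t Ht); nra. }
  replace (A * (a - a)) with 0 in H by ring.
  rewrite exp_0 in H; nra.
Qed.

Lemma is_derive_energy (f f1 f2 : R -> C) (t : R) :
  is_CDerive f t (f1 t) -> is_CDerive f1 t (f2 t) ->
  is_derive (fun s => Cmod (f s) ^ 2 + Cmod (f1 s) ^ 2) t
    (2 * Re (f1 t * Cconj (f t)) + 2 * Re (f2 t * Cconj (f1 t))).
Proof.
  intros F F1; apply @is_derive_plus; now apply is_derive_Cmod_sqr.
Qed.

(** Gronwall for the energy [|f|^2 + |f1|^2], all cross terms being split by AM-GM. With [B = 0] it
    yields uniqueness and transport of growth; with [B > 0] it compares solutions for two wave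
    numbers. *)
Lemma second_order_gronwall (f f1 f2 : R -> C) (A B a b : R) :
  0 <= A -> 0 <= B -> a <= b ->
  (forall t, a <= t <= b -> is_CDerive f t (f1 t)) ->
  (forall t, a <= t <= b -> is_CDerive f1 t (f2 t)) ->
  (forall t, a <= t <= b -> Cmod (f2 t) <= A * Cmod (f t) + B) ->
  Cmod (f a) ^ 2 + Cmod (f1 a) ^ 2 <=
  exp ((2 + A) * (b - a)) * (Cmod (f b) ^ 2 + Cmod (f1 b) ^ 2 + B ^ 2 * (b - a)).
Proof.
  intros HA HB Hab F F1 F2.
  apply (gronwall_backward (fun t => Cmod (f t) ^ 2 + Cmod (f1 t) ^ 2)
    (fun t => 2 * Re (f1 t * Cconj (f t)) + 2 * Re (f2 t * Cconj (f1 t)))); auto.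
  - lra.
  - nra.
  - intros t Ht; now apply is_derive_energy; [apply F|apply F1].
  - intros t Ht.
    assert (H1 := Re_mult_conj_le (f1 t) (f t)).
    assert (H2 := Re_mult_conj_le (f2 t) (f1 t)).
    specialize (F2 t Ht).
    apply Rabs_le_between in H1; apply Rabs_le_between in H2.
    assert (P0 := Cmod_ge_0 (f t)); assert (P1 := Cmod_ge_0 (f1 t)).
    assert (P2 := Cmod_ge_0 (f2 t)).
    set (x := Cmod (f t)) in *; set (y := Cmod (f1 t)) in *; set (z := Cmod (f2 t)) in *.
    assert (H3 : z * y <= (A * x + B) * y) by (apply Rmult_le_compat_r; lra).
    assert (H4 : 2 * (A * x * y) <= A * (x ^ 2 + y ^ 2)).
    { assert (0 <= A * (x - y) ^ 2) by (apply Rmult_le_pos; [lra|apply pow2_ge_0]). nra. }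
    assert (H5 : 2 * (B * y) <= B ^ 2 + y ^ 2) by (assert (0 <= (B - y) ^ 2) by apply pow2_ge_0; nra).
    assert (H6 : 2 * (x * y) <= x ^ 2 + y ^ 2) by (assert (0 <= (x - y) ^ 2) by apply pow2_ge_0; nra).
    assert (0 <= x ^ 2) by nra.
    lra.
Qed.

Lemma is_derive_eps (f : R -> R) (t l : R) :
  is_derive f t l <->
  forall eps, 0 < eps -> exists delta, 0 < delta /\
    forall s, Rabs (s - t) < delta -> Rabs (f s - f t - l * (s - t)) <= eps * Rabs (s - t).
Proof.
  rewrite is_derive_Reals; split; intros H eps Heps.
  - destruct (H eps Heps) as [d Hd].
    exists d; split; [apply cond_pos|].
    intros s Hs.
    destruct (Req_dec s t) as [->|Hn].
    + rewrite !Rminus_diag, Rmult_0_r, Rminus_0_r, Rabs_R0; lra.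
    + assert (Hn' : s - t <> 0) by lra.
      specialize (Hd (s - t) Hn' Hs).
      replace (t + (s - t)) with s in Hd by ring.
      replace (f s - f t - l * (s - t)) with (((f s - f t) / (s - t) - l) * (s - t))
        by (field; lra).
      rewrite Rabs_mult; apply Rmult_le_compat_r; [apply Rabs_pos | lra].
  - destruct (H (eps / 2)) as (d & Hd & Hf); [lra|].
    exists (mkposreal d Hd); simpl; intros h Hh0 Hh.
    specialize (Hf (t + h)); replace (t + h - t) with h in Hf by ring.
    specialize (Hf Hh).
    replace ((f (t + h) - f t) / h - l) with ((f (t + h) - f t - l * h) / h) by (field; lra).
    unfold Rdiv; rewrite Rabs_mult, Rabs_inv.
    assert (Hp : 0 < Rabs h) by now apply Rabs_pos_lt.
    apply Rle_lt_trans with (eps / 2 * Rabs h * / Rabs h).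
    + apply Rmult_le_compat_r; [left; now apply Rinv_0_lt_compat | exact Hf].
    + rewrite Rmult_assoc, Rinv_r; lra.
Qed.

Lemma is_CDerive_eps (f : R -> C) (t : R) (l : C) :
  is_CDerive f t l <->
  forall eps, 0 < eps -> exists delta, 0 < delta /\
    forall s, Rabs (s - t) < delta ->
      Cmod (f s - f t - l * RtoC (s - t)) <= eps * Rabs (s - t).
Proof.
  unfold is_CDerive; rewrite !is_derive_eps; split.
  - intros [H1 H2] eps Heps.
    destruct (H1 (eps / 2)) as (d1 & Hd1 & F1); [lra|].
    destruct (H2 (eps / 2)) as (d2 & Hd2 & F2); [lra|].
    exists (Rmin d1 d2); split; [now apply Rmin_pos|].
    intros s Hs.
    assert (B1 := F1 s (Rlt_le_trans _ _ _ Hs (Rmin_l _ _))).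
    assert (B2 := F2 s (Rlt_le_trans _ _ _ Hs (Rmin_r _ _))).
    eapply Rle_trans; [apply Cmod_le_Re_Im|].
    replace (Re (f s - f t - l * RtoC (s - t))) with (Re (f s) - Re (f t) - Re l * (s - t))
      by (unfold Re, Im; simpl; ring).
    replace (Im (f s - f t - l * RtoC (s - t))) with (Im (f s) - Im (f t) - Im l * (s - t))
      by (unfold Re, Im; simpl; ring).
    lra.
  - intros H; split; intros eps Heps; destruct (H eps Heps) as (d & Hd & F);
      exists d; (split; [exact Hd|]); intros s Hs; specialize (F s Hs).
    + eapply Rle_trans; [|exact F].
      replace (Re (f s) - Re (f t) - Re l * (s - t)) with (Re (f s - f t - l * RtoC (s - t)))
        by (unfold Re, Im; simpl; ring).
      apply re_le_Cmod.
    + eapply Rle_trans; [|exact F].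
      replace (Im (f s) - Im (f t) - Im l * (s - t)) with (Im (f s - f t - l * RtoC (s - t)))
        by (unfold Re, Im; simpl; ring).
      apply Im_abs_le_Cmod.
Qed.

Lemma is_CDerive_continuous_eps (f : R -> C) (t : R) (l : C) :
  is_CDerive f t l ->
  forall eps, 0 < eps -> exists delta, 0 < delta /\
    forall s, Rabs (s - t) < delta -> Cmod (f s - f t) < eps.
Proof.
  rewrite is_CDerive_eps; intros H eps Heps.
  destruct (H 1 Rlt_0_1) as (d & Hd & F).
  assert (Hl := Cmod_ge_0 l).
  assert (Hp : 0 < eps / (2 + Cmod l)) by (apply Rdiv_lt_0_compat; lra).
  exists (Rmin d (eps / (2 + Cmod l))); split; [now apply Rmin_pos|].
  intros s Hs.
  assert (B1 := F s (Rlt_le_trans _ _ _ Hs (Rmin_l _ _))).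
  assert (B2 := Rlt_le_trans _ _ _ Hs (Rmin_r _ _)).
  replace (f s - f t)%C with ((f s - f t - l * RtoC (s - t)) + l * RtoC (s - t))%C by ring.
  eapply Rle_lt_trans; [apply Cmod_triangle|].
  rewrite (Cmod_mult l), Cmod_R.
  assert (Ha := Rabs_pos (s - t)).
  assert (B3 : Rabs (s - t) * (2 + Cmod l) < eps).
  { apply (Rmult_lt_compat_r (2 + Cmod l)) in B2; [|lra].
    unfold Rdiv in B2; rewrite Rmult_assoc, Rinv_l in B2; lra. }
  nra.
Qed.

(** * Continuity and complex differentiability relative to a domain *)

(** Continuity is relative to a domain because [psi] is controlled only for [Im k >= 0]: at a real
    wave number nothing is known about approach from below. *)
Definition Ccont (D : C -> Prop) (f : C -> C) (z : C) : Prop :=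
  forall eps, 0 < eps -> exists delta, 0 < delta /\
    forall w, D w -> Cmod (w - z) < delta -> Cmod (f w - f z) < eps.

Section Ccont.
Context (D : C -> Prop).

Lemma Ccont_const (c z : C) : Ccont D (fun _ => c) z.
Proof.
  intros eps Heps; exists 1; split; [lra|]; intros w _ _.
  replace (c - c)%C with (RtoC 0) by ring; rewrite Cmod_0; exact Heps.
Qed.

Lemma Ccont_id (z : C) : Ccont D (fun w => w) z.
Proof. intros eps Heps; exists eps; split; auto. Qed.

Lemma Ccont_plus (f g : C -> C) (z : C) :
  Ccont D f z -> Ccont D g z -> Ccont D (fun w => f w + g w)%C z.
Proof.
  intros Hf Hg eps Heps.
  destruct (Hf (eps / 2)) as (d1 & Hd1 & F1); [lra|].
  destruct (Hg (eps / 2)) as (d2 & Hd2 & F2); [lra|].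
  exists (Rmin d1 d2); split; [now apply Rmin_pos|].
  intros w Dw Hw.
  assert (B1 := F1 w Dw (Rlt_le_trans _ _ _ Hw (Rmin_l _ _))).
  assert (B2 := F2 w Dw (Rlt_le_trans _ _ _ Hw (Rmin_r _ _))).
  replace (f w + g w - (f z + g z))%C with ((f w - f z) + (g w - g z))%C by ring.
  eapply Rle_lt_trans; [apply Cmod_triangle | lra].
Qed.

Lemma Ccont_mult (f g : C -> C) (z : C) :
  Ccont D f z -> Ccont D g z -> Ccont D (fun w => f w * g w)%C z.
Proof.
  intros Hf Hg eps Heps.
  assert (P1 := Cmod_ge_0 (f z)); assert (P2 := Cmod_ge_0 (g z)).
  set (K := Cmod (f z) + Cmod (g z) + 2).
  assert (HK : 0 < eps / K) by (apply Rdiv_lt_0_compat; unfold K; lra).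
  assert (He : 0 < Rmin 1 (eps / K)) by (apply Rmin_pos; lra).
  destruct (Hf _ He) as (d1 & Hd1 & F1).
  destruct (Hg _ He) as (d2 & Hd2 & F2).
  exists (Rmin d1 d2); split; [now apply Rmin_pos|].
  intros w Dw Hw.
  assert (B1 := F1 w Dw (Rlt_le_trans _ _ _ Hw (Rmin_l _ _))).
  assert (B2 := F2 w Dw (Rlt_le_trans _ _ _ Hw (Rmin_r _ _))).
  replace (f w * g w - f z * g z)%C with
    ((f w - f z) * (g w - g z) + ((f w - f z) * g z + f z * (g w - g z)))%C by ring.
  eapply Rle_lt_trans; [apply Cmod_triangle|].
  eapply Rle_lt_trans; [apply Rplus_le_compat_l, Cmod_triangle|].
  rewrite !Cmod_mult.
  set (e := Rmin 1 (eps / K)) in *.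
  assert (E1 : e <= 1) by apply Rmin_l.
  assert (E2 : e * K <= eps).
  { replace eps with (eps / K * K) by (field; unfold K; lra).
    apply Rmult_le_compat_r; [unfold K; lra | apply Rmin_r]. }
  assert (P3 := Cmod_ge_0 (f w - f z)); assert (P4 := Cmod_ge_0 (g w - g z)).
  set (x := Cmod (f w - f z)) in *; set (y := Cmod (g w - g z)) in *.
  assert (x * y <= e * 1) by (apply Rmult_le_compat; lra).
  assert (x * Cmod (g z) <= e * Cmod (g z)) by (apply Rmult_le_compat_r; lra).
  assert (Cmod (f z) * y <= Cmod (f z) * e) by (apply Rmult_le_compat_l; lra).
  unfold K in E2; nra.
Qed.

Lemma Ccont_opp (f : C -> C) (z : C) : Ccont D f z -> Ccont D (fun w => - f w)%C z.
Proof.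
  intros Hf eps Heps; destruct (Hf eps Heps) as (d & Hd & F).
  exists d; split; auto; intros w Dw Hw.
  replace (- f w - - f z)%C with (- (f w - f z))%C by ring.
  rewrite Cmod_opp; auto.
Qed.

Lemma Ccont_minus (f g : C -> C) (z : C) :
  Ccont D f z -> Ccont D g z -> Ccont D (fun w => f w - g w)%C z.
Proof. intros Hf Hg; apply Ccont_plus; [|apply Ccont_opp]; assumption. Qed.

Lemma Ccont_inv (f : C -> C) (z : C) :
  f z <> 0%C -> Ccont D f z -> Ccont D (fun w => / f w)%C z.
Proof.
  intros Hz Hf eps Heps.
  assert (P : 0 < Cmod (f z)) by now apply Cmod_gt_0.
  set (K := Cmod (f z)) in *.
  assert (He : 0 < Rmin (K / 2) (eps * K ^ 2 / 4)).
  { apply Rmin_pos; [lra|]. assert (0 < K ^ 2) by nra. nra. }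
  destruct (Hf _ He) as (d & Hd & F).
  exists d; split; auto; intros w Dw Hw.
  specialize (F w Dw Hw).
  assert (B1 := Rlt_le_trans _ _ _ F (Rmin_l _ _)).
  assert (B2 := Rlt_le_trans _ _ _ F (Rmin_r _ _)).
  assert (B3 : K / 2 < Cmod (f w)).
  { assert (T := Cmod_triangle_inv (f z) (f w)).
    rewrite Cmod_minus_sym in T; fold K in T; lra. }
  assert (Hw0 : f w <> 0%C) by (apply Cmod_neq_0; lra).
  replace (/ f w - / f z)%C with (- (f w - f z) / (f w * f z))%C by (field; auto).
  rewrite Cmod_div by (apply Cmod_neq_0; rewrite Cmod_mult; fold K; nra).
  rewrite Cmod_opp, Cmod_mult; fold K.
  apply Rlt_div_l; [nra|].
  assert (eps * K * (K / 2) < eps * K * Cmod (f w)) by (apply Rmult_lt_compat_l; nra).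
  assert (0 < eps * K ^ 2) by (apply Rmult_lt_0_compat; nra).
  nra.
Qed.

End Ccont.

Lemma Ccont_comp (D D' : C -> Prop) (f g : C -> C) (z : C) :
  (forall w, D w -> D' (g w)) -> Ccont D g z -> Ccont D' f (g z) ->
  Ccont D (fun w => f (g w)) z.
Proof.
  intros HD Hg Hf eps Heps.
  destruct (Hf eps Heps) as (d & Hd & F).
  destruct (Hg d Hd) as (d' & Hd' & G).
  exists d'; split; auto.
Qed.

(** Caratheodory's formulation: [phi] is the slope function at [z]. *)
Definition is_Cdiff (D : C -> Prop) (f : C -> C) (z l : C) : Prop :=
  exists phi : C -> C,
    (forall w, D w -> f w - f z = phi w * (w - z))%C /\ Ccont D phi z /\ phi z = l.

Section Cdiff.
Context (D : C -> Prop).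

Lemma is_Cdiff_cont (f : C -> C) (z l : C) : is_Cdiff D f z l -> Ccont D f z.
Proof.
  intros (phi & E & Hc & _).
  assert (H : Ccont D (fun w => phi w * (w - z))%C z).
  { apply Ccont_mult; [exact Hc|].
    apply Ccont_minus; [apply Ccont_id | apply Ccont_const]. }
  intros eps Heps; destruct (H eps Heps) as (d & Hd & F).
  exists d; split; auto; intros w Dw Hw; rewrite E by assumption.
  specialize (F w Dw Hw).
  replace (phi w * (w - z) - phi z * (z - z))%C with (phi w * (w - z))%C in F by ring.
  exact F.
Qed.

Lemma is_Cdiff_eq (f : C -> C) (z l l' : C) : is_Cdiff D f z l -> l = l' -> is_Cdiff D f z l'.
Proof. now intros H <-. Qed.

Lemma is_Cdiff_ext (f g : C -> C) (z l : C) :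
  D z -> (forall w, D w -> f w = g w) -> is_Cdiff D f z l -> is_Cdiff D g z l.
Proof.
  intros Dz E (phi & E1 & Hc & E2); exists phi; repeat split; auto.
  intros w Dw; rewrite <- !E by assumption; auto.
Qed.

Lemma is_Cdiff_const (c z : C) : is_Cdiff D (fun _ => c) z 0%C.
Proof.
  exists (fun _ => 0%C); repeat split; [intros; ring | apply Ccont_const].
Qed.

Lemma is_Cdiff_id (z : C) : is_Cdiff D (fun w => w) z 1%C.
Proof.
  exists (fun _ => 1%C); repeat split; [intros; ring | apply Ccont_const].
Qed.

Lemma is_Cdiff_plus (f g : C -> C) (z l m : C) :
  is_Cdiff D f z l -> is_Cdiff D g z m -> is_Cdiff D (fun w => f w + g w)%C z (l + m)%C.
Proof.
  intros (phi & E1 & H1 & <-) (psi & E2 & H2 & <-).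
  exists (fun w => phi w + psi w)%C; repeat split.
  - intros w Dw.
    replace (f w + g w - (f z + g z))%C with ((f w - f z) + (g w - g z))%C by ring.
    rewrite E1, E2 by assumption; ring.
  - now apply Ccont_plus.
Qed.

Lemma is_Cdiff_mult (f g : C -> C) (z l m : C) :
  is_Cdiff D f z l -> is_Cdiff D g z m ->
  is_Cdiff D (fun w => f w * g w)%C z (l * g z + f z * m)%C.
Proof.
  intros Hf Hg; assert (Cg := is_Cdiff_cont _ _ _ Hg); revert Hf Hg.
  intros (phi & E1 & H1 & <-) (psi & E2 & H2 & <-).
  exists (fun w => phi w * g w + f z * psi w)%C; repeat split.
  - intros w Dw.
    replace (f w * g w - f z * g z)%C with ((f w - f z) * g w + f z * (g w - g z))%C by ring.
    rewrite E1, E2 by assumption; ring.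
  - apply Ccont_plus; apply Ccont_mult; auto using Ccont_const.
Qed.

Lemma is_Cdiff_scal (c : C) (f : C -> C) (z l : C) :
  is_Cdiff D f z l -> is_Cdiff D (fun w => c * f w)%C z (c * l)%C.
Proof.
  intros H; eapply is_Cdiff_eq.
  - apply (is_Cdiff_mult (fun _ => c)); [apply is_Cdiff_const | exact H].
  - ring.
Qed.

Lemma is_Cdiff_opp (f : C -> C) (z l : C) :
  is_Cdiff D f z l -> is_Cdiff D (fun w => - f w)%C z (- l)%C.
Proof.
  intros (phi & E1 & H1 & <-).
  exists (fun w => - phi w)%C; repeat split; [|now apply Ccont_opp].
  intros w Dw; replace (- f w - - f z)%C with (- (f w - f z))%C by ring.
  rewrite E1 by assumption; ring.
Qed.

Lemma is_Cdiff_minus (f g : C -> C) (z l m : C) :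
  is_Cdiff D f z l -> is_Cdiff D g z m -> is_Cdiff D (fun w => f w - g w)%C z (l - m)%C.
Proof. intros F G; apply is_Cdiff_plus; [|apply is_Cdiff_opp]; assumption. Qed.

Lemma is_Cdiff_inv (f : C -> C) (z l : C) :
  D z -> (forall w, D w -> f w <> 0%C) -> is_Cdiff D f z l ->
  is_Cdiff D (fun w => / f w)%C z (- l / (f z * f z))%C.
Proof.
  intros Dz Hn Hf; assert (Cf := is_Cdiff_cont _ _ _ Hf).
  destruct Hf as (phi & E1 & H1 & <-).
  exists (fun w => - phi w * / (f w * f z))%C; repeat split.
  - intros w Dw.
    replace (/ f w - / f z)%C with (- (f w - f z) / (f w * f z))%C by (field; auto).
    rewrite E1 by assumption; field; auto.
  - apply Ccont_mult; [now apply Ccont_opp|].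
    apply Ccont_inv; [apply Cmult_neq_0; auto|].
    apply Ccont_mult; [exact Cf | apply Ccont_const].
Qed.

Lemma is_Cdiff_intro (f : C -> C) (z l : C) :
  (forall eps, 0 < eps -> exists delta, 0 < delta /\
    forall w, D w -> Cmod (w - z) < delta ->
      Cmod (f w - f z - l * (w - z)) <= eps * Cmod (w - z)) ->
  is_Cdiff D f z l.
Proof.
  intros H.
  exists (fun w => if Ceq_dec w z then l else ((f w - f z) / (w - z))%C); repeat split.
  - intros w Dw; destruct (Ceq_dec w z) as [->|Hn]; [ring|].
    field; intros E; apply Hn; replace w with ((w - z) + z)%C by ring; rewrite E; ring.
  - intros eps Heps.
    destruct (H (eps / 2)) as (d & Hd & F); [lra|].
    exists d; split; auto; intros w Dw Hw.
    destruct (Ceq_dec z z) as [_|]; [|congruence].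
    destruct (Ceq_dec w z) as [->|Hn].
    + replace (l - l)%C with (RtoC 0) by ring; rewrite Cmod_0; exact Heps.
    + assert (N : (w - z)%C <> 0%C).
      { intros E; apply Hn; replace w with ((w - z) + z)%C by ring; rewrite E; ring. }
      replace ((f w - f z) / (w - z) - l)%C with ((f w - f z - l * (w - z)) / (w - z))%C
        by (field; exact N).
      rewrite Cmod_div by exact N.
      assert (P : 0 < Cmod (w - z)) by now apply Cmod_gt_0.
      apply Rlt_div_l; [exact P|].
      specialize (F w Dw Hw); nra.
  - destruct (Ceq_dec z z); congruence.
Qed.

(** The bridge from complex differentiability to real calculus: all estimates are made along curves,
    on which the mean value inequality and Gronwall's lemma apply. *)
Lemma is_Cdiff_path (f : C -> C) (gam : R -> C) (t : R) (l v : C) :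
  is_Cdiff D f (gam t) l -> locally t (fun s => D (gam s)) -> is_CDerive gam t v ->
  is_CDerive (fun s => f (gam s)) t (l * v)%C.
Proof.
  intros (phi & E & Hc & <-) [dD HD] Hg.
  assert (Cg := is_CDerive_continuous_eps _ _ _ Hg).
  rewrite is_CDerive_eps in *; intros eps Heps.
  assert (Pl := Cmod_ge_0 (phi (gam t))); assert (Pv := Cmod_ge_0 v).
  set (L := Cmod (phi (gam t))) in *; set (V := Cmod v) in *.
  assert (He1 : 0 < eps / (2 * (L + 1))) by (apply Rdiv_lt_0_compat; lra).
  assert (He2 : 0 < Rmin 1 (eps / (2 * (V + 1))))
    by (apply Rmin_pos; [lra | apply Rdiv_lt_0_compat; lra]).
  destruct (Hg _ He1) as (d1 & Hd1 & G1).
  destruct (Hc _ He2) as (d2 & Hd2 & F2).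
  destruct (Cg d2 Hd2) as (d3 & Hd3 & G3).
  exists (Rmin dD (Rmin d1 d3)); split.
  { repeat apply Rmin_pos; auto; apply cond_pos. }
  intros s Hs.
  assert (S1 : D (gam s)) by (apply HD, (Rlt_le_trans _ _ _ Hs (Rmin_l _ _))).
  assert (Hs' := Rlt_le_trans _ _ _ Hs (Rmin_r _ _)).
  specialize (G1 s (Rlt_le_trans _ _ _ Hs' (Rmin_l _ _))).
  specialize (G3 s (Rlt_le_trans _ _ _ Hs' (Rmin_r _ _))).
  specialize (F2 (gam s) S1 G3).
  rewrite E by exact S1.
  replace (phi (gam s) * (gam s - gam t) - phi (gam t) * v * RtoC (s - t))%C with
    (phi (gam s) * (gam s - gam t - v * RtoC (s - t)) +
     (phi (gam s) - phi (gam t)) * (v * RtoC (s - t)))%C by ring.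
  eapply Rle_trans; [apply Cmod_triangle|].
  rewrite !Cmod_mult, Cmod_R; fold V.
  assert (B1 : Cmod (phi (gam s)) <= L + 1).
  { assert (T := Cmod_triangle_inv (phi (gam s)) (phi (gam t))); fold L in T.
    assert (T' := Rlt_le_trans _ _ _ F2 (Rmin_l _ _)); lra. }
  assert (B2 := Rlt_le_trans _ _ _ F2 (Rmin_r _ _)).
  assert (Pa := Rabs_pos (s - t)).
  set (x := Rabs (s - t)) in *.
  apply Rle_trans with ((L + 1) * (eps / (2 * (L + 1)) * x) + eps / (2 * (V + 1)) * ((V + 1) * x)).
  - apply Rplus_le_compat; apply Rmult_le_compat; try apply Cmod_ge_0; try lra; nra.
  - apply Req_le; field; lra.
Qed.

End Cdiff.

Lemma is_Cdiff_comp (D D' : C -> Prop) (f g : C -> C) (z l m : C) :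
  (forall w, D w -> D' (g w)) -> is_Cdiff D' f (g z) l -> is_Cdiff D g z m ->
  is_Cdiff D (fun w => f (g w)) z (l * m)%C.
Proof.
  intros HD (phi & E1 & H1 & <-) Hg; assert (Cg := is_Cdiff_cont _ _ _ _ Hg).
  destruct Hg as (psi & E2 & H2 & <-).
  exists (fun w => phi (g w) * psi w)%C; repeat split.
  - intros w Dw; rewrite E1, E2 by auto; ring.
  - apply Ccont_mult; [|exact H2]; now apply (Ccont_comp D D').
Qed.

(** * Entire series *)

Lemma ex_series_of_le (a b : nat -> R) :
  (forall m, Rabs (a m) <= b m) -> ex_series b -> ex_series a.
Proof. intros H; apply (ex_series_le a b); exact H. Qed.

(** Bounding the two components separately would lose a constant. Instead the sum [w] is paired with
    itself: [|w|^2] is the series of [Re (w conj (u m))], whose terms are at most [|w| b m]; then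
    one factor [|w|] cancels. *)
Lemma CSeries_bound (u : nat -> C) (b : nat -> R) :
  (forall m, Cmod (u m) <= b m) -> ex_series b -> Cmod (CSeries u) <= Series b.
Proof.
  intros Hu Hb; set (w := CSeries u).
  assert (E1 : ex_series (fun m => Re (u m))).
  { apply (ex_series_of_le _ b); auto.
    intros m; eapply Rle_trans; [apply re_le_Cmod | apply Hu]. }
  assert (E2 : ex_series (fun m => Im (u m))).
  { apply (ex_series_of_le _ b); auto.
    intros m; eapply Rle_trans; [apply Im_abs_le_Cmod | apply Hu]. }
  assert (B0 : 0 <= Series b).
  { replace 0 with (Series (fun _ => 0)).
    - apply Series_le; auto; intros m; split; [lra|].
      eapply Rle_trans; [apply Cmod_ge_0 | apply Hu].
    - rewrite (Series_ext _ (fun n => 0 * b n)) by (intros; ring).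
      rewrite Series_scal_l; ring. }
  destruct (Req_dec (Cmod w) 0) as [->|Hw]; [exact B0|].
  assert (Pw : 0 < Cmod w) by (assert (H := Cmod_ge_0 w); lra).
  assert (S : Cmod w ^ 2 <= Cmod w * Series b); [|nra].
  assert (EQ : Cmod w ^ 2 = Series (fun m => Re w * Re (u m) + Im w * Im (u m))).
  { rewrite Series_plus, !Series_scal_l.
    - rewrite Cmod2_alt; unfold w, CSeries, Re, Im; simpl; ring.
    - now apply (ex_series_scal_l (Re w) (fun m => Re (u m))).
    - now apply (ex_series_scal_l (Im w) (fun m => Im (u m))). }
  assert (L : forall m, Rabs (Re w * Re (u m) + Im w * Im (u m)) <= Cmod w * b m).
  { intros m.
    replace (Re w * Re (u m) + Im w * Im (u m)) with (Re (w * Cconj (u m)))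
      by (unfold Re, Im; simpl; ring).
    eapply Rle_trans; [apply Re_mult_conj_le|].
    apply Rmult_le_compat_l; [lra | apply Hu]. }
  assert (Eb : ex_series (fun m => Cmod w * b m)) by now apply (ex_series_scal_l (Cmod w) b).
  assert (Ea : ex_series (fun m => Rabs (Re w * Re (u m) + Im w * Im (u m)))).
  { apply (ex_series_of_le _ (fun m => Cmod w * b m)); auto.
    intros m; rewrite Rabs_Rabsolu; apply L. }
  rewrite EQ, <- Series_scal_l.
  eapply Rle_trans; [apply Rle_abs|].
  eapply Rle_trans; [apply Series_Rabs, Ea|].
  apply Series_le; auto; intros m; split; [apply Rabs_pos | apply L].
Qed.

Definition Cex_series (u : nat -> C) : Prop :=
  ex_series (fun m => Re (u m)) /\ ex_series (fun m => Im (u m)).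

Lemma Cex_series_of_le (u : nat -> C) (b : nat -> R) :
  (forall m, Cmod (u m) <= b m) -> ex_series b -> Cex_series u.
Proof.
  intros Hu Hb; split; apply (ex_series_of_le _ b); auto; intros m;
    (eapply Rle_trans; [|apply Hu]); [apply re_le_Cmod | apply Im_abs_le_Cmod].
Qed.

Lemma CSeries_ext (u v : nat -> C) : (forall m, u m = v m) -> CSeries u = CSeries v.
Proof.
  intros E; unfold CSeries; f_equal; apply Series_ext; intros m; now rewrite E.
Qed.

Lemma CSeries_plus (u v : nat -> C) :
  Cex_series u -> Cex_series v ->
  CSeries (fun m => u m + v m)%C = (CSeries u + CSeries v)%C.
Proof.
  intros [U1 U2] [V1 V2]; apply C_ext.
  - exact (Series_plus _ _ U1 V1).
  - exact (Series_plus _ _ U2 V2).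
Qed.

Lemma CSeries_scal (c : C) (u : nat -> C) :
  Cex_series u -> CSeries (fun m => c * u m)%C = (c * CSeries u)%C.
Proof.
  intros [U1 U2].
  assert (A1 := ex_series_scal_l (Re c) _ U1); assert (A2 := ex_series_scal_l (Im c) _ U2).
  assert (A3 := ex_series_scal_l (Re c) _ U2); assert (A4 := ex_series_scal_l (Im c) _ U1).
  apply C_ext.
  - change (Series (fun m => Re c * Re (u m) - Im c * Im (u m)) =
      Re c * Series (fun m => Re (u m)) - Im c * Series (fun m => Im (u m))).
    rewrite <- !Series_scal_l; exact (Series_minus _ _ A1 A2).
  - change (Series (fun m => Re c * Im (u m) + Im c * Re (u m)) =
      Re c * Series (fun m => Im (u m)) + Im c * Series (fun m => Re (u m))).
    rewrite <- !Series_scal_l; exact (Series_plus _ _ A3 A4).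
Qed.

Lemma Cex_series_scal (c : C) (u : nat -> C) :
  Cex_series u -> Cex_series (fun m => c * u m)%C.
Proof.
  intros [U1 U2].
  assert (A1 := ex_series_scal_l (Re c) _ U1); assert (A2 := ex_series_scal_l (Im c) _ U2).
  assert (A3 := ex_series_scal_l (Re c) _ U2); assert (A4 := ex_series_scal_l (Im c) _ U1).
  split.
  - exact (ex_series_minus _ _ A1 A2).
  - exact (ex_series_plus _ _ A3 A4).
Qed.

Lemma CSeries_incr_1 (u : nat -> C) :
  Cex_series u -> CSeries u = (u 0%nat + CSeries (fun m => u (S m)))%C.
Proof.
  intros [U1 U2]; apply C_ext.
  - exact (Series_incr_1 _ U1).
  - exact (Series_incr_1 _ U2).
Qed.

(** Exponential type is asked for, not merely infinite radius of convergence: the class is stable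
    under termwise differentiation, and every majorant series sums to a value of [exp]. *)
Definition entire (a : nat -> R) : Prop :=
  exists K rho, 0 <= K /\ 0 <= rho /\ forall m, Rabs (a m) <= K * rho ^ m / INR (fact m).

Definition entsum (a : nat -> R) (z : C) : C := CSeries (fun m => RtoC (a m) * z ^ m)%C.

Lemma is_series_exp (x : R) : is_series (fun m => x ^ m / INR (fact m)) (exp x).
Proof.
  apply (is_series_ext (fun m => scal (pow_n x m) (/ INR (fact m)))).
  - intros m; rewrite pow_n_pow; reflexivity.
  - apply is_exp_Reals.
Qed.

Lemma is_series_scal_exp (K x : R) : is_series (fun m => K * (x ^ m / INR (fact m))) (K * exp x).
Proof. exact (is_series_scal_l K _ _ (is_series_exp x)). Qed.

Lemma entsum_term_bound (a : nat -> R) (K rho r : R) (z : C) (m : nat) :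
  (forall m, Rabs (a m) <= K * rho ^ m / INR (fact m)) -> Cmod z <= r ->
  Cmod (RtoC (a m) * z ^ m) <= K * ((rho * r) ^ m / INR (fact m)).
Proof.
  intros Ha Hz.
  rewrite Cmod_mult, Cmod_R, Cmod_pow, Rpow_mult_distr.
  replace (K * (rho ^ m * r ^ m / INR (fact m))) with (K * rho ^ m / INR (fact m) * r ^ m)
    by (field; apply INR_fact_neq_0).
  apply Rmult_le_compat; auto using Rabs_pos.
  - apply pow_le, Cmod_ge_0.
  - apply pow_incr; split; [apply Cmod_ge_0 | exact Hz].
Qed.

Lemma entsum_ex (a : nat -> R) (z : C) :
  entire a -> Cex_series (fun m => RtoC (a m) * z ^ m)%C.
Proof.
  intros (K & rho & HK & Hr & Ha).
  eapply Cex_series_of_le.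
  - intros m; apply (entsum_term_bound a K rho (Cmod z)); [exact Ha | apply Rle_refl].
  - eexists; apply is_series_scal_exp.
Qed.

Lemma entsum_bounded (a : nat -> R) (r : R) :
  entire a -> exists M, 0 <= M /\ forall z, Cmod z <= r -> Cmod (entsum a z) <= M.
Proof.
  intros (K & rho & HK & Hr & Ha).
  exists (K * exp (rho * r)); split.
  - apply Rmult_le_pos; [exact HK | left; apply exp_pos].
  - intros z Hz.
    rewrite <- (is_series_unique _ _ (is_series_scal_exp K (rho * r))).
    apply CSeries_bound.
    + intros m; now apply entsum_term_bound.
    + eexists; apply is_series_scal_exp.
Qed.

Lemma entire_PS_derive (a : nat -> R) : entire a -> entire (PS_derive a).
Proof.
  intros (K & rho & HK & Hr & Ha).
  exists (K * rho), rho; repeat split; auto; [now apply Rmult_le_pos|].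
  intros m; unfold PS_derive.
  rewrite Rabs_mult, (Rabs_pos_eq (INR (S m))) by apply pos_INR.
  apply Rle_trans with (INR (S m) * (K * rho ^ S m / INR (fact (S m)))).
  - apply Rmult_le_compat_l; [apply pos_INR | apply Ha].
  - apply Req_le; rewrite fact_simpl, mult_INR; simpl pow.
    field; split; [apply INR_fact_neq_0 | apply not_0_INR; lia].
Qed.

(** Multiplying the remainder of order [m] by [w] leaves the new error [(m + 1) z^m (w - z)^2]. The
    crude bound [m + 1 <= 3 * 4^m] makes the two contributions [4^m] and [3 * 4^m] add up to
    [4^(m + 1)]. *)
Lemma pow_increment_bound (w z : C) (r : R) (m : nat) :
  1 <= r -> Cmod w <= r -> Cmod z <= r ->
  Cmod (w ^ S m - z ^ S m - RtoC (INR (S m)) * z ^ m * (w - z)) <=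
  (4 * r) ^ m * Cmod (w - z) ^ 2.
Proof.
  intros Hr Hw Hz; induction m as [|m IH].
  - replace (w ^ 1 - z ^ 1 - RtoC (INR 1) * z ^ 0 * (w - z))%C with (RtoC 0)
      by (simpl; ring).
    rewrite Cmod_0; simpl; assert (H := Cmod_ge_0 (w - z)); nra.
  - replace (w ^ S (S m) - z ^ S (S m) - RtoC (INR (S (S m))) * z ^ S m * (w - z))%C with
      (w * (w ^ S m - z ^ S m - RtoC (INR (S m)) * z ^ m * (w - z)) +
       RtoC (INR (S m)) * z ^ m * ((w - z) * (w - z)))%C.
    2:{ rewrite !S_INR, !RtoC_plus; simpl; ring. }
    eapply Rle_trans; [apply Cmod_triangle|].
    rewrite !Cmod_mult, Cmod_R, (Rabs_pos_eq (INR (S m))), Cmod_pow by apply pos_INR.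
    set (d := Cmod (w - z)) in *.
    assert (Pd : 0 <= d ^ 2) by apply pow2_ge_0.
    assert (Pr : 0 <= r ^ m) by (apply pow_le; lra).
    assert (H1 : Cmod z ^ m <= r ^ m) by (apply pow_incr; split; [apply Cmod_ge_0 | exact Hz]).
    assert (H2 : INR (S m) <= 3 * 4 ^ m).
    { clear; induction m as [|m IH]; [simpl; lra|].
      rewrite S_INR; simpl pow; assert (1 <= 4 ^ m) by (apply pow_R1_Rle; lra). lra. }
    set (T := Cmod (w ^ S m - z ^ S m - RtoC (INR (S m)) * z ^ m * (w - z))) in *.
    assert (PT : 0 <= T) by apply Cmod_ge_0.
    rewrite Rpow_mult_distr in IH.
    assert (B1 : Cmod w * T <= r * (4 ^ m * r ^ m * d ^ 2)).
    { apply Rmult_le_compat; auto using Cmod_ge_0. }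
    assert (P4 : 0 <= 3 * 4 ^ m) by (assert (0 < 4 ^ m) by (apply pow_lt; lra); lra).
    assert (B2 : INR (S m) * Cmod z ^ m * (d * d) <= 3 * 4 ^ m * r ^ m * (d * d)).
    { apply Rmult_le_compat_r; [nra|].
      apply Rmult_le_compat; auto using pos_INR, pow_le, Cmod_ge_0. }
    assert (B3 : 3 * 4 ^ m * r ^ m * (d * d) <= r * (3 * 4 ^ m * r ^ m * d ^ 2)).
    { assert (0 <= 3 * 4 ^ m * r ^ m * d ^ 2) by (apply Rmult_le_pos; [apply Rmult_le_pos|]; assumption). nra. }
    replace ((4 * r) ^ S m * d ^ 2) with (r * (4 ^ m * r ^ m * d ^ 2) + r * (3 * 4 ^ m * r ^ m * d ^ 2))
      by (rewrite Rpow_mult_distr; simpl; ring).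
    lra.
Qed.

Lemma entsum_diff (D : C -> Prop) (a : nat -> R) (z : C) :
  entire a -> is_Cdiff D (entsum a) z (entsum (PS_derive a) z).
Proof.
  intros Ha; apply is_Cdiff_intro; intros eps Heps.
  destruct (Ha) as (K & rho & HK & Hrho & Hb).
  set (r := Cmod z + 1).
  assert (Hz := Cmod_ge_0 z).
  assert (Hr : 1 <= r) by (unfold r; lra).
  (* [M] sums the majorants [K rho^(m+1) / m! * (4 r)^m] of the second-order remainders, so the
     error is at most [M |w - z|^2]; the radius [eps / (M + 1)] turns this into [eps |w - z|]. *)
  set (M := K * rho * exp (rho * (4 * r))).
  assert (HM : 0 <= M).
  { apply Rmult_le_pos; [now apply Rmult_le_pos | left; apply exp_pos]. }
  exists (Rmin 1 (eps / (M + 1))); split.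
  { apply Rmin_pos; [lra | apply Rdiv_lt_0_compat; lra]. }
  intros w _ Hw.
  assert (Hw1 := Rlt_le_trans _ _ _ Hw (Rmin_l _ _)).
  assert (Hw2 := Rlt_le_trans _ _ _ Hw (Rmin_r _ _)).
  assert (Bw : Cmod w <= r).
  { assert (T := Cmod_triangle_inv w z); unfold r; lra. }
  assert (Bz : Cmod z <= r) by (unfold r; lra).
  assert (EW := entsum_ex a w Ha); assert (EZ := entsum_ex a z Ha).
  assert (ED := entsum_ex _ z (entire_PS_derive a Ha)).
  assert (S1 : forall y, Cex_series (fun m => RtoC (a m) * y ^ m)%C ->
     Cex_series (fun m => RtoC (a (S m)) * y ^ S m)%C).
  { intros y [Y1 Y2]; split.
    - exact (proj1 (ex_series_incr_1 _) Y1).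
    - exact (proj1 (ex_series_incr_1 _) Y2). }
  assert (EQ : (entsum a w - entsum a z - entsum (PS_derive a) z * (w - z))%C =
    CSeries (fun m => RtoC (a (S m)) *
      (w ^ S m - z ^ S m - RtoC (INR (S m)) * z ^ m * (w - z)))%C).
  { unfold entsum.
    rewrite (CSeries_incr_1 _ EW), (CSeries_incr_1 _ EZ).
    replace (RtoC (a 0%nat) * w ^ 0)%C with (RtoC (a 0%nat)) by (simpl; ring).
    replace (RtoC (a 0%nat) * z ^ 0)%C with (RtoC (a 0%nat)) by (simpl; ring).
    rewrite (CSeries_ext (fun m => RtoC (a (S m)) *
      (w ^ S m - z ^ S m - RtoC (INR (S m)) * z ^ m * (w - z)))%C
      (fun m => RtoC (a (S m)) * w ^ S m + ((- (1)) * (RtoC (a (S m)) * z ^ S m) +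
         (- (w - z)) * (RtoC (PS_derive a m) * z ^ m)))%C).
    2:{ intros m; unfold PS_derive; rewrite RtoC_mult; ring. }
    rewrite !CSeries_plus, !CSeries_scal; auto using Cex_series_scal.
    - ring.
    - apply S1 in EZ.
      assert (X := Cex_series_scal (- (1)) _ EZ); assert (Y := Cex_series_scal (- (w - z)) _ ED).
      destruct X as [X1 X2], Y as [Y1 Y2]; split.
      + exact (ex_series_plus _ _ X1 Y1).
      + exact (ex_series_plus _ _ X2 Y2). }
  rewrite EQ.
  assert (Pd := Cmod_ge_0 (w - z)).
  apply Rle_trans with (M * Cmod (w - z) ^ 2).
  2:{ apply Rmult_lt_compat_r with (r := M + 1) in Hw2; [|lra].
      unfold Rdiv in Hw2; rewrite Rmult_assoc, Rinv_l in Hw2 by lra. nra. }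
  replace (M * Cmod (w - z) ^ 2) with (Series (fun m =>
    (K * rho * Cmod (w - z) ^ 2) * ((rho * (4 * r)) ^ m / INR (fact m)))).
  2:{ rewrite (is_series_unique _ _ (is_series_scal_exp _ _)); unfold M; ring. }
  apply CSeries_bound; [|eexists; apply is_series_scal_exp].
  intros m; rewrite Cmod_mult, Cmod_R.
  apply Rle_trans with ((K * rho ^ S m / INR (fact (S m))) * ((4 * r) ^ m * Cmod (w - z) ^ 2)).
  - apply Rmult_le_compat; auto using Rabs_pos, Cmod_ge_0, pow_increment_bound.
  - rewrite (Rpow_mult_distr rho), fact_simpl, mult_INR.
    replace (K * rho * Cmod (w - z) ^ 2 * (rho ^ m * (4 * r) ^ m / INR (fact m))) with
      (K * rho ^ S m / INR (fact m) * ((4 * r) ^ m * Cmod (w - z) ^ 2))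
      by (simpl; field; apply INR_fact_neq_0).
    apply Rmult_le_compat_r.
    { apply Rmult_le_pos; [apply pow_le; lra | apply pow2_ge_0]. }
    apply Rmult_le_compat_l; [apply Rmult_le_pos; [exact HK | now apply pow_le]|].
    apply Rinv_le_contravar; [apply INR_fact_lt_0|].
    rewrite <- (Rmult_1_l (INR (fact m))) at 1.
    apply Rmult_le_compat_r; [left; apply INR_fact_lt_0|].
    rewrite S_INR; assert (H := pos_INR m); lra.
Qed.

Lemma entsum_0 (a : nat -> R) : entire a -> entsum a 0%C = RtoC (a 0%nat).
Proof.
  intros Ha; unfold entsum; rewrite CSeries_incr_1 by now apply entsum_ex.
  rewrite (CSeries_ext _ (fun m => 0 * (RtoC (a m) * 0 ^ m))%C).
  - rewrite CSeries_scal by now apply entsum_ex. simpl; ring.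
  - intros m; simpl; ring.
Qed.

(** * The logarithm *)

(** The complement of the branch cut of [Clog]. *)
Definition off_cut (z : C) : Prop := 0 < Cmod z + Im z.

Lemma off_cut_neq_0 (z : C) : off_cut z -> z <> 0%C.
Proof. intros H ->; unfold off_cut in H; rewrite Cmod_0 in H; simpl in H; lra. Qed.

Lemma off_cut_upper (z : C) : z <> 0%C -> 0 <= Im z -> off_cut z.
Proof. intros H1 H2; apply Cmod_gt_0 in H1; unfold off_cut; lra. Qed.

Lemma off_cut_open (z : C) :
  off_cut z -> exists delta, 0 < delta /\ forall w, Cmod (w - z) < delta -> off_cut w.
Proof.
  intros H; exists ((Cmod z + Im z) / 2); split; [unfold off_cut in H; lra|].
  intros w Hw; unfold off_cut in *.
  assert (T := Cmod_triangle_inv z w); rewrite Cmod_minus_sym in T.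
  assert (T2 := Im_abs_le_Cmod (w - z)).
  replace (Im (w - z)) with (Im w - Im z) in T2 by (unfold Im; simpl; ring).
  apply Rabs_le_between in T2; lra.
Qed.

Lemma off_cut_path (gam : R -> C) (t : R) (v : C) :
  off_cut (gam t) -> is_CDerive gam t v -> locally t (fun s => off_cut (gam s)).
Proof.
  intros H Hg; destruct (off_cut_open _ H) as (d & Hd & F).
  destruct (is_CDerive_continuous_eps _ _ _ Hg d Hd) as (e & He & G).
  exists (mkposreal e He); intros s Hs; apply F, G, Hs.
Qed.

Lemma off_cut_scal (r : R) (z : C) : 0 < r -> off_cut z -> off_cut (RtoC r * z).
Proof.
  unfold off_cut; intros Hr Hz.
  rewrite Cmod_mult, Cmod_R, Rabs_pos_eq by lra.
  replace (Im (RtoC r * z)) with (r * Im z) by (unfold Im; simpl; ring).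
  nra.
Qed.

Lemma off_cut_half (z : C) : off_cut z -> off_cut (z / 2).
Proof.
  intros H; assert (E : (z / 2)%C = (RtoC (/ 2) * z)%C)
    by (apply C_ext; unfold Re, Im; simpl; field).
  rewrite E; apply off_cut_scal; [lra | exact H].
Qed.

Lemma is_CDerive_Clog_path (gam : R -> C) (t : R) (v : C) :
  off_cut (gam t) -> is_CDerive gam t v ->
  is_CDerive (fun s => Clog (gam s)) t (v / gam t)%C.
Proof.
  intros Hc [G1 G2].
  assert (Hp := Cmod_sqr_pos _ (off_cut_neq_0 _ Hc)).
  unfold off_cut in Hc; unfold Cmod in Hc.
  change (fst (gam t)) with (Re (gam t)) in Hc; change (snd (gam t)) with (Im (gam t)) in Hc.
  set (x := fun s => Re (gam s)) in *; set (y := fun s => Im (gam s)) in *.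
  change (Re (gam t)) with (x t) in *; change (Im (gam t)) with (y t) in *.
  assert (E1 : Derive (fun s => x s) t = Re v) by now apply is_derive_unique.
  assert (E2 : Derive (fun s => y s) t = Im v) by now apply is_derive_unique.
  assert (X1 : ex_derive (fun s => x s) t) by now eexists; apply G1.
  assert (X2 : ex_derive (fun s => y s) t) by now eexists; apply G2.
  set (rho := sqrt (x t ^ 2 + y t ^ 2)) in *.
  assert (Hr : 0 < rho) by now apply sqrt_lt_R0.
  assert (Hr2 : rho * rho = x t ^ 2 + y t ^ 2) by (apply sqrt_sqrt; lra).
  assert (E : (v / gam t)%C =
    ((Re v * x t + Im v * y t) / (x t ^ 2 + y t ^ 2),
     (Im v * x t - Re v * y t) / (x t ^ 2 + y t ^ 2))).
  { replace (gam t) with ((x t, y t) : C) by (now apply C_ext).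
    apply C_ext; unfold Re, Im in *; simpl; field; simpl in Hp; lra. }
  rewrite E; split.
  - apply (is_derive_ext (fun s => ln (sqrt (x s ^ 2 + y s ^ 2)))); [reflexivity|].
    auto_derive.
    + replace (x t * (x t * 1) + y t * (y t * 1)) with (x t ^ 2 + y t ^ 2) by ring.
      fold rho; repeat split; auto; lra.
    + rewrite E1, E2; unfold Re, Im; cbn [fst snd pow Init.Nat.pred INR].
      replace (x t * (x t * 1) + y t * (y t * 1)) with (x t ^ 2 + y t ^ 2) by ring.
      fold rho; rewrite <- Hr2; field; lra.
  - apply (is_derive_ext (fun s => PI / 2 - 2 * atan (x s / (sqrt (x s ^ 2 + y s ^ 2) + y s))));
      [reflexivity|].
    auto_derive.
    + replace (x t * (x t * 1) + y t * (y t * 1)) with (x t ^ 2 + y t ^ 2) by ring.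
      fold rho; repeat split; auto; lra.
    + rewrite E1, E2; unfold Re, Im; cbn [fst snd pow Init.Nat.pred INR].
      replace (x t * (x t * 1) + y t * (y t * 1)) with (x t ^ 2 + y t ^ 2) by ring.
      fold rho; rewrite <- Hr2.
      generalize (fst v) (snd v); intros a b.
      (* This factorization makes the half-angle formula differentiable in closed form: the
         denominator [1 + (x / (rho + y))^2] of the derivative of [atan] collapses to
         [2 rho / (rho + y)]. *)
      assert (Hx : x t * x t = (rho - y t) * (rho + y t)) by (simpl in Hr2; lra).
      assert (HD : 1 + x t * / (rho + y t) * (x t * / (rho + y t) * 1) = 2 * rho / (rho + y t)).
      { transitivity (1 + (x t * x t) / ((rho + y t) * (rho + y t))); [field; lra|].
        rewrite Hx; field; lra. }
      rewrite HD.
      transitivity (- / rho * (a - (a * (x t * x t) + b * x t * (y t + rho)) / (rho * (rho + y t)))).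
      * field; lra.
      * rewrite Hx; field; lra.
Qed.

(** The mean value inequality is applied to [Clog] minus its linear part along the segment from [z]
    to [w], which a small radius keeps off the cut. *)
Lemma is_Cdiff_Clog (z : C) : off_cut z -> is_Cdiff off_cut Clog z (/ z)%C.
Proof.
  intros Hz; apply is_Cdiff_intro; intros eps Heps.
  assert (Nz := off_cut_neq_0 z Hz).
  assert (Pz : 0 < Cmod z) by now apply Cmod_gt_0.
  destruct (off_cut_open z Hz) as (d & Hd & F).
  (* On the segment [|gam| >= |z| / 2], hence [|1 / gam - 1 / z| <= K |w - z|]. *)
  set (K := 2 / Cmod z ^ 2).
  assert (PK : 0 < K) by (apply Rdiv_lt_0_compat; nra).
  exists (Rmin (Rmin d (Cmod z / 2)) (eps / K)); split.
  { repeat apply Rmin_pos; try lra; now apply Rdiv_lt_0_compat. }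
  intros w _ Hw.
  assert (H1 := Rlt_le_trans _ _ _ (Rlt_le_trans _ _ _ Hw (Rmin_l _ _)) (Rmin_l _ _)).
  assert (H2 := Rlt_le_trans _ _ _ (Rlt_le_trans _ _ _ Hw (Rmin_l _ _)) (Rmin_r _ _)).
  assert (H3 := Rlt_le_trans _ _ _ Hw (Rmin_r _ _)).
  assert (Pd := Cmod_ge_0 (w - z)).
  set (gam := fun t : R => (z + RtoC t * (w - z))%C).
  assert (Hg : forall t, is_CDerive gam t (w - z)%C).
  { intros t; unfold gam; eapply is_CDerive_eq.
    - apply is_CDerive_plus; [apply is_CDerive_const|].
      apply is_CDerive_mult; [apply is_CDerive_id | apply is_CDerive_const].
    - simpl; ring. }
  assert (Hdist : forall t, 0 <= t <= 1 -> Cmod (gam t - z) <= Cmod (w - z)).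
  { intros t Ht; unfold gam.
    replace (z + RtoC t * (w - z) - z)%C with (RtoC t * (w - z))%C by ring.
    rewrite Cmod_mult, Cmod_R, Rabs_pos_eq by lra; nra. }
  assert (Hfar : forall t, 0 <= t <= 1 -> Cmod z / 2 <= Cmod (gam t)).
  { intros t Ht; assert (T := Cmod_triangle_inv z (gam t)).
    rewrite Cmod_minus_sym in T; specialize (Hdist t Ht); lra. }
  assert (B := Cmod_increment_le_lin
    (fun t => Clog (gam t) - RtoC t * ((w - z) / z))%C
    (fun t => (w - z) / gam t - (w - z) / z)%C (K * Cmod (w - z) ^ 2) 0 1).
  replace (Clog w - Clog z - / z * (w - z))%C with
    (Clog (gam 1) - RtoC 1 * ((w - z) / z) - (Clog (gam 0) - RtoC 0 * ((w - z) / z)))%C.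
  2:{ unfold gam.
      replace (z + RtoC 1 * (w - z))%C with w by ring.
      replace (z + RtoC 0 * (w - z))%C with z by ring.
      field; exact Nz. }
  apply Rle_trans with (K * Cmod (w - z) ^ 2).
  - rewrite Rminus_0_r, Rmult_1_r in B; apply B; [lra| |].
    + intros t Ht; apply is_CDerive_minus.
      * apply is_CDerive_Clog_path; [|apply Hg].
        apply F; specialize (Hdist t Ht); lra.
      * eapply is_CDerive_eq.
        -- apply is_CDerive_mult; [apply is_CDerive_id | apply is_CDerive_const].
        -- simpl; ring.
    + intros t Ht.
      specialize (Hdist t Ht); specialize (Hfar t Ht).
      assert (Ng : gam t <> 0%C) by (apply Cmod_neq_0; lra).
      replace ((w - z) / gam t - (w - z) / z)%C with
        (- ((w - z) * (gam t - z)) / (gam t * z))%C by (field; auto).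
      rewrite Cmod_div, Cmod_opp, !Cmod_mult by now apply Cmult_neq_0.
      apply Rle_div_l; [apply Rmult_lt_0_compat; lra|].
      apply Rle_trans with (Cmod (w - z) * Cmod (w - z)).
      * apply Rmult_le_compat_l; assumption.
      * unfold K; apply Rle_trans with (2 / Cmod z ^ 2 * Cmod (w - z) ^ 2 * (Cmod z / 2 * Cmod z)).
        -- apply Req_le; field; lra.
        -- apply Rmult_le_compat_l; [fold K; apply Rmult_le_pos; [lra | apply pow2_ge_0]|].
           apply Rmult_le_compat_r; lra.
  - apply (Rmult_lt_compat_r K) in H3; [|exact PK].
    unfold Rdiv in H3; rewrite Rmult_assoc, Rinv_l in H3 by lra; nra.
Qed.

(** * The Hankel function *)

(** The second derivative enters Bessel's equation. Its continuity is recorded because the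
    logarithmic derivative of [psi] must be continuously differentiable in [k] for differentiation
    under the integral over a half-circle. *)
Definition Cdiff2 (f f1 f2 : C -> C) : Prop :=
  forall z, off_cut z ->
    is_Cdiff off_cut f z (f1 z) /\ is_Cdiff off_cut f1 z (f2 z) /\ Ccont off_cut f2 z.

Definition ex_Cdiff2 (f : C -> C) : Prop := exists f1 f2, Cdiff2 f f1 f2.

Lemma ex_Cdiff2_ext (f g : C -> C) :
  (forall z, off_cut z -> f z = g z) -> ex_Cdiff2 f -> ex_Cdiff2 g.
Proof.
  intros E (f1 & f2 & H); exists f1, f2; intros z Hz; destruct (H z Hz) as (H1 & H2 & H3).
  repeat split; auto; now apply (is_Cdiff_ext off_cut f).
Qed.

Lemma ex_Cdiff2_const (c : C) : ex_Cdiff2 (fun _ => c).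
Proof.
  exists (fun _ => 0%C), (fun _ => 0%C); intros z _; repeat split;
    auto using is_Cdiff_const, Ccont_const.
Qed.

Lemma ex_Cdiff2_id : ex_Cdiff2 (fun z => z).
Proof.
  exists (fun _ => 1%C), (fun _ => 0%C); intros z _; repeat split;
    auto using is_Cdiff_id, is_Cdiff_const, Ccont_const.
Qed.

Lemma ex_Cdiff2_plus (f g : C -> C) :
  ex_Cdiff2 f -> ex_Cdiff2 g -> ex_Cdiff2 (fun z => f z + g z)%C.
Proof.
  intros (f1 & f2 & F) (g1 & g2 & G).
  exists (fun z => f1 z + g1 z)%C, (fun z => f2 z + g2 z)%C; intros z Hz.
  destruct (F z Hz) as (F1 & F2 & F3), (G z Hz) as (G1 & G2 & G3).
  repeat split; auto using is_Cdiff_plus, Ccont_plus.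
Qed.

Lemma ex_Cdiff2_mult (f g : C -> C) :
  ex_Cdiff2 f -> ex_Cdiff2 g -> ex_Cdiff2 (fun z => f z * g z)%C.
Proof.
  intros (f1 & f2 & F) (g1 & g2 & G).
  exists (fun z => f1 z * g z + f z * g1 z)%C,
    (fun z => (f2 z * g z + f1 z * g1 z) + (f1 z * g1 z + f z * g2 z))%C; intros z Hz.
  destruct (F z Hz) as (F1 & F2 & F3), (G z Hz) as (G1 & G2 & G3).
  repeat split.
  - now apply is_Cdiff_mult.
  - apply is_Cdiff_plus; now apply is_Cdiff_mult.
  - apply is_Cdiff_cont in F1, F2, G1, G2.
    repeat (apply Ccont_plus || apply Ccont_mult); assumption.
Qed.

Lemma ex_Cdiff2_pow (f : C -> C) (n : nat) : ex_Cdiff2 f -> ex_Cdiff2 (fun z => f z ^ n)%C.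
Proof.
  intros F; induction n as [|n IH]; simpl.
  - apply ex_Cdiff2_const.
  - now apply ex_Cdiff2_mult.
Qed.

Lemma ex_Cdiff2_inv (f : C -> C) :
  (forall z, off_cut z -> f z <> 0%C) -> ex_Cdiff2 f -> ex_Cdiff2 (fun z => / f z)%C.
Proof.
  intros Hn (f1 & f2 & F).
  exists (fun z => - f1 z / (f z * f z))%C.
  exists (fun z => - f2 z * / (f z * f z) +
    - f1 z * (- (f1 z * f z + f z * f1 z) / ((f z * f z) * (f z * f z))))%C.
  intros z Hz; destruct (F z Hz) as (F1 & F2 & F3).
  assert (Hnn : forall w, off_cut w -> (f w * f w)%C <> 0%C)
    by (intros; apply Cmult_neq_0; auto).
  repeat split.
  - now apply is_Cdiff_inv.
  - apply (is_Cdiff_mult off_cut (fun w => - f1 w)%C (fun w => / (f w * f w))%C);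
      [now apply is_Cdiff_opp|].
    apply (is_Cdiff_inv off_cut (fun w => f w * f w)%C); auto.
    now apply is_Cdiff_mult.
  - apply is_Cdiff_cont in F1, F2.
    repeat (apply Ccont_plus || apply Ccont_mult || apply Ccont_opp || (apply Ccont_inv; auto));
      auto using Cmult_neq_0.
Qed.

Lemma ex_Cdiff2_entsum (a : nat -> R) (f : C -> C) :
  entire a -> ex_Cdiff2 f -> ex_Cdiff2 (fun z => entsum a (f z)).
Proof.
  intros Ha (f1 & f2 & F).
  set (a1 := PS_derive a); set (a2 := PS_derive a1).
  assert (Ha1 : entire a1) by now apply entire_PS_derive.
  assert (Ha2 : entire a2) by now apply entire_PS_derive.
  exists (fun z => entsum a1 (f z) * f1 z)%C,
    (fun z => (entsum a2 (f z) * f1 z) * f1 z + entsum a1 (f z) * f2 z)%C.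
  intros z Hz; destruct (F z Hz) as (F1 & F2 & F3).
  assert (C1 : forall b, entire b ->
    is_Cdiff off_cut (fun w => entsum b (f w)) z (entsum (PS_derive b) (f z) * f1 z)%C).
  { intros b Hb; apply (is_Cdiff_comp off_cut (fun _ => True) (entsum b) f); auto.
    now apply entsum_diff. }
  repeat split.
  - exact (C1 a Ha).
  - apply (is_Cdiff_mult off_cut (fun w => entsum a1 (f w)) f1); [exact (C1 a1 Ha1) | exact F2].
  - assert (D1 := is_Cdiff_cont _ _ _ _ (C1 a1 Ha1)).
    assert (D2 := is_Cdiff_cont _ _ _ _ (C1 a2 Ha2)).
    apply is_Cdiff_cont in F2.
    repeat (apply Ccont_plus || apply Ccont_mult); assumption.
Qed.

Lemma ex_Cdiff2_Clog_half : ex_Cdiff2 (fun z => Clog (z / 2)).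
Proof.
  exists (fun z => / (z / 2) * / 2)%C, (fun z => - (/ 2) / ((z / 2) * (z / 2)) * / 2)%C.
  assert (N2 : RtoC 2 <> 0%C) by (intros E; apply RtoC_inj in E; lra).
  assert (Hh : forall z, is_Cdiff off_cut (fun w => w / 2)%C z (/ 2)%C).
  { intros z; apply (is_Cdiff_eq _ _ _ (1 * / 2 + z * 0)%C); [|ring].
    apply (is_Cdiff_mult off_cut (fun w => w) (fun _ => / 2)%C);
      [apply is_Cdiff_id | apply is_Cdiff_const]. }
  intros z Hz.
  assert (Nz : forall w, off_cut w -> (w / 2)%C <> 0%C)
    by (intros; now apply off_cut_neq_0, off_cut_half).
  repeat split.
  - apply (is_Cdiff_comp off_cut off_cut Clog (fun w => w / 2)%C); auto using off_cut_half.
    now apply is_Cdiff_Clog, off_cut_half.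
  - eapply is_Cdiff_eq.
    + apply is_Cdiff_mult; [|apply is_Cdiff_const].
      apply (is_Cdiff_inv off_cut (fun w => w / 2)%C); auto.
    + cbv beta; ring.
  - assert (Hc := is_Cdiff_cont _ _ _ _ (Hh z)).
    apply Ccont_mult; [|apply Ccont_const].
    apply Ccont_mult; [apply Ccont_const|].
    apply (Ccont_inv off_cut (fun w => (w / 2) * (w / 2))%C).
    + apply Cmult_neq_0; auto.
    + now apply Ccont_mult.
Qed.

(** * The Hankel function in terms of entire series in [(z / 2)^2] *)

Definition jcoef (n m : nat) : R := (-1) ^ m / (INR (fact m) * INR (fact (n + m))).

Definition ycoef (n m : nat) : R :=
  (digammaS m + digammaS (n + m)) * (-1) ^ m / (INR (fact m) * INR (fact (n + m))).

(** Padding with zeros turns the finite principal part into an entire series, so that the three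
    parts of the Hankel function are handled by the same lemmas. *)
Definition pcoef (n m : nat) : R :=
  match n with
  | O => 0
  | S p => if (m <=? p)%nat then INR (fact (p - m)) / INR (fact m) else 0
  end.

Lemma INR_fact_ge_1 (m : nat) : 1 <= INR (fact m).
Proof. apply (le_INR 1), lt_O_fact. Qed.

Lemma harmonic_0 : harmonic 0 = 0.
Proof. unfold harmonic; rewrite sum_n_m_zero by lia; reflexivity. Qed.

Lemma harmonic_S (m : nat) : harmonic (S m) = harmonic m + / INR (S m).
Proof. unfold harmonic; rewrite sum_n_Sm by lia; reflexivity. Qed.

Lemma harmonic_bounds (m : nat) : 0 <= harmonic m <= INR m.
Proof.
  induction m as [|m IH].
  - rewrite harmonic_0; simpl; lra.
  - rewrite harmonic_S, S_INR; assert (H := pos_INR m).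
    assert (H1 : 0 < / (INR m + 1)) by (apply Rinv_0_lt_compat; lra).
    assert (H2 : / (INR m + 1) <= 1) by (rewrite <- Rinv_1; apply Rinv_le_contravar; lra).
    lra.
Qed.

Lemma Rabs_signed_coef_le (n m : nat) (x : R) :
  Rabs (x * (-1) ^ m / (INR (fact m) * INR (fact (n + m)))) <= Rabs x / INR (fact m).
Proof.
  assert (F1 := INR_fact_lt_0 m); assert (F2 := INR_fact_ge_1 (n + m)).
  unfold Rdiv; rewrite !Rabs_mult, pow_1_abs, Rabs_inv, Rabs_mult,
    (Rabs_pos_eq (INR (fact m))), (Rabs_pos_eq (INR (fact (n + m)))) by lra.
  rewrite Rmult_1_r; apply Rmult_le_compat_l; [apply Rabs_pos|].
  apply Rinv_le_contravar; nra.
Qed.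

Lemma entire_jcoef (n : nat) : entire (jcoef n).
Proof.
  exists 1, 1; repeat split; try lra; intros m; rewrite pow1, Rmult_1_r.
  unfold jcoef; rewrite <- (Rmult_1_l ((-1) ^ m)).
  eapply Rle_trans; [apply Rabs_signed_coef_le|]; rewrite Rabs_R1; lra.
Qed.

Lemma INR_le_pow2 (m : nat) : INR m <= 2 ^ m.
Proof.
  induction m as [|m IH]; [simpl; lra|].
  rewrite S_INR; simpl pow; assert (1 <= 2 ^ m) by (apply pow_R1_Rle; lra); lra.
Qed.

(** The digamma values grow at most linearly; replacing [m] by [2^m] absorbs this growth into the
    exponential type, which is why [rho] is [2] here and [1] for [jcoef]. *)
Lemma entire_ycoef (n : nat) : entire (ycoef n).
Proof.
  set (g := Rabs euler_gamma); assert (Hg : 0 <= g) by apply Rabs_pos.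
  exists (2 + INR n + 2 * g), 2.
  assert (Hn := pos_INR n).
  repeat split; try lra; intros m.
  eapply Rle_trans; [apply Rabs_signed_coef_le|].
  apply Rmult_le_compat_r; [left; apply Rinv_0_lt_compat, INR_fact_lt_0|].
  assert (H1 := harmonic_bounds m); assert (H2 := harmonic_bounds (n + m)).
  rewrite plus_INR in H2.
  assert (H3 := INR_le_pow2 m).
  assert (H4 : 1 <= 2 ^ m) by (apply pow_R1_Rle; lra).
  assert (H5 : Rabs (digammaS m + digammaS (n + m)) <= 2 * INR m + INR n + 2 * g).
  { unfold digammaS.
    replace (harmonic m - euler_gamma + (harmonic (n + m) - euler_gamma)) with
      ((harmonic m + harmonic (n + m)) + - (2 * euler_gamma)) by ring.
    eapply Rle_trans; [apply Rabs_triang|].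
    rewrite Rabs_Ropp, Rabs_mult, (Rabs_pos_eq 2), (Rabs_pos_eq (_ + _)) by lra.
    fold g; lra. }
  nra.
Qed.

Lemma entire_pcoef (n : nat) : entire (pcoef n).
Proof.
  destruct n as [|p]; unfold pcoef.
  - exists 0, 0; repeat split; try lra; intros m; rewrite Rabs_R0; unfold Rdiv; lra.
  - exists (INR (fact p)), 1; repeat split; try lra; [apply pos_INR|].
    intros m; rewrite pow1, Rmult_1_r.
    assert (F := INR_fact_lt_0 m); assert (Fp := INR_fact_lt_0 p).
    destruct (Nat.leb_spec m p) as [H|H].
    + rewrite Rabs_pos_eq.
      * apply Rmult_le_compat_r; [left; now apply Rinv_0_lt_compat|].
        apply le_INR, fact_le; lia.
      * apply Rlt_le, Rdiv_lt_0_compat; apply INR_fact_lt_0.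
    + rewrite Rabs_R0; apply Rlt_le, Rdiv_lt_0_compat; assumption.
Qed.

Lemma Series_finite (a : nat -> R) (p : nat) :
  (forall m, (p < m)%nat -> a m = 0) -> Series a = sum_n a p.
Proof.
  intros H; apply is_series_unique.
  apply (filterlim_ext_loc (fun _ => sum_n a p)); [|apply filterlim_const].
  exists p; intros m Hm; induction Hm as [|m Hm IH]; [reflexivity|].
  rewrite sum_Sn, <- IH, H by lia; exact (eq_sym (Rplus_0_r _)).
Qed.

Lemma CSeries_finite (u : nat -> C) (p : nat) :
  (forall m, (p < m)%nat -> u m = 0%C) -> CSeries u = sum_n u p.
Proof.
  intros H.
  assert (E : forall m, sum_n u m = (sum_n (fun j => Re (u j)) m, sum_n (fun j => Im (u j)) m)).
  { intros m; induction m as [|m IH].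
    - rewrite !sum_O; now apply C_ext.
    - rewrite !sum_Sn, IH; reflexivity. }
  rewrite E; unfold CSeries.
  rewrite (Series_finite (fun m => Re (u m)) p), (Series_finite (fun m => Im (u m)) p);
    try reflexivity; intros m Hm; now rewrite H.
Qed.

Lemma Cpow_even_shift (t : C) (m n : nat) : (t ^ (2 * m + n) = t ^ n * (t ^ 2) ^ m)%C.
Proof. rewrite Cpow_add_r, Cpow_mult_r; ring. Qed.

Lemma sum_n_C_ext_loc (u v : nat -> C) (p : nat) :
  (forall m, (m <= p)%nat -> u m = v m) -> sum_n u p = sum_n v p.
Proof. intros H; now apply sum_n_ext_loc. Qed.

Lemma BesselJ_entsum (n : nat) (z : C) :
  BesselJ n z = ((z / 2) ^ n * entsum (jcoef n) ((z / 2) ^ 2))%C.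
Proof.
  unfold BesselJ, entsum.
  rewrite <- CSeries_scal by apply entsum_ex, entire_jcoef.
  apply CSeries_ext; intros m; rewrite Cpow_even_shift; unfold jcoef; ring.
Qed.

Lemma BesselY_principal_entsum (n : nat) (z : C) :
  BesselY_principal n z = (entsum (pcoef n) ((z / 2) ^ 2) / (z / 2) ^ n)%C.
Proof.
  destruct n as [|p].
  - unfold BesselY_principal, entsum, pcoef.
    rewrite (CSeries_ext _ (fun m => 0 * (RtoC 0 * ((z / 2) ^ 2) ^ m))%C) by (intros; ring).
    rewrite CSeries_scal; [unfold Cdiv; ring|].
    apply (entsum_ex (fun _ => 0)), (entire_pcoef 0).
  - unfold BesselY_principal; f_equal.
    unfold entsum; rewrite (CSeries_finite _ p).
    + apply sum_n_C_ext_loc; intros m Hm; unfold pcoef.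
      rewrite (proj2 (Nat.leb_le m p)) by lia.
      now rewrite Cpow_mult_r.
    + intros m Hm; unfold pcoef.
      rewrite (proj2 (Nat.leb_gt m p)) by lia; ring.
Qed.

(** The bracket multiplying [(z/2)^n] in [HankelH], as a function of [t = z/2]. *)
Definition hankel_reg (n : nat) (t : C) : C :=
  ((1 + RtoC (2 / PI) * Ci * Clog t) * entsum (jcoef n) (t ^ 2)
   - RtoC (/ PI) * Ci * entsum (ycoef n) (t ^ 2))%C.

Lemma HankelH_form (n : nat) (z : C) :
  HankelH n z = ((z / 2) ^ n * hankel_reg n (z / 2)
    - RtoC (/ PI) * Ci * (entsum (pcoef n) ((z / 2) ^ 2) / (z / 2) ^ n))%C.
Proof.
  unfold HankelH, BesselY.
  rewrite BesselJ_entsum, BesselY_principal_entsum.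
  rewrite (CSeries_ext (fun m => RtoC ((digammaS m + digammaS (n + m)) * (-1) ^ m /
             (INR (fact m) * INR (fact (n + m)))) * (z / 2) ^ (2 * m + n))%C
    (fun m => (z / 2) ^ n * (RtoC (ycoef n m) * ((z / 2) ^ 2) ^ m))%C).
  - rewrite CSeries_scal by apply entsum_ex, entire_ycoef.
    fold (entsum (ycoef n) ((z / 2) ^ 2)); unfold hankel_reg; ring.
  - intros m; rewrite Cpow_even_shift; unfold ycoef; ring.
Qed.

Lemma off_cut_half_pow_neq_0 (n : nat) (z : C) : off_cut z -> ((z / 2) ^ n)%C <> 0%C.
Proof. intros H; now apply Cpow_nz, off_cut_neq_0, off_cut_half. Qed.

Lemma ex_Cdiff2_HankelH (n : nat) : ex_Cdiff2 (HankelH n).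
Proof.
  assert (Hh : ex_Cdiff2 (fun z => z / 2)%C)
    by (apply ex_Cdiff2_mult; [apply ex_Cdiff2_id | apply ex_Cdiff2_const]).
  assert (Hs : ex_Cdiff2 (fun z => (z / 2) ^ 2)%C)
    by (apply (ex_Cdiff2_pow (fun z => z / 2)%C); exact Hh).
  assert (Hn : ex_Cdiff2 (fun z => (z / 2) ^ n)%C)
    by (apply (ex_Cdiff2_pow (fun z => z / 2)%C); exact Hh).
  eapply ex_Cdiff2_ext; [intros z _; symmetry; apply HankelH_form|].
  unfold hankel_reg.
  apply (ex_Cdiff2_ext (fun z =>
    (z / 2) ^ n * ((1 + RtoC (2 / PI) * Ci * Clog (z / 2)) * entsum (jcoef n) ((z / 2) ^ 2)
    + - (RtoC (/ PI) * Ci) * entsum (ycoef n) ((z / 2) ^ 2))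
    + - (RtoC (/ PI) * Ci) * (entsum (pcoef n) ((z / 2) ^ 2) * / (z / 2) ^ n))%C).
  { intros z Hz; unfold Cdiv; ring. }
  repeat (apply ex_Cdiff2_plus || apply ex_Cdiff2_mult); auto using ex_Cdiff2_const,
    ex_Cdiff2_Clog_half, ex_Cdiff2_entsum, entire_jcoef, entire_ycoef, entire_pcoef.
  apply (ex_Cdiff2_inv (fun z => (z / 2) ^ n)%C); [|exact Hn].
  intros z Hz; now apply off_cut_half_pow_neq_0.
Qed.

(** * The Hankel function on the positive imaginary axis *)

Lemma ln_le_sub_1 (x : R) : 0 < x -> ln x <= x - 1.
Proof.
  intros Hx; assert (H := exp_ineq1_le (ln x)); rewrite exp_ln in H by exact Hx; lra.
Qed.

Lemma ln_ge_1_sub_inv (x : R) : 0 < x -> 1 - / x <= ln x.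
Proof.
  intros Hx; assert (H := ln_le_sub_1 (/ x) (Rinv_0_lt_compat _ Hx)).
  rewrite ln_Rinv in H by exact Hx; lra.
Qed.

Lemma ln_succ_bounds (x : R) : 0 < x -> / (x + 1) <= ln (x + 1) - ln x <= / x.
Proof.
  intros Hx; rewrite <- ln_div by lra.
  assert (P : 0 < (x + 1) / x) by (apply Rdiv_lt_0_compat; lra).
  assert (H1 := ln_le_sub_1 _ P); assert (H2 := ln_ge_1_sub_inv _ P).
  replace ((x + 1) / x - 1) with (/ x) in H1 by (field; lra).
  replace (1 - / ((x + 1) / x)) with (/ (x + 1)) in H2 by (field; lra).
  lra.
Qed.

(** Both bounds come from [1 / (x + 1) <= ln (x + 1) - ln x <= 1 / x]: the left-hand sequence
    increases, the right-hand one decreases, and they enclose their common limit. *)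
Lemma euler_gamma_bounds (m : nat) :
  harmonic m - ln (INR (S m)) <= euler_gamma <= harmonic (S m) - ln (INR (S m)).
Proof.
  set (u := fun m => harmonic (S m) - ln (INR (S m))).
  set (v := fun m => harmonic m - ln (INR (S m))).
  assert (Hpos : forall k, 0 < INR (S k)) by (intros; apply lt_0_INR; lia).
  assert (Hu : forall k, u (S k) <= u k).
  { intros k; unfold u; rewrite (harmonic_S (S k)), (S_INR (S k)).
    assert (H := ln_succ_bounds _ (Hpos k)); lra. }
  assert (Hv : forall k, v k <= v (S k)).
  { intros k; unfold v; rewrite (harmonic_S k), (S_INR (S k)).
    assert (H := ln_succ_bounds _ (Hpos k)); lra. }
  assert (Hvu : forall k, v k <= u k).
  { intros k; unfold u, v; rewrite harmonic_S.
    assert (H := Rinv_0_lt_compat _ (Hpos k)); lra. }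
  assert (Hu' : forall j k, (j <= k)%nat -> u k <= u j).
  { intros j k Hjk; induction Hjk; [lra | eapply Rle_trans; [apply Hu | eassumption]]. }
  assert (Hv' : forall j k, (j <= k)%nat -> v j <= v k).
  { intros j k Hjk; induction Hjk; [lra | eapply Rle_trans; [eassumption | apply Hv]]. }
  assert (Hvu' : forall j k, v j <= u k).
  { intros j k; destruct (Nat.le_ge_cases j k) as [H|H].
    - eapply Rle_trans; [apply Hv', H | apply Hvu].
    - eapply Rle_trans; [apply Hvu | apply Hu', H]. }
  assert (Hl : is_lim_seq u (Finite euler_gamma)).
  { assert (E := Lim_seq_correct' u (ex_finite_lim_seq_decr u (v 0%nat) Hu (Hvu' 0%nat))).
    (* Shifting by one discards the index [0], where [ln (INR 0)] is only a default value. *)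
    unfold euler_gamma; rewrite <- Lim_seq_incr_1; exact E. }
  split.
  - apply (is_lim_seq_le (fun _ => v m) u (v m) euler_gamma); auto using is_lim_seq_const.
  - now apply (is_lim_seq_decr_compare u euler_gamma).
Qed.

Lemma digammaS_bounds (m : nat) :
  ln (INR (S m)) - / INR (S m) <= digammaS m <= ln (INR (S m)).
Proof.
  unfold digammaS; assert (H := euler_gamma_bounds m); rewrite harmonic_S in H; lra.
Qed.

Lemma Series_mono (a b : nat -> R) :
  (forall m, a m <= b m) -> ex_series a -> ex_series b -> Series a <= Series b.
Proof.
  intros H Ha Hb.
  assert (E : Series b - Series a = Series (fun m => b m - a m)) by (now rewrite Series_minus).
  assert (P : 0 <= Series (fun m => b m - a m)); [|lra].
  replace 0 with (Series (fun _ => 0)).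
  - apply Series_le; [intros m; specialize (H m); lra|].
    now apply (ex_series_minus b a).
  - rewrite (Series_ext _ (fun m => 0 * a m)) by (intros; ring).
    rewrite Series_scal_l; ring.
Qed.

Lemma pow_fact_le_exp (x : R) (m : nat) : 0 <= x -> x ^ m / INR (fact m) <= exp x.
Proof.
  intros Hx.
  assert (Hp : forall j, 0 <= x ^ j / INR (fact j)).
  { intros j; apply Rmult_le_pos; [now apply pow_le|].
    left; apply Rinv_0_lt_compat, INR_fact_lt_0. }
  assert (H : sum_n (fun j => x ^ j / INR (fact j)) m <= exp x).
  { apply (is_lim_seq_incr_compare (sum_n (fun j => x ^ j / INR (fact j)))).
    - apply is_series_exp.
    - intros k; rewrite sum_Sn; unfold plus; simpl; specialize (Hp (S k)); simpl in Hp; lra. }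
  eapply Rle_trans; [|exact H].
  destruct m as [|m]; [rewrite sum_O; lra|].
  rewrite sum_Sn; unfold plus; cbn [AbelianMonoid.plus R_AbelianMonoid].
  enough (0 <= sum_n (fun j => x ^ j / INR (fact j)) m) by (simpl in *; lra).
  clear H; induction m as [|m IH]; [rewrite sum_O; apply Hp|].
  rewrite sum_Sn; unfold plus; simpl; specialize (Hp (S m)); simpl in *; lra.
Qed.

Lemma is_series_of_shift (a : nat -> R) (l : R) :
  is_series (fun k => a (S k)) (l - a 0%nat) -> is_series a l.
Proof. intros H; apply is_series_decr_1; exact H. Qed.

Lemma is_series_shift (a : nat -> R) (l : R) :
  is_series a l -> is_series (fun k => a (S k)) (l - a 0%nat).
Proof.
  intros H; apply is_series_incr_1.
  refine (eq_ind l (fun x : R => is_series a x) H _ _); unfold plus; simpl; ring.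
Qed.

(** * Concentration of the weights of the modified Bessel series *)

Section ModifiedBesselWeights.
Context (n : nat) (s : R) (Hs : 1 <= s).

(** The terms of the series of the modified Bessel function [I_n(2s)], up to
    the factor [s^n]. *)
Definition weight (m : nat) : R := (s ^ 2) ^ m / (INR (fact m) * INR (fact (n + m))).

Let Q (m : nat) : R := INR (S m) * INR (S (n + m)).

Lemma weight_pos (m : nat) : 0 < weight m.
Proof.
  apply Rdiv_lt_0_compat; [apply pow_lt; nra|].
  apply Rmult_lt_0_compat; apply INR_fact_lt_0.
Qed.

Lemma weight_S (m : nat) : INR (S m) * INR (S (n + m)) * weight (S m) = s ^ 2 * weight m.
Proof.
  unfold weight; replace (n + S m)%nat with (S (n + m)) by lia.
  rewrite !fact_simpl, !mult_INR; simpl pow.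
  field; repeat split; try apply INR_fact_neq_0; apply not_0_INR; lia.
Qed.

Lemma weight_le (m : nat) : weight m <= (s ^ 2) ^ m / INR (fact m).
Proof.
  unfold weight, Rdiv; apply Rmult_le_compat_l; [apply pow_le; nra|].
  apply Rinv_le_contravar; [apply INR_fact_lt_0|].
  assert (H1 := INR_fact_lt_0 m); assert (H2 := INR_fact_ge_1 (n + m)); nra.
Qed.

Lemma ex_series_weight : ex_series weight.
Proof.
  apply (ex_series_of_le _ (fun m => (s ^ 2) ^ m / INR (fact m))).
  - intros m; rewrite Rabs_pos_eq by (left; apply weight_pos); apply weight_le.
  - eexists; apply is_series_exp.
Qed.

(** Each term factors as [s^(n+m) / (n+m)!], which is at most [exp s], times [s^m / m!]; the latter
    factors again sum to [exp s]. *)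
Lemma weight_sum_le_exp : s ^ n * Series weight <= exp (2 * s).
Proof.
  rewrite <- Series_scal_l.
  replace (exp (2 * s)) with (Series (fun m => exp s * (s ^ m / INR (fact m)))).
  2:{ rewrite (is_series_unique _ _ (is_series_scal_exp _ _)), <- exp_plus; f_equal; ring. }
  apply Series_le; [|eexists; apply is_series_scal_exp].
  intros m; split.
  - apply Rmult_le_pos; [apply pow_le; lra | left; apply weight_pos].
  - assert (E := pow_fact_le_exp s (n + m) ltac:(lra)).
    replace (s ^ n * weight m) with (s ^ (n + m) / INR (fact (n + m)) * (s ^ m / INR (fact m))).
    + apply Rmult_le_compat_r; [|exact E].
      apply Rmult_le_pos; [apply pow_le; lra | left; apply Rinv_0_lt_compat, INR_fact_lt_0].
    + unfold weight; rewrite pow_add, <- pow_mult.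
      replace (2 * m)%nat with (m + m)%nat by lia; rewrite pow_add.
      field; split; apply INR_fact_neq_0.
Qed.

Let moment (m : nat) : R := INR m * INR (n + m) * weight m.

(** With respect to the normalized weights the mean of [m (n + m)] is exactly [s^2]: by [weight_S]
    the moment series is [s^2] times the series of weights, shifted by one index. This is the
    concentration that makes [ln (s^2)] cancel the digamma values. *)
Lemma is_series_moment : is_series moment (s ^ 2 * Series weight).
Proof.
  apply is_series_of_shift.
  replace (s ^ 2 * Series weight - moment 0%nat) with (s ^ 2 * Series weight).
  - apply (is_series_ext (fun m => s ^ 2 * weight m)).
    + intros m; unfold moment; rewrite <- weight_S.
      now replace (n + S m)%nat with (S (n + m)) by lia.
    + exact (is_series_scal_l (s ^ 2) _ _ (Series_correct _ ex_series_weight)).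
  - unfold moment; simpl; ring.
Qed.

(** The summand of the Neumann-type series for [K_n(2s)]. *)
Definition deviation (m : nat) : R := digammaS m + digammaS (n + m) - ln (s ^ 2).

Lemma Q_pos (m : nat) : 0 < Q m.
Proof. apply Rmult_lt_0_compat; apply lt_0_INR; lia. Qed.

Lemma deviation_upper (m : nat) : deviation m <= Q m / s ^ 2 - 1.
Proof.
  assert (H1 := digammaS_bounds m); assert (H2 := digammaS_bounds (n + m)).
  assert (P1 : 0 < INR (S m)) by (apply lt_0_INR; lia).
  assert (P2 : 0 < INR (S (n + m))) by (apply lt_0_INR; lia).
  assert (Ps : 0 < s ^ 2) by nra.
  assert (H3 := ln_le_sub_1 (Q m / s ^ 2) (Rdiv_lt_0_compat _ _ (Q_pos m) Ps)).
  rewrite ln_div in H3 by (auto using Q_pos).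
  unfold Q in H3 at 1; rewrite ln_mult in H3 by assumption.
  unfold deviation; lra.
Qed.

(** The leading part is [ln x >= 1 - 1 / x] at [x = Q m / s^2]. The corrections [1 / (m + 1)] from
    the digamma bounds are recast as multiples of [1 / s] and [s / Q m], because sums of
    [weight m / Q m] have a closed form. *)
Lemma deviation_lower (m : nat) :
  1 - s ^ 2 / Q m - / s - s * (INR n + 1) / Q m <= deviation m.
Proof.
  assert (H1 := digammaS_bounds m); assert (H2 := digammaS_bounds (n + m)).
  assert (P1 : 1 <= INR (S m)) by (apply (le_INR 1); lia).
  assert (P2 : INR (S m) <= INR (S (n + m))) by (apply le_INR; lia).
  assert (Ps : 0 < s ^ 2) by nra.
  assert (H3 := ln_ge_1_sub_inv (Q m / s ^ 2) (Rdiv_lt_0_compat _ _ (Q_pos m) Ps)).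
  rewrite ln_div in H3 by (auto using Q_pos).
  unfold Q in H3 at 2; rewrite ln_mult in H3 by lra.
  assert (PQ := Q_pos m).
  replace (/ (Q m / s ^ 2)) with (s ^ 2 / Q m) in H3 by (field; split; lra).
  assert (H4 : / INR (S (n + m)) <= / INR (S m)) by (apply Rinv_le_contravar; lra).
  (* AM-GM *)
  assert (H5 : 2 * / INR (S m) <= / s + s * / INR (S m) ^ 2).
  { assert (0 <= / s * (1 - s * / INR (S m)) ^ 2).
    { apply Rmult_le_pos; [left; apply Rinv_0_lt_compat; lra | apply pow2_ge_0]. }
    replace (/ s * (1 - s * / INR (S m)) ^ 2) with
      (/ s + s * / INR (S m) ^ 2 - 2 * / INR (S m)) in H by (field; lra).
    lra. }
  assert (H6 : s * / INR (S m) ^ 2 <= s * (INR n + 1) / Q m).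
  { unfold Rdiv; rewrite Rmult_assoc; apply Rmult_le_compat_l; [lra|].
    unfold Q.
    replace (INR (S (n + m))) with (INR (S m) + INR n) in *
      by (rewrite !S_INR, plus_INR; ring).
    assert (Hn := pos_INR n).
    apply Rmult_le_reg_l with (INR (S m) ^ 2 * (INR (S m) + INR n)); [nra|].
    field_simplify; [|lra|lra]. nra. }
  unfold deviation; lra.
Qed.

(** At [- s^2] the alternating signs of [ycoef] disappear, so the series is the real part of a
    convergent entire series minus a multiple of the series of weights. *)
Lemma ex_series_deviation : ex_series (fun m => deviation m * weight m).
Proof.
  destruct (entsum_ex (ycoef n) (RtoC (- s ^ 2)) (entire_ycoef n)) as [H _].
  apply (ex_series_ext (fun m =>
    minus ((fun m => Re (RtoC (ycoef n m) * RtoC (- s ^ 2) ^ m)) m)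
      ((fun m => ln (s ^ 2) * weight m) m))).
  - intros m; rewrite <- RtoC_pow, <- RtoC_mult.
    unfold minus, plus, opp, deviation, weight, ycoef; simpl.
    replace (- (s * (s * 1))) with ((-1) * (s * (s * 1))) by ring.
    rewrite Rpow_mult_distr.
    assert (E : (-1) ^ m * (-1) ^ m = 1) by (rewrite <- Rpow_mult_distr;
      replace (-1 * -1) with 1 by ring; apply pow1).
    transitivity ((digammaS m + digammaS (n + m)) * ((-1) ^ m * (-1) ^ m) * (s * (s * 1)) ^ m /
      (INR (fact m) * INR (fact (n + m))) -
      ln (s * (s * 1)) * ((s * (s * 1)) ^ m / (INR (fact m) * INR (fact (n + m))))).
    + field; split; apply INR_fact_neq_0.
    + rewrite E; field; split; apply INR_fact_neq_0.
  - exact (ex_series_minus _ _ H (ex_series_scal_l (ln (s ^ 2)) _ ex_series_weight)).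
Qed.

(** The bounds on [deviation] are chosen so that their weighted sums can be evaluated. The terms of
    order one cancel in both of them, and what remains is of relative size [1 / s]. *)
Lemma deviation_sum_bound :
  Rabs (Series (fun m => deviation m * weight m)) <= (INR n + 3) / s * Series weight.
Proof.
  assert (Hn := pos_INR n).
  assert (Ew := ex_series_weight).
  assert (Sw := Series_correct _ Ew).
  set (T := Series weight) in *.
  assert (PT : 0 <= T).
  { replace 0 with (Series (fun m => 0 * weight m)) by (rewrite Series_scal_l; ring).
    apply Series_le; auto; intros m; assert (H := weight_pos m); lra. }
  assert (Ps2 : s <= s ^ 2) by nra.
  assert (Pis : 0 < / s) by (apply Rinv_0_lt_compat; lra).
  apply Rabs_le_between; split.
  (* Since [s^2 / Q m * weight m = weight (S m)], the lower bound becomes a combination of the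
     series of weights and its shift. *)
  - set (lo := fun m => (1 - / s) * weight m - (s ^ 2 + s * (INR n + 1)) / s ^ 2 * weight (S m)).
    assert (Sl : is_series lo ((1 - / s) * T - (s ^ 2 + s * (INR n + 1)) / s ^ 2 * (T - weight 0%nat))).
    { exact (is_series_minus _ _ _ _ (is_series_scal_l (1 - / s) _ _ Sw)
        (is_series_scal_l ((s ^ 2 + s * (INR n + 1)) / s ^ 2) _ _ (is_series_shift _ _ Sw))). }
    apply Rle_trans with (Series lo).
    + rewrite (is_series_unique _ _ Sl).
      assert (W0 := weight_pos 0).
      assert (H : 0 <= (s ^ 2 + s * (INR n + 1)) / s ^ 2 * weight 0%nat).
      { apply Rmult_le_pos; [|lra]. apply Rmult_le_pos; [nra|].
        left; apply Rinv_0_lt_compat; nra. }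
      replace ((1 - / s) * T - (s ^ 2 + s * (INR n + 1)) / s ^ 2 * (T - weight 0%nat)) with
        (- (INR n + 2) / s * T + (s ^ 2 + s * (INR n + 1)) / s ^ 2 * weight 0%nat) by (field; lra).
      assert (0 <= / s * T) by (apply Rmult_le_pos; lra).
      unfold Rdiv in *; nra.
    + apply Series_mono; [| eexists; exact Sl | apply ex_series_deviation].
      intros m; unfold lo.
      assert (W := weight_pos m); assert (D := deviation_lower m); assert (PQ := Q_pos m).
      replace (weight (S m)) with (s ^ 2 / Q m * weight m).
      2:{ assert (E := weight_S m); fold (Q m) in E.
          apply Rmult_eq_reg_l with (Q m); [|lra]; rewrite E; field; lra. }
      apply (Rmult_le_compat_r (weight m)) in D; [|lra].
      eapply Rle_trans; [|exact D]; apply Req_le; field; split; lra.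
  (* Here [Q m = m (n + m) + 2 m + n + 1], and [2 m <= s + m (n + m) / s] removes the linear term;
     only the moment and the total mass are left. *)
  - set (up := fun m => (1 + / s) / s ^ 2 * moment m + ((s + INR n + 1) / s ^ 2 - 1) * weight m).
    assert (Su : is_series up ((1 + / s) / s ^ 2 * (s ^ 2 * T) + ((s + INR n + 1) / s ^ 2 - 1) * T)).
    { exact (is_series_plus _ _ _ _ (is_series_scal_l ((1 + / s) / s ^ 2) _ _ is_series_moment)
        (is_series_scal_l ((s + INR n + 1) / s ^ 2 - 1) _ _ Sw)). }
    apply Rle_trans with (Series up).
    + apply Series_mono; [| apply ex_series_deviation | eexists; exact Su].
      intros m; unfold up, moment.
      assert (W := weight_pos m); assert (D := deviation_upper m).
      apply (Rmult_le_compat_r (weight m)) in D; [|lra].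
      eapply Rle_trans; [exact D|].
      replace ((1 + / s) / s ^ 2 * (INR m * INR (n + m) * weight m) +
        ((s + INR n + 1) / s ^ 2 - 1) * weight m) with
        ((((1 + / s) * (INR m * INR (n + m)) + (s + INR n + 1)) / s ^ 2 - 1) * weight m)
        by (field; lra).
      apply Rmult_le_compat_r; [lra|].
      apply Rplus_le_compat_r, Rmult_le_compat_r; [left; apply Rinv_0_lt_compat; nra|].
      unfold Q; rewrite !S_INR, plus_INR.
      assert (Hm := pos_INR m).
      assert (A1 : 2 * INR m <= s + / s * INR m ^ 2).
      { assert (0 <= / s * (s - INR m) ^ 2) by (apply Rmult_le_pos; [lra | apply pow2_ge_0]).
        replace (/ s * (s - INR m) ^ 2) with (s + / s * INR m ^ 2 - 2 * INR m) in H by (field; lra).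
        lra. }
      assert (A2 : / s * INR m ^ 2 <= / s * (INR m * (INR n + INR m)))
        by (apply Rmult_le_compat_l; nra).
      nra.
    + rewrite (is_series_unique _ _ Su).
      replace ((1 + / s) / s ^ 2 * (s ^ 2 * T) + ((s + INR n + 1) / s ^ 2 - 1) * T) with
        ((2 + (INR n + 1) * / s) * (/ s * T)) by (field; lra).
      assert (0 <= / s * T) by (apply Rmult_le_pos; lra).
      assert (/ s <= 1) by (rewrite <- Rinv_1; apply Rinv_le_contravar; lra).
      unfold Rdiv; rewrite Rmult_assoc; apply Rmult_le_compat_r; [lra|]; nra.
Qed.

End ModifiedBesselWeights.

Lemma Series_zero : Series (fun _ => 0) = 0.
Proof.
  rewrite (Series_ext _ (fun _ => 0 * 0)) by (intros; ring).
  rewrite (Series_scal_l 0 (fun _ => 0)); ring.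
Qed.

Lemma entsum_RtoC (a : nat -> R) (x : R) :
  entsum a (RtoC x) = RtoC (Series (fun m => a m * x ^ m)).
Proof.
  unfold entsum, CSeries; apply C_ext.
  - apply Series_ext; intros m; rewrite <- RtoC_pow, <- RtoC_mult; reflexivity.
  - change (Series (fun m => Im (RtoC (a m) * RtoC x ^ m)%C) = 0).
    rewrite <- Series_zero; apply Series_ext; intros m;
      rewrite <- RtoC_pow, <- RtoC_mult; reflexivity.
Qed.

Lemma pow_m1_mult (m : nat) (x : R) : (-1) ^ m * (- x) ^ m = x ^ m.
Proof. rewrite <- Rpow_mult_distr; f_equal; ring. Qed.

Lemma entsum_jcoef_neg (n : nat) (s : R) :
  entsum (jcoef n) (RtoC (- s ^ 2)) = RtoC (Series (weight n s)).
Proof.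
  rewrite entsum_RtoC; f_equal; apply Series_ext; intros m.
  unfold jcoef, weight; rewrite <- (pow_m1_mult m (s ^ 2)).
  field; split; apply INR_fact_neq_0.
Qed.

Lemma entsum_ycoef_neg (n : nat) (s : R) :
  1 <= s ->
  entsum (ycoef n) (RtoC (- s ^ 2)) =
  RtoC (Series (fun m => deviation n s m * weight n s m) + ln (s ^ 2) * Series (weight n s)).
Proof.
  intros Hs; rewrite entsum_RtoC; f_equal.
  rewrite <- Series_scal_l, <- Series_plus.
  - apply Series_ext; intros m.
    unfold ycoef, deviation, weight; rewrite <- (pow_m1_mult m (s ^ 2)).
    field; split; apply INR_fact_neq_0.
  - now apply ex_series_deviation.
  - exact (ex_series_scal_l (ln (s ^ 2)) _ (ex_series_weight n s Hs)).
Qed.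

Lemma Clog_imaginary (s : R) : 0 < s -> Clog (Ci * RtoC s) = (ln s, PI / 2).
Proof.
  intros Hs; unfold Clog, Arg; rewrite Cmod_mult, Cmod_Ci, Cmod_R, Rabs_pos_eq by lra.
  replace (Re (Ci * RtoC s)) with 0 by (unfold Re; simpl; ring).
  unfold Rdiv at 2; rewrite Rmult_0_l, atan_0.
  f_equal; [f_equal|]; ring.
Qed.

(** At [t = i s] the phase of the logarithm cancels the contribution of [J_n]. *)
Lemma hankel_reg_imaginary (n : nat) (s : R) :
  1 <= s ->
  hankel_reg n (Ci * RtoC s) =
  (- Ci * RtoC (/ PI * Series (fun m => deviation n s m * weight n s m)%R))%C.
Proof.
  intros Hs; unfold hankel_reg.
  assert (E : ((Ci * RtoC s) ^ 2)%C = RtoC (- s ^ 2)).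
  { apply C_ext; unfold Re, Im; simpl; ring. }
  rewrite E, entsum_jcoef_neg, entsum_ycoef_neg, Clog_imaginary by lra.
  replace (ln (s ^ 2)) with (2 * ln s).
  2:{ replace (s ^ 2) with (s * s) by ring; rewrite ln_mult; lra. }
  assert (HP := PI_RGT_0).
  apply C_ext; unfold Re, Im; simpl; field; lra.
Qed.

Lemma pcoef_bound (n m : nat) : Rabs (pcoef n m) <= INR (fact n) / INR (fact m).
Proof.
  assert (F := INR_fact_lt_0 m).
  assert (P : 0 <= INR (fact n) / INR (fact m))
    by (apply Rlt_le, Rdiv_lt_0_compat; apply INR_fact_lt_0).
  destruct n as [|p]; unfold pcoef; [rewrite Rabs_R0; exact P|].
  destruct (Nat.leb_spec m p) as [H|H]; [|rewrite Rabs_R0; exact P].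
  rewrite Rabs_pos_eq by (apply Rlt_le, Rdiv_lt_0_compat; apply INR_fact_lt_0).
  apply Rmult_le_compat_r; [left; now apply Rinv_0_lt_compat|].
  apply le_INR, fact_le; lia.
Qed.

Lemma pcoef_zero (n m : nat) : (n <= m)%nat -> pcoef n m = 0.
Proof.
  destruct n as [|p]; intros H; [reflexivity|]; unfold pcoef.
  now rewrite (proj2 (Nat.leb_gt m p)) by lia.
Qed.

(** The series is a polynomial of degree less than [n] with coefficients at most [n! / m!], so each
    power is at most [s^n], and the sum of [1 / m!] contributes [exp 1]. *)
Lemma entsum_pcoef_bound (n : nat) (s : R) (z : C) :
  1 <= s -> Cmod z <= s -> Cmod (entsum (pcoef n) z) <= INR (fact n) * exp 1 * s ^ n.
Proof.
  intros Hs Hz.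
  replace (INR (fact n) * exp 1 * s ^ n) with
    (Series (fun m => (INR (fact n) * s ^ n) * (1 ^ m / INR (fact m)))).
  2:{ rewrite (is_series_unique _ _ (is_series_scal_exp _ _)); ring. }
  apply CSeries_bound; [|eexists; apply is_series_scal_exp].
  intros m; rewrite Cmod_mult, Cmod_R, Cmod_pow, pow1.
  destruct (Nat.le_gt_cases n m) as [H|H].
  - rewrite (pcoef_zero n m H), Rabs_R0, Rmult_0_l.
    apply Rmult_le_pos; [apply Rmult_le_pos; [apply pos_INR | apply pow_le; lra]|].
    apply Rlt_le, Rdiv_lt_0_compat; [lra | apply INR_fact_lt_0].
  - replace (INR (fact n) * s ^ n * (1 / INR (fact m))) with (INR (fact n) / INR (fact m) * s ^ n)
      by (field; apply INR_fact_neq_0).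
    apply Rmult_le_compat; auto using Rabs_pos, pcoef_bound.
    + apply pow_le, Cmod_ge_0.
    + apply Rle_trans with (s ^ m).
      * apply pow_incr; split; [apply Cmod_ge_0 | exact Hz].
      * apply Rle_pow; [exact Hs | lia].
Qed.

(** Far from the true exponential decay, but sufficient: after multiplication by [sqrt x] the bound
    is still [o(exp x)], which excludes the growing solution. The gain [1 / x] over the separate
    terms of the expansion is the content of [deviation_sum_bound]. *)
Lemma HankelH_imaginary_bound (n : nat) :
  exists K, 0 <= K /\
    forall x, 2 <= x -> Cmod (HankelH n (Ci * RtoC x)) <= K * (exp x / x).
Proof.
  set (K1 := INR (fact n) * exp 1).
  assert (HK1 : 0 <= K1) by (apply Rmult_le_pos; [apply pos_INR | left; apply exp_pos]).
  assert (HP : 1 <= PI) by (assert (H := PI2_1); lra).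
  assert (Hn := pos_INR n); assert (Hf := INR_fact_lt_0 (S n)).
  exists (2 * (INR n + 3) + 2 * (K1 * INR (fact (S n)))); split; [nra|].
  intros x Hx; set (s := x / 2); assert (Hs : 1 <= s) by (unfold s; lra).
  assert (E : (Ci * RtoC x / 2)%C = (Ci * RtoC s)%C).
  { unfold s; apply C_ext; unfold Re, Im; simpl; field. }
  assert (Ht : Cmod (Ci * RtoC s) = s) by (rewrite Cmod_mult, Cmod_Ci, Cmod_R, Rabs_pos_eq; lra).
  assert (Hpi : Cmod (RtoC (/ PI) * Ci) <= 1).
  { rewrite Cmod_mult, Cmod_Ci, Cmod_R, Rmult_1_r, Rabs_pos_eq.
    - rewrite <- Rinv_1; apply Rinv_le_contravar; lra.
    - left; apply Rinv_0_lt_compat; lra. }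
  rewrite HankelH_form, E, hankel_reg_imaginary by exact Hs.
  eapply Rle_trans; [apply Cmod_triangle_minus|].
  assert (Psn : 0 < s ^ n) by (apply pow_lt; lra).
  assert (Pe := exp_pos x).
  assert (Ex : exp x = exp s * exp s) by (rewrite <- exp_plus; f_equal; unfold s; field).
  assert (B1 : Cmod ((Ci * RtoC s) ^ n *
     (- Ci * RtoC (/ PI * Series (fun m => deviation n s m * weight n s m)%R))) <=
     2 * (INR n + 3) * (exp x / x)).
  { rewrite !Cmod_mult, Cmod_pow, Ht, Cmod_opp, Cmod_Ci, Cmod_R, Rmult_1_l, Rabs_mult.
    assert (D := deviation_sum_bound n s Hs).
    assert (W := weight_sum_le_exp n s Hs).
    replace (2 * s) with x in W by (unfold s; field).
    assert (Hip : Rabs (/ PI) <= 1).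
    { rewrite Rabs_pos_eq by (left; apply Rinv_0_lt_compat; lra).
      rewrite <- Rinv_1; apply Rinv_le_contravar; lra. }
    set (S := Rabs (Series (fun m => deviation n s m * weight n s m))) in *.
    assert (PS : 0 <= S) by apply Rabs_pos.
    apply Rle_trans with (s ^ n * (1 * S)).
    { apply Rmult_le_compat_l; [lra|]; apply Rmult_le_compat_r; assumption. }
    apply Rle_trans with ((INR n + 3) / s * (s ^ n * Series (weight n s))).
    { replace ((INR n + 3) / s * (s ^ n * Series (weight n s))) with
        (s ^ n * ((INR n + 3) / s * Series (weight n s))) by ring.
      apply Rmult_le_compat_l; lra. }
    apply Rle_trans with ((INR n + 3) / s * exp x).
    { apply Rmult_le_compat_l; [|exact W].
      apply Rlt_le, Rdiv_lt_0_compat; lra. }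
    apply Req_le; unfold s; field; lra. }
  assert (B2 : Cmod (RtoC (/ PI) * Ci *
      (entsum (pcoef n) ((Ci * RtoC s) ^ 2) / (Ci * RtoC s) ^ n)) <=
      2 * (K1 * INR (fact (S n))) * (exp x / x)).
  { rewrite Cmod_mult.
    assert (Nz : ((Ci * RtoC s) ^ n)%C <> 0%C).
    { apply Cpow_nz, Cmod_neq_0; lra. }
    rewrite Cmod_div, Cmod_pow, Ht by exact Nz.
    assert (B := entsum_pcoef_bound n (s ^ 2) ((Ci * RtoC s) ^ 2) ltac:(nra)
      ltac:(rewrite Cmod_pow, Ht; lra)).
    fold K1 in B.
    set (P := Cmod (entsum (pcoef n) ((Ci * RtoC s) ^ 2))) in *.
    assert (PP : 0 <= P) by apply Cmod_ge_0.
    assert (B' : P / s ^ n <= K1 * s ^ n).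
    { apply Rle_div_l; [lra|].
      replace (K1 * s ^ n * s ^ n) with (K1 * (s ^ 2) ^ n); [exact B|].
      rewrite <- pow_mult; replace (2 * n)%nat with (n + n)%nat by lia; rewrite pow_add; ring. }
    apply Rle_trans with (1 * (K1 * s ^ n)).
    { apply Rmult_le_compat; auto using Cmod_ge_0.
      apply Rmult_le_pos; [exact PP | left; now apply Rinv_0_lt_compat]. }
    (* The exponent [S n] in place of [n] is what produces the factor [1 / s]. *)
    assert (X := pow_fact_le_exp s (S n) ltac:(lra)).
    apply Rle_div_l in X; [|exact Hf].
    assert (X2 : s ^ n <= INR (fact (S n)) * (exp x / s)).
    { rewrite Ex.
      apply Rmult_le_reg_r with s; [lra|].
      replace (INR (fact (S n)) * (exp s * exp s / s) * s) with (exp s * INR (fact (S n)) * exp s)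
        by (field; lra).
      replace (s ^ n * s) with (s ^ S n) by (simpl; ring).
      assert (E1 : 1 <= exp s) by (assert (H := exp_ineq1_le s); lra).
      assert (0 <= exp s * INR (fact (S n))) by nra.
      nra. }
    apply Rle_trans with (1 * (K1 * (INR (fact (S n)) * (exp x / s)))).
    { apply Rmult_le_compat_l; [lra|]; now apply Rmult_le_compat_l. }
    apply Req_le; unfold s; field; lra. }
  lra.
Qed.

(** * The Hankel function near the origin *)

(** The domain is open, hence contains a horizontal segment through [z], and along it both values
    are the derivative of the same function of a real variable. This identifies an abstractly given
    derivative of [HankelH] with the explicit one. *)
Lemma is_Cdiff_off_cut_unique (f : C -> C) (z l l' : C) :
  off_cut z -> is_Cdiff off_cut f z l -> is_Cdiff off_cut f z l' -> l = l'.
Proof.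
  intros Hz H H'.
  assert (G : is_CDerive (fun s => z + RtoC s)%C 0 1%C).
  { eapply is_CDerive_eq; [apply is_CDerive_plus; [apply is_CDerive_const | apply is_CDerive_id]|].
    ring. }
  assert (E : (z + RtoC 0)%C = z) by ring.
  assert (L : locally 0 (fun s => off_cut (z + RtoC s)%C)).
  { apply (off_cut_path _ _ 1%C); [now rewrite E | exact G]. }
  rewrite <- E in H, H'.
  assert (D := is_CDerive_unique _ _ _ (is_Cdiff_path _ f (fun s => z + RtoC s)%C 0 l 1%C H L G)).
  assert (D' := is_CDerive_unique _ _ _ (is_Cdiff_path _ f (fun s => z + RtoC s)%C 0 l' 1%C H' L G)).
  rewrite !Cmult_1_r in *; congruence.
Qed.

Lemma is_Cdiff_pow (D : C -> Prop) (f : C -> C) (z l : C) (n : nat) :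
  is_Cdiff D f z l ->
  is_Cdiff D (fun w => f w ^ n)%C z (RtoC (INR n) * f z ^ pred n * l)%C.
Proof.
  intros H; induction n as [|n IH].
  - eapply is_Cdiff_eq; [apply (is_Cdiff_const D 1%C) | simpl; ring].
  - eapply is_Cdiff_eq; [apply (is_Cdiff_mult D f (fun w => f w ^ n)%C); [exact H | exact IH]|].
    rewrite S_INR, RtoC_plus; destruct n as [|n]; simpl; ring.
Qed.

Lemma Cmod_Clog_bound (t : C) : 0 < Cmod t <= 1 -> Cmod t * Cmod (Clog t) <= 7.
Proof.
  intros Ht.
  assert (B : Cmod (Clog t) <= (/ Cmod t - 1) + 6).
  { eapply Rle_trans; [apply Cmod_le_Re_Im|]; apply Rplus_le_compat.
    - unfold Clog, Re; simpl.
      assert (H1 := ln_ge_1_sub_inv _ (proj1 Ht)); assert (H2 := ln_le_sub_1 _ (proj1 Ht)).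
      apply Rabs_le_between; lra.
    - unfold Clog, Im, Arg; simpl.
      assert (H := atan_bound (Re t / (Cmod t + Im t))); assert (HP := PI_4).
      apply Rabs_le_between; unfold Im in *; lra. }
  apply (Rmult_le_compat_l (Cmod t)) in B; [|lra].
  replace (Cmod t * (/ Cmod t - 1 + 6)) with (1 + 5 * Cmod t) in B by (field; lra).
  lra.
Qed.

Lemma hankel_reg_bounds (n : nat) :
  exists B, 0 <= B /\ forall t, 0 < Cmod t <= 1 -> Cmod t * Cmod (hankel_reg n t) <= B.
Proof.
  destruct (entsum_bounded (jcoef n) 1 (entire_jcoef n)) as (Mj & PMj & Bj).
  destruct (entsum_bounded (ycoef n) 1 (entire_ycoef n)) as (My & PMy & By).
  assert (HP : 3 < PI) by (assert (H := PI2_3_2); lra).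
  assert (Hip : 0 < / PI <= / 3).
  { split; [apply Rinv_0_lt_compat; lra | apply Rinv_le_contravar; lra]. }
  assert (C1 : Cmod (RtoC (/ PI) * Ci) <= 1)
    by (rewrite Cmod_mult, Cmod_Ci, Cmod_R, Rabs_pos_eq; lra).
  assert (C2 : Cmod (RtoC (2 / PI) * Ci) <= 1)
    by (rewrite Cmod_mult, Cmod_Ci, Cmod_R, Rabs_pos_eq; unfold Rdiv; lra).
  exists (1 * Mj + 1 * (7 * Mj) + 1 * (1 * My)); split; [lra|].
  intros t Ht.
  assert (Tt : Cmod (t ^ 2) <= 1) by (rewrite Cmod_pow; nra).
  specialize (Bj (t ^ 2)%C Tt); specialize (By (t ^ 2)%C Tt).
  assert (BL : Cmod (t * Clog t) <= 7) by (rewrite Cmod_mult; now apply Cmod_Clog_bound).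
  assert (Bt : Cmod t <= 1) by lra.
  rewrite <- Cmod_mult; unfold hankel_reg.
  set (EJ := entsum (jcoef n) (t ^ 2)) in *; set (EY := entsum (ycoef n) (t ^ 2)) in *.
  replace (t * ((1 + RtoC (2 / PI) * Ci * Clog t) * EJ - RtoC (/ PI) * Ci * EY))%C with
    (t * EJ + RtoC (2 / PI) * Ci * ((t * Clog t) * EJ) - RtoC (/ PI) * Ci * (t * EY))%C by ring.
  repeat (apply Cmod_minus_le || apply Cmod_plus_le || (apply C1 || apply C2) || apply Cmod_mult_le);
    assumption.
Qed.

(** [z |-> (z/2)^n H_n(z)] stays away from zero near the origin: for [n >= 1] by
    the leading term of the principal part, for [n = 0] because of the logarithm. *)
Lemma hankel_scaled_lower_bound (n : nat) :
  exists d c, 0 < d <= 1 /\ 0 < c /\ forall t, 0 < Cmod t <= d ->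
    c <= Cmod (t ^ n * (t ^ n * hankel_reg n t) - RtoC (/ PI) * Ci * entsum (pcoef n) (t ^ 2)).
Proof.
  assert (HP : 3 < PI <= 4) by (split; [assert (H := PI2_3_2); lra | apply PI_4]).
  destruct (entsum_bounded (jcoef n) 1 (entire_jcoef n)) as (Mj & PMj & Bj).
  destruct (entsum_bounded (ycoef n) 1 (entire_ycoef n)) as (My & PMy & By).
  assert (Hip : / PI <= 1) by (rewrite <- Rinv_1; apply Rinv_le_contravar; lra).
  assert (Pip : / 4 <= / PI) by (apply Rinv_le_contravar; lra).
  assert (C1 : Cmod (RtoC (/ PI) * Ci) = / PI)
    by (rewrite Cmod_mult, Cmod_Ci, Cmod_R, Rabs_pos_eq; lra).
  assert (C2 : Cmod (RtoC (2 / PI) * Ci) = 2 * / PI)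
    by (rewrite Cmod_mult, Cmod_Ci, Cmod_R, Rabs_pos_eq; unfold Rdiv; lra).
  destruct n as [|p].
  - assert (H0 := is_Cdiff_cont _ _ _ _
      (entsum_diff (fun _ => True) (jcoef 0) 0%C (entire_jcoef 0))).
    rewrite <- (Cmult_0_l 0) in H0 at 1.
    destruct (H0 (/ 2)) as (d1 & Hd1 & F); [lra|].
    rewrite Cmult_0_l, (entsum_0 _ (entire_jcoef 0)) in F.
    assert (J0 : jcoef 0 0 = 1) by (unfold jcoef; simpl; field).
    rewrite J0 in F.
    (* With [2 / PI >= 1 / 2] and [|J| >= 1 / 2], the logarithmic term is at least
       [L / 4 = 1 + Mj + My]; the other terms take away at most [Mj + My] and leave [1]. *)
    set (L := 4 * (1 + Mj + My)).
    assert (PE := exp_pos (- L)).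
    assert (PL : 4 <= L) by (unfold L; lra).
    exists (Rmin (Rmin 1 d1 / 2) (exp (- L))), 1.
    assert (Pm : 0 < Rmin 1 d1) by (apply Rmin_pos; lra).
    split; [split|split].
    + apply Rmin_pos; lra.
    + eapply Rle_trans; [apply Rmin_l|]; assert (H := Rmin_l 1 d1); lra.
    + lra.
    + intros t [Pt Ht].
      assert (T1 : Cmod t <= Rmin 1 d1 / 2) by (eapply Rle_trans; [exact Ht | apply Rmin_l]).
      assert (T2 : Cmod t <= exp (- L)) by (eapply Rle_trans; [exact Ht | apply Rmin_r]).
      assert (T3 := Rmin_l 1 d1); assert (T4 := Rmin_r 1 d1).
      assert (Tt : Cmod (t ^ 2) <= Cmod t) by (rewrite Cmod_pow; nra).
      assert (EP : entsum (pcoef 0) (t ^ 2) = 0%C).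
      { unfold entsum.
        rewrite (CSeries_ext _ (fun m => 0 * (RtoC (pcoef 0 m) * (t ^ 2) ^ m))%C)
          by (intros; unfold pcoef; ring).
        rewrite CSeries_scal by apply entsum_ex, entire_pcoef; ring. }
      rewrite EP.
      replace (t ^ 0 * (t ^ 0 * hankel_reg 0 t) - RtoC (/ PI) * Ci * 0)%C with (hankel_reg 0 t)
        by (simpl; ring).
      specialize (Bj (t ^ 2)%C ltac:(lra)); specialize (By (t ^ 2)%C ltac:(lra)).
      specialize (F (t ^ 2)%C I ltac:(replace (t ^ 2 - 0)%C with (t ^ 2)%C by ring; lra)).
      assert (EJ : / 2 <= Cmod (entsum (jcoef 0) (t ^ 2))).
      { assert (T := Cmod_triangle_inv 1%C (entsum (jcoef 0) (t ^ 2))).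
        rewrite Cmod_1, Cmod_minus_sym in T; lra. }
      assert (EL : L <= Cmod (Clog t)).
      { eapply Rle_trans; [|apply re_le_Cmod]; unfold Clog, Re; simpl.
        rewrite Rabs_left1.
        - assert (ln (Cmod t) <= - L); [|lra].
          rewrite <- (ln_exp (- L)); now apply ln_le.
        - assert (H := ln_le_sub_1 _ Pt); lra. }
      unfold hankel_reg.
      set (EJt := entsum (jcoef 0) (t ^ 2)) in *; set (EYt := entsum (ycoef 0) (t ^ 2)) in *.
      replace ((1 + RtoC (2 / PI) * Ci * Clog t) * EJt - RtoC (/ PI) * Ci * EYt)%C with
        ((RtoC (2 / PI) * Ci) * (Clog t * EJt) - (RtoC (/ PI) * Ci * EYt - EJt))%C by ring.
      assert (T := Cmod_triangle_inv ((RtoC (2 / PI) * Ci) * (Clog t * EJt))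
        (RtoC (/ PI) * Ci * EYt - EJt)).
      assert (U := Cmod_triangle_minus (RtoC (/ PI) * Ci * EYt) EJt).
      rewrite (Cmod_mult (RtoC (2 / PI) * Ci)), C2, Cmod_mult in T.
      rewrite (Cmod_mult (RtoC (/ PI) * Ci)), C1 in U.
      assert (A1 : L * / 2 <= Cmod (Clog t) * Cmod EJt) by (apply Rmult_le_compat; lra).
      assert (A2 : 2 * / 4 * (L * / 2) <= 2 * / PI * (Cmod (Clog t) * Cmod EJt))
        by (apply Rmult_le_compat; lra).
      assert (A3 : / PI * Cmod EYt <= 1 * My) by (apply Rmult_le_compat; auto using Cmod_ge_0; lra).
      unfold L in A2; lra.
  - assert (H0 := is_Cdiff_cont _ _ _ _
      (entsum_diff (fun _ => True) (pcoef (S p)) 0%C (entire_pcoef (S p)))).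
    destruct (H0 (/ 2)) as (d1 & Hd1 & F); [lra|].
    rewrite (entsum_0 _ (entire_pcoef (S p))) in F.
    assert (P0 : 1 <= pcoef (S p) 0).
    { unfold pcoef; rewrite (proj2 (Nat.leb_le 0 p)) by lia.
      rewrite Nat.sub_0_r; simpl (fact 0); simpl (INR 1); unfold Rdiv.
      rewrite Rinv_1, Rmult_1_r; apply INR_fact_ge_1. }
    destruct (hankel_reg_bounds (S p)) as (B & PB & HB).
    (* The principal part is at least [1 / 4 * 1 / 2 = 1 / 8], and the second radius keeps the
       remaining term below [1 / 16]. *)
    exists (Rmin (Rmin 1 d1 / 2) (/ (16 * (B + 1)))), (/ 16).
    assert (Pm : 0 < Rmin 1 d1) by (apply Rmin_pos; lra).
    assert (PB' : 0 < / (16 * (B + 1))) by (apply Rinv_0_lt_compat; lra).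
    split; [split|split].
    + apply Rmin_pos; lra.
    + eapply Rle_trans; [apply Rmin_l|]; assert (H := Rmin_l 1 d1); lra.
    + lra.
    + intros t [Pt Ht].
      assert (T1 : Cmod t <= Rmin 1 d1 / 2) by (eapply Rle_trans; [exact Ht | apply Rmin_l]).
      assert (T2 : Cmod t <= / (16 * (B + 1))) by (eapply Rle_trans; [exact Ht | apply Rmin_r]).
      assert (T3 := Rmin_l 1 d1); assert (T4 := Rmin_r 1 d1).
      assert (Tt : Cmod (t ^ 2) <= Cmod t) by (rewrite Cmod_pow; nra).
      specialize (F (t ^ 2)%C I ltac:(replace (t ^ 2 - 0)%C with (t ^ 2)%C by ring; lra)).
      assert (EPl : / 2 <= Cmod (entsum (pcoef (S p)) (t ^ 2))).
      { assert (T := Cmod_triangle_inv (RtoC (pcoef (S p) 0)) (entsum (pcoef (S p)) (t ^ 2))).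
        rewrite Cmod_R, Rabs_pos_eq, Cmod_minus_sym in T by lra; lra. }
      specialize (HB t ltac:(lra)).
      assert (BS : Cmod (t ^ S p * (t ^ S p * hankel_reg (S p) t)) <= / 16).
      { replace (t ^ S p * (t ^ S p * hankel_reg (S p) t))%C with
          (t ^ p * t ^ p * (t * (t * hankel_reg (S p) t)))%C by (simpl; ring).
        rewrite !Cmod_mult, Cmod_pow.
        assert (Y1 : 0 <= Cmod t ^ p <= 1).
        { split; [apply pow_le; lra|]. rewrite <- (pow1 p); apply pow_incr; lra. }
        assert (Y2 : Cmod t * (Cmod t * Cmod (hankel_reg (S p) t)) <= / (16 * (B + 1)) * B).
        { apply Rmult_le_compat; try lra; apply Rmult_le_pos; [lra | apply Cmod_ge_0]. }
        assert (Y3 : / (16 * (B + 1)) * B <= / 16).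
        { apply Rle_trans with (/ (16 * (B + 1)) * (B + 1)); [apply Rmult_le_compat_l; lra|].
          apply Req_le; field; lra. }
        assert (Y4 : 0 <= Cmod t * (Cmod t * Cmod (hankel_reg (S p) t)))
          by (repeat apply Rmult_le_pos; try lra; apply Cmod_ge_0).
        assert (Y5 : Cmod t ^ p * Cmod t ^ p <= 1) by nra.
        assert (Y6 : 0 <= Cmod t ^ p * Cmod t ^ p) by nra.
        nra. }
      rewrite Cmod_minus_sym.
      eapply Rle_trans; [|apply Cmod_triangle_inv].
      rewrite (Cmod_mult (RtoC (/ PI) * Ci)), C1.
      assert (/ 4 * / 2 <= / PI * Cmod (entsum (pcoef (S p)) (t ^ 2)))
        by (apply Rmult_le_compat; lra).
      lra.
Qed.

Lemma hankel_scaled (n : nat) (z : C) :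
  off_cut z ->
  ((z / 2) ^ n * HankelH n z)%C =
  ((z / 2) ^ n * ((z / 2) ^ n * hankel_reg n (z / 2))
   - RtoC (/ PI) * Ci * entsum (pcoef n) ((z / 2) ^ 2))%C.
Proof.
  intros Hz; assert (N := off_cut_half_pow_neq_0 n z Hz).
  rewrite HankelH_form; set (t := (z / 2)%C) in *; field; exact N.
Qed.

Lemma C2_neq_0 : RtoC 2 <> 0%C.
Proof. intros E; apply RtoC_inj in E; lra. Qed.

Lemma is_Cdiff_half (z : C) : is_Cdiff off_cut (fun w => w / 2)%C z (/ 2)%C.
Proof.
  eapply is_Cdiff_eq.
  - apply (is_Cdiff_mult off_cut (fun w => w) (fun _ => / 2)%C);
      [apply is_Cdiff_id | apply is_Cdiff_const].
  - ring.
Qed.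

Lemma is_Cdiff_entsum_half (a : nat -> R) (z : C) :
  entire a ->
  is_Cdiff off_cut (fun w => entsum a ((w / 2) ^ 2)) z
    (entsum (PS_derive a) ((z / 2) ^ 2) * (z / 2))%C.
Proof.
  intros Ha; eapply is_Cdiff_eq.
  - apply (is_Cdiff_comp off_cut (fun _ => True) (entsum a) (fun w => (w / 2) ^ 2)%C); auto.
    + now apply entsum_diff.
    + apply (is_Cdiff_pow off_cut (fun w => w / 2)%C), is_Cdiff_half.
  - cbv beta; simpl (INR 2); replace (RtoC (1 + 1)) with (RtoC 2) by (f_equal; ring).
    simpl; field; exact C2_neq_0.
Qed.

(** Near the origin [H_n] behaves like a negative power, or a logarithm when [n = 0], so [z H' / H]
    stays bounded. After multiplication by [t^n] the numerator is bounded and the denominator is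
    bounded below by [hankel_scaled_lower_bound]. *)
Lemma HankelH_log_derivative_near_0 (n : nat) :
  exists d K, 0 < d /\ 0 <= K /\ forall z, off_cut z -> Cmod z <= d ->
    HankelH n z <> 0%C /\
    forall l, is_Cdiff off_cut (HankelH n) z l -> Cmod (z * l) <= K * Cmod (HankelH n z).
Proof.
  destruct (hankel_scaled_lower_bound n) as (d & c & Hd & Hc & Hlow).
  destruct (hankel_reg_bounds n) as (B & PB & HB).
  set (aj := PS_derive (jcoef n)); set (ay := PS_derive (ycoef n)); set (ap := PS_derive (pcoef n)).
  assert (Ej : entire aj) by apply entire_PS_derive, entire_jcoef.
  assert (Ey : entire ay) by apply entire_PS_derive, entire_ycoef.
  assert (Ep : entire ap) by apply entire_PS_derive, entire_pcoef.
  destruct (entsum_bounded (jcoef n) 1 (entire_jcoef n)) as (Mj & PMj & Bj).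
  destruct (entsum_bounded (pcoef n) 1 (entire_pcoef n)) as (Mp & PMp & Bp).
  destruct (entsum_bounded aj 1 Ej) as (Mj' & PMj' & Bj').
  destruct (entsum_bounded ay 1 Ey) as (My' & PMy' & By').
  destruct (entsum_bounded ap 1 Ep) as (Mp' & PMp' & Bp').
  assert (HP : 3 < PI) by (assert (H := PI2_3_2); lra).
  assert (Hip : 0 < / PI <= / 3).
  { split; [apply Rinv_0_lt_compat; lra | apply Rinv_le_contravar; lra]. }
  assert (C1 : Cmod (RtoC (/ PI) * Ci) <= 1)
    by (rewrite Cmod_mult, Cmod_Ci, Cmod_R, Rabs_pos_eq; lra).
  assert (C2 : Cmod (RtoC (2 / PI) * Ci) <= 1)
    by (rewrite Cmod_mult, Cmod_Ci, Cmod_R, Rabs_pos_eq; unfold Rdiv; lra).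
  (* The three groups bound the three summands of [t^n (z l)] in [Ezl] below: derivative of the
     power, derivative of the regular bracket, principal part. *)
  set (K0 := INR n * B + (Mj + (2 * Mj' + 14 * Mj') + 2 * My') + (2 * Mp' + INR n * Mp)).
  assert (Hn := pos_INR n).
  assert (PK0 : 0 <= K0).
  { unfold K0; assert (0 <= INR n * B) by (now apply Rmult_le_pos).
    assert (0 <= INR n * Mp) by (now apply Rmult_le_pos). lra. }
  exists d, (K0 / c); split; [lra|]; split; [apply Rmult_le_pos; [lra | left; now apply Rinv_0_lt_compat]|].
  intros z Hz Hzd.
  set (t := (z / 2)%C).
  assert (Nz := off_cut_neq_0 z Hz).
  assert (Ez : z = (2 * t)%C) by (unfold t; field; exact C2_neq_0).
  assert (Ct : Cmod t = Cmod z / 2).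
  { rewrite Ez, Cmod_mult, Cmod_R, Rabs_pos_eq by lra; field. }
  assert (Pz : 0 < Cmod z) by now apply Cmod_gt_0.
  assert (Ht : 0 < Cmod t <= d) by lra.
  assert (Ht1 : 0 < Cmod t <= 1) by lra.
  assert (Nt : t <> 0%C) by (apply Cmod_neq_0; lra).
  assert (Ntn : (t ^ n)%C <> 0%C) by now apply Cpow_nz.
  specialize (Hlow t Ht); unfold t in Hlow; rewrite <- hankel_scaled in Hlow by exact Hz.
  fold t in Hlow; rewrite Cmod_mult in Hlow.
  assert (NH : HankelH n z <> 0%C).
  { intros E; rewrite E, Cmod_0 in Hlow; lra. }
  split; [exact NH|].
  intros l Hl.
  set (EJ := entsum (jcoef n) (t ^ 2)); set (EY := entsum (ycoef n) (t ^ 2)).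
  set (EP := entsum (pcoef n) (t ^ 2)).
  set (l1 := (RtoC (INR n) * t ^ pred n * / 2)%C).
  set (l2 := (((0 + RtoC (2 / PI) * Ci * (/ t * / 2)) * EJ +
      (1 + RtoC (2 / PI) * Ci * Clog t) * (entsum aj (t ^ 2) * t)) -
      RtoC (/ PI) * Ci * (entsum ay (t ^ 2) * t))%C).
  set (l3 := (entsum ap (t ^ 2) * t)%C).
  assert (D1 : is_Cdiff off_cut (fun w => (w / 2) ^ n)%C z l1).
  { apply (is_Cdiff_pow off_cut (fun w => w / 2)%C), is_Cdiff_half. }
  assert (D2 : is_Cdiff off_cut (fun w => hankel_reg n (w / 2)) z l2).
  { unfold hankel_reg, l2.
    apply (is_Cdiff_minus off_cut
      (fun w => (1 + RtoC (2 / PI) * Ci * Clog (w / 2)) * entsum (jcoef n) ((w / 2) ^ 2))%C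
      (fun w => RtoC (/ PI) * Ci * entsum (ycoef n) ((w / 2) ^ 2))%C).
    - apply (is_Cdiff_mult off_cut (fun w => 1 + RtoC (2 / PI) * Ci * Clog (w / 2))%C
        (fun w => entsum (jcoef n) ((w / 2) ^ 2))).
      + apply (is_Cdiff_plus off_cut (fun _ => 1%C)); [apply is_Cdiff_const|].
        apply (is_Cdiff_scal off_cut (RtoC (2 / PI) * Ci) (fun w => Clog (w / 2))).
        apply (is_Cdiff_comp off_cut off_cut Clog (fun w => w / 2)%C);
          auto using off_cut_half, is_Cdiff_half.
        now apply is_Cdiff_Clog, off_cut_half.
      + apply is_Cdiff_entsum_half, entire_jcoef.
    - apply (is_Cdiff_scal off_cut _ (fun w => entsum (ycoef n) ((w / 2) ^ 2))).
      apply is_Cdiff_entsum_half, entire_ycoef. }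
  assert (D3 : is_Cdiff off_cut (fun w => entsum (pcoef n) ((w / 2) ^ 2)) z l3)
    by (apply is_Cdiff_entsum_half, entire_pcoef).
  assert (D4 : is_Cdiff off_cut (fun w => / (w / 2) ^ n)%C z (- l1 / (t ^ n * t ^ n))%C).
  { apply (is_Cdiff_inv off_cut (fun w => (w / 2) ^ n)%C); auto.
    intros w Hw; now apply off_cut_half_pow_neq_0. }
  assert (E : l = (l1 * hankel_reg n t + t ^ n * l2 -
     RtoC (/ PI) * Ci * (l3 * / t ^ n + EP * (- l1 / (t ^ n * t ^ n))))%C).
  { apply (is_Cdiff_off_cut_unique (HankelH n) z); auto.
    apply (is_Cdiff_ext off_cut (fun w => (w / 2) ^ n * hankel_reg n (w / 2)
      - RtoC (/ PI) * Ci * (entsum (pcoef n) ((w / 2) ^ 2) * / (w / 2) ^ n))%C); auto.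
    { intros w _; symmetry; apply HankelH_form. }
    apply (is_Cdiff_minus off_cut (fun w => (w / 2) ^ n * hankel_reg n (w / 2))%C
      (fun w => RtoC (/ PI) * Ci * (entsum (pcoef n) ((w / 2) ^ 2) * / (w / 2) ^ n))%C).
    - exact (is_Cdiff_mult off_cut _ _ _ _ _ D1 D2).
    - apply (is_Cdiff_scal off_cut _ (fun w => entsum (pcoef n) ((w / 2) ^ 2) * / (w / 2) ^ n)%C).
      exact (is_Cdiff_mult off_cut _ _ _ _ _ D3 D4). }
  assert (Ezl1 : (z * l1)%C = (RtoC (INR n) * t ^ n)%C).
  { rewrite Ez; unfold l1; destruct n as [|p]; simpl pred; [simpl; ring|].
    rewrite Cpow_S; field; exact C2_neq_0. }
  assert (Ezl2 : (z * l2)%C = (RtoC (2 / PI) * Ci * EJ +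
      ((t * entsum aj (t ^ 2) * (2 * t)) +
       RtoC (2 / PI) * Ci * ((t * Clog t) * (2 * (t * entsum aj (t ^ 2)))))
      - RtoC (/ PI) * Ci * (2 * (t * (t * entsum ay (t ^ 2)))))%C).
  { rewrite Ez; unfold l2; field; exact Nt. }
  assert (Ezl : (t ^ n * (z * l))%C = ((RtoC (INR n) * (t ^ n * (t ^ n * hankel_reg n t))
      + t ^ n * (t ^ n * (z * l2)))
      - RtoC (/ PI) * Ci * (2 * (t * (t * entsum ap (t ^ 2))) - RtoC (INR n) * EP))%C).
  { rewrite E.
    replace (t ^ n * (z * (l1 * hankel_reg n t + t ^ n * l2 -
      RtoC (/ PI) * Ci * (l3 * / t ^ n + EP * (- l1 / (t ^ n * t ^ n))))))%C with
     ((z * l1) * (t ^ n * hankel_reg n t) + t ^ n * (t ^ n * (z * l2)) -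
       RtoC (/ PI) * Ci * (z * l3 - EP * ((z * l1) / t ^ n)))%C by (field; exact Ntn).
    rewrite Ezl1.
    replace (z * l3)%C with (2 * (t * (t * entsum ap (t ^ 2))))%C by (rewrite Ez; unfold l3; ring).
    field; exact Ntn. }
  assert (Tt : Cmod (t ^ 2) <= 1) by (rewrite Cmod_pow; nra).
  specialize (Bj (t ^ 2)%C Tt); specialize (Bp (t ^ 2)%C Tt).
  specialize (Bj' (t ^ 2)%C Tt); specialize (By' (t ^ 2)%C Tt); specialize (Bp' (t ^ 2)%C Tt).
  fold EJ in Bj; fold EP in Bp.
  assert (BL : Cmod (t * Clog t) <= 7) by (rewrite Cmod_mult; now apply Cmod_Clog_bound).
  assert (Bt : Cmod t <= 1) by lra.
  assert (B2 : Cmod 2%C <= 2) by (rewrite Cmod_R, Rabs_pos_eq; lra).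
  assert (Btn : Cmod (t ^ n) <= 1).
  { rewrite Cmod_pow, <- (pow1 n); apply pow_incr; lra. }
  assert (BN : Cmod (RtoC (INR n)) <= INR n) by (rewrite Cmod_R, Rabs_pos_eq; lra).
  assert (Bz2 : Cmod (z * l2) <= Mj + (2 * Mj' + 14 * Mj') + 2 * My').
  { rewrite Ezl2.
    replace (Mj + (2 * Mj' + 14 * Mj') + 2 * My') with
      (1 * Mj + (1 * Mj' * (2 * 1) + 1 * (7 * (2 * (1 * Mj')))) + 1 * (2 * (1 * (1 * My')))) by ring.
    repeat (apply Cmod_minus_le || apply Cmod_plus_le || (apply C1 || apply C2) || apply Cmod_mult_le);
      assumption. }
  assert (BR : Cmod (RtoC (INR n) * (t ^ n * (t ^ n * hankel_reg n t))) <= INR n * B).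
  (* The logarithm in [hankel_reg] is unbounded, but for [n = 0] the coefficient vanishes, and for
     [n >= 1] one spare factor [t] tames it. *)
  { destruct n as [|p]; [simpl; rewrite Cmult_0_l, Cmod_0; lra|].
    replace (RtoC (INR (S p)) * (t ^ S p * (t ^ S p * hankel_reg (S p) t)))%C with
      (RtoC (INR (S p)) * (t ^ S p * (t ^ p * (t * hankel_reg (S p) t))))%C
      by (rewrite !Cpow_S; ring).
    replace (INR (S p) * B) with (INR (S p) * (1 * (1 * B))) by ring.
    assert (Btp : Cmod (t ^ p) <= 1).
    { rewrite Cmod_pow, <- (pow1 p); apply pow_incr; lra. }
    assert (Brg : Cmod (t * hankel_reg (S p) t) <= B) by (rewrite Cmod_mult; now apply HB).
    repeat apply Cmod_mult_le; assumption. }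
  assert (BT : Cmod (t ^ n * (z * l)) <= K0).
  { rewrite Ezl; unfold K0.
    replace (2 * Mp' + INR n * Mp) with (1 * (2 * (1 * (1 * Mp')) + INR n * Mp)) by ring.
    apply Cmod_minus_le; [apply Cmod_plus_le; [exact BR|]|].
    - replace (Mj + (2 * Mj' + 14 * Mj') + 2 * My') with
        (1 * (1 * (Mj + (2 * Mj' + 14 * Mj') + 2 * My'))) by ring.
      repeat apply Cmod_mult_le; assumption.
    - apply Cmod_mult_le; [exact C1|].
      apply Cmod_minus_le; repeat apply Cmod_mult_le; assumption. }
  rewrite Cmod_mult in BT.
  assert (Ptn : 0 < Cmod (t ^ n)) by now apply Cmod_gt_0.
  apply Rmult_le_reg_l with (Cmod (t ^ n)); [exact Ptn|].
  apply Rle_trans with K0; [exact BT|].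
  replace (Cmod (t ^ n) * (K0 / c * Cmod (HankelH n z))) with
    (K0 / c * (Cmod (t ^ n) * Cmod (HankelH n z))) by ring.
  apply Rle_trans with (K0 / c * c); [apply Req_le; field; lra|].
  apply Rmult_le_compat_l; [apply Rmult_le_pos; [lra | left; now apply Rinv_0_lt_compat] | exact Hlow].
Qed.

(** * The recessive solution *)

Definition Cexp (z : C) : C := (exp (Re z) * cos (Im z), exp (Re z) * sin (Im z)).

Lemma Cmod_Cexp (z : C) : Cmod (Cexp z) = exp (Re z).
Proof.
  assert (H := exp_pos (Re z)).
  assert (E : Cmod (Cexp z) ^ 2 = exp (Re z) ^ 2).
  { rewrite Cmod2_alt; change (Re (Cexp z)) with (exp (Re z) * cos (Im z));
      change (Im (Cexp z)) with (exp (Re z) * sin (Im z)).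
    assert (T := sin2_cos2 (Im z)); unfold Rsqr in T.
    transitivity (exp (Re z) ^ 2 * (sin (Im z) * sin (Im z) + cos (Im z) * cos (Im z))); [ring|].
    rewrite T; ring. }
  assert (P := Cmod_ge_0 (Cexp z)); nra.
Qed.

Lemma Cexp_neq_0 (z : C) : Cexp z <> 0%C.
Proof. apply Cmod_neq_0; rewrite Cmod_Cexp; apply exp_pos. Qed.

Lemma is_CDerive_Cexp (f : R -> C) (t : R) (l : C) :
  is_CDerive f t l -> is_CDerive (fun s => Cexp (f s)) t (l * Cexp (f t))%C.
Proof.
  intros [F1 F2].
  set (x := fun s => Re (f s)) in *; set (y := fun s => Im (f s)) in *.
  assert (E1 : Derive (fun s => x s) t = Re l) by now apply is_derive_unique.
  assert (E2 : Derive (fun s => y s) t = Im l) by now apply is_derive_unique.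
  assert (X1 : ex_derive (fun s => x s) t) by now eexists; apply F1.
  assert (X2 : ex_derive (fun s => y s) t) by now eexists; apply F2.
  split.
  - apply (is_derive_ext (fun s => exp (x s) * cos (y s))); [reflexivity|].
    auto_derive; [now repeat split|]; rewrite E1, E2.
    unfold x, y, Cexp, Re, Im; simpl; ring.
  - apply (is_derive_ext (fun s => exp (x s) * sin (y s))); [reflexivity|].
    auto_derive; [now repeat split|]; rewrite E1, E2.
    unfold x, y, Cexp, Re, Im; simpl; ring.
Qed.

Section Recessive.
Context (Y Y1 V : R -> C) (s0 kap N : R).
Context (HY : forall s, s0 <= s -> is_CDerive Y s (Y1 s)).
Context (HY1 : forall s, s0 <= s -> is_CDerive Y1 s ((1 - V s) * Y s)%C).
Context (Hkap : kap <= 1) (HVk : forall s, s0 <= s -> Cmod (V s) <= kap).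
Context (HN : 0 <= N) (HVN : forall s, s0 <= s -> 1 <= s -> Cmod (V s) <= N / s ^ 2).
Context (Hgrowth : forall eps, 0 < eps -> exists S, forall s, S <= s ->
  Cmod (Y s) + Cmod (Y1 s) <= eps * exp s).

(** Half the derivative of [|Y|^2]: its sign separates the decaying solution from all growing ones,
    and the equation makes it monotone. *)
Let Q (s : R) : R := Re (Y1 s * Cconj (Y s)).
Let dQ (s : R) : R := Cmod (Y1 s) ^ 2 + Re (1 - V s) * Cmod (Y s) ^ 2.

Lemma recessive_dQ (s : R) : s0 <= s -> is_derive Q s (dQ s).
Proof.
  intros Hs; unfold Q.
  replace (dQ s) with (Re ((1 - V s) * Y s * Cconj (Y s) + Y1 s * Cconj (Y1 s))).
  - apply (is_CDerive_mult Y1 (fun s => Cconj (Y s))); [now apply HY1|].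
    now apply is_CDerive_conj, HY.
  - unfold dQ; rewrite !Cmod2_alt; unfold Re, Im; simpl; ring.
Qed.

Lemma recessive_dQ_lower (s del : R) :
  Cmod (V s) <= del -> Cmod (Y1 s) ^ 2 + (1 - del) * Cmod (Y s) ^ 2 <= dQ s.
Proof.
  intros Hd; unfold dQ.
  assert (H := Re_le_Cmod (V s)).
  replace (Re (1 - V s)) with (1 - Re (V s)) by (unfold Re; simpl; ring).
  assert (0 <= Cmod (Y s) ^ 2) by apply pow2_ge_0; nra.
Qed.

Lemma recessive_Q_le (s : R) : 2 * Q s <= Cmod (Y1 s) ^ 2 + Cmod (Y s) ^ 2.
Proof.
  assert (H := Re_mult_conj_le (Y1 s) (Y s)); apply Rabs_le_between in H; fold (Q s) in H.
  assert (0 <= (Cmod (Y1 s) - Cmod (Y s)) ^ 2) by apply pow2_ge_0; nra.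
Qed.

Lemma recessive_dQ_nonneg (s : R) : s0 <= s -> 0 <= dQ s.
Proof.
  intros Hs; eapply Rle_trans; [|apply (recessive_dQ_lower s kap), HVk, Hs].
  assert (0 <= Cmod (Y s) ^ 2) by apply pow2_ge_0.
  assert (0 <= Cmod (Y1 s) ^ 2) by apply pow2_ge_0; nra.
Qed.

(** If [Q] were positive somewhere, then [Q' >= 2 (1 - N / s^2) Q] would force
    growth of order [exp (2 s)]. *)
Lemma recessive_Q_nonpos (s : R) : s0 <= s -> Q s <= 0.
Proof.
  intros Hs; destruct (Rle_lt_dec (Q s) 0) as [H|Hpos]; [exact H|exfalso].
  set (s2 := Rmax s 1).
  assert (A1 : s <= s2) by apply Rmax_l; assert (A2 : 1 <= s2) by apply Rmax_r.
  assert (Mono : forall u v, s0 <= u -> u <= v -> Q u <= Q v).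
  { intros u v Hu Huv; apply (derive_nonneg_le Q dQ); auto; intros t Ht.
    - apply recessive_dQ; lra.
    - apply recessive_dQ_nonneg; lra. }
  (* [exp (- 2 t - 2 N / t)] is the integrating factor of [Q' >= 2 (1 - N / t^2) Q]; the exponent
     stays finite because [N / t^2] is integrable at infinity. *)
  set (c := Q s2 * exp (- 2 * s2 - 2 * N / s2)).
  assert (Pc : 0 < c).
  { apply Rmult_lt_0_compat; [|apply exp_pos]; assert (H := Mono s s2 Hs A1); lra. }
  assert (Low : forall u, s2 <= u -> c * exp (2 * u) <= Q u).
  { intros u Hu.
    assert (G : c <= Q u * exp (- 2 * u - 2 * N / u)).
    { apply (derive_nonneg_le (fun t => Q t * exp (- 2 * t - 2 * N / t))
        (fun t => (dQ t + Q t * (- 2 + 2 * N / t ^ 2)) * exp (- 2 * t - 2 * N / t))); auto.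
      - intros t Ht.
        assert (D := recessive_dQ t ltac:(lra)).
        assert (E : Derive (fun x => Q x) t = dQ t) by now apply is_derive_unique.
        auto_derive; [split; [now eexists; apply D|]; split; [lra|auto]|].
        rewrite E; unfold Rminus, Rdiv; set (ex := exp _); field; lra.
      - intros t Ht; apply Rmult_le_pos; [|left; apply exp_pos].
        assert (T0 : s0 <= t) by lra.
        assert (Qt : 0 <= Q t) by (assert (H := Mono s t Hs ltac:(lra)); lra).
        assert (L1 := recessive_dQ_nonneg t T0).
        assert (L2 := recessive_dQ_lower t _ (HVN t T0 ltac:(lra))).
        assert (L3 := recessive_Q_le t).
        replace (2 * N / t ^ 2) with (2 * (N / t ^ 2)) by (field; lra).
        set (del := N / t ^ 2) in *.
        assert (0 <= Cmod (Y t) ^ 2) by apply pow2_ge_0.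
        assert (0 <= Cmod (Y1 t) ^ 2) by apply pow2_ge_0.
        assert (Pdel : 0 <= del).
        { apply Rmult_le_pos; [exact HN | left; apply Rinv_0_lt_compat; nra]. }
        (* For [del <= 1] the lower bound on [dQ] dominates [2 (1 - del) Q]; for [del > 1] the term
           [2 (del - 1) Q] is itself nonnegative and [dQ >= 0] suffices. *)
        destruct (Rle_lt_dec del 1) as [Hd|Hd]; nra. }
    assert (E1 : exp (- 2 * u - 2 * N / u) <= exp (- (2 * u))).
    { assert (0 <= 2 * N / u).
      { apply Rmult_le_pos; [lra | left; apply Rinv_0_lt_compat; lra]. }
      destruct (Req_dec (2 * N / u) 0) as [->|]; [apply Req_le; f_equal; ring|].
      left; apply exp_increasing; lra. }
    assert (E2 : exp (- (2 * u)) * exp (2 * u) = 1).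
    { rewrite <- exp_plus; replace (- (2 * u) + 2 * u) with 0 by ring; apply exp_0. }
    assert (Pe := exp_pos (2 * u)).
    assert (Qu : 0 <= Q u) by (assert (H := Mono s u Hs ltac:(lra)); lra).
    assert (G' : c <= Q u * exp (- (2 * u))).
    { eapply Rle_trans; [exact G|]; now apply Rmult_le_compat_l. }
    apply Rle_trans with (Q u * exp (- (2 * u)) * exp (2 * u)).
    - apply Rmult_le_compat_r; lra.
    - rewrite Rmult_assoc, E2; lra. }
  assert (Hsq : 0 < sqrt c) by now apply sqrt_lt_R0.
  (* Multiplying the two growth bounds gives [Q <= c / 4 * exp (2 u)], against the lower bound
     [c * exp (2 u)]. *)
  destruct (Hgrowth (sqrt c / 2)) as (S & HS); [lra|].
  set (u := Rmax S s2).
  specialize (HS u (Rmax_l _ _)); specialize (Low u (Rmax_r _ _)).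
  assert (B := Re_mult_conj_le (Y1 u) (Y u)); apply Rabs_le_between in B; fold (Q u) in B.
  assert (P0 := Cmod_ge_0 (Y u)); assert (P1 := Cmod_ge_0 (Y1 u)).
  assert (Pe := exp_pos u).
  replace (2 * u) with (u + u) in Low by ring; rewrite exp_plus in Low.
  assert (Esq : sqrt c * sqrt c = c) by (apply sqrt_sqrt; lra).
  assert (X : Cmod (Y1 u) * Cmod (Y u) <= (sqrt c / 2 * exp u) * (sqrt c / 2 * exp u))
    by (apply Rmult_le_compat; lra).
  replace ((sqrt c / 2 * exp u) * (sqrt c / 2 * exp u)) with
    ((sqrt c * sqrt c) / 4 * (exp u * exp u)) in X by field.
  rewrite Esq in X; assert (0 < c * (exp u * exp u)) by (apply Rmult_lt_0_compat; [exact Pc | now apply Rmult_lt_0_compat]).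
  lra.
Qed.

Lemma recessive_decreasing (s : R) : s0 <= s -> Cmod (Y s) <= Cmod (Y s0).
Proof.
  intros Hs; apply Cmod_le_of_sqr; [apply Cmod_ge_0|].
  assert (H : - Cmod (Y s0) ^ 2 <= - Cmod (Y s) ^ 2); [|lra].
  apply (derive_nonneg_le (fun t => - Cmod (Y t) ^ 2) (fun t => - (2 * Q t))); auto.
  - intros t Ht; apply @is_derive_opp, is_derive_Cmod_sqr, HY; lra.
  - intros t Ht; assert (H := recessive_Q_nonpos t ltac:(lra)); lra.
Qed.

(** The quantity [w = exp (- s) (Y1 + Y)] satisfies [w' = - exp (- s) V Y] and tends to [0] by the
    growth hypothesis. Integrating from [s0] to infinity, with [|Y|] bounded by its initial value,
    leaves [kap |Y s0| exp (- s0)]. *)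
Lemma recessive_log_derivative : Cmod (Y1 s0 + Y s0) <= kap * Cmod (Y s0).
Proof.
  set (w := fun s => (RtoC (exp (- s)) * (Y1 s + Y s))%C).
  set (A := kap * Cmod (Y s0)).
  assert (Pk : 0 <= kap) by (eapply Rle_trans; [apply Cmod_ge_0 | apply (HVk s0); lra]).
  assert (Inc : forall S, s0 <= S -> Cmod (w S - w s0) <= A * exp (- s0) - A * exp (- S)).
  { intros S HS.
    replace (A * exp (- s0) - A * exp (- S)) with (- A * exp (- S) - - A * exp (- s0)) by ring.
    apply (Cmod_increment_le w (fun s => - RtoC (exp (- s)) * (V s * Y s))%C
      (fun s => - A * exp (- s)) (fun s => A * exp (- s))); auto.
    - intros t Ht; unfold w; eapply is_CDerive_eq.
      + apply (is_CDerive_mult (fun s => RtoC (exp (- s))) (fun s => Y1 s + Y s)%C).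
        * apply (is_CDerive_RtoC (fun s => exp (- s)) t (- exp (- t))).
          auto_derive; auto; ring.
        * apply is_CDerive_plus; [apply HY1; lra | apply HY; lra].
      + rewrite RtoC_opp; ring.
    - intros t Ht; auto_derive; auto; ring.
    - intros t Ht; rewrite Cmod_mult, Cmod_opp, Cmod_R, Rabs_pos_eq by (left; apply exp_pos).
      rewrite Rmult_comm; apply Rmult_le_compat_r; [left; apply exp_pos|].
      rewrite Cmod_mult; apply Rmult_le_compat; try apply Cmod_ge_0.
      + apply HVk; lra.
      + apply recessive_decreasing; lra. }
  assert (Hw : Cmod (w s0) <= A * exp (- s0)).
  { destruct (Rle_lt_dec (Cmod (w s0)) (A * exp (- s0))) as [H|H]; [exact H|exfalso].
    destruct (Hgrowth ((Cmod (w s0) - A * exp (- s0)) / 2)) as (S & HS); [lra|].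
    set (u := Rmax S s0).
    specialize (HS u (Rmax_l _ _)); specialize (Inc u (Rmax_r _ _)).
    assert (Wu : Cmod (w u) <= (Cmod (w s0) - A * exp (- s0)) / 2).
    { unfold w at 1; rewrite Cmod_mult, Cmod_R, Rabs_pos_eq by (left; apply exp_pos).
      assert (Pe := exp_pos (- u)).
      apply Rle_trans with (exp (- u) * ((Cmod (w s0) - A * exp (- s0)) / 2 * exp u)).
      - apply Rmult_le_compat_l; [lra|].
        eapply Rle_trans; [apply Cmod_triangle | lra].
      - apply Req_le.
        assert (E : exp (- u) * exp u = 1)
          by (rewrite <- exp_plus; replace (- u + u) with 0 by ring; apply exp_0).
        transitivity ((exp (- u) * exp u) * ((Cmod (w s0) - A * exp (- s0)) / 2)); [ring|].
        rewrite E; ring. }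
    assert (T := Cmod_triangle_inv (w s0) (w u)); rewrite Cmod_minus_sym in T.
    assert (PA : 0 <= A * exp (- u)).
    { apply Rmult_le_pos; [|left; apply exp_pos].
      apply Rmult_le_pos; [exact Pk | apply Cmod_ge_0]. }
    lra. }
  unfold w in Hw; rewrite Cmod_mult, Cmod_R, Rabs_pos_eq in Hw by (left; apply exp_pos).
  apply Rmult_le_reg_l with (exp (- s0)); [apply exp_pos|]; fold A; lra.
Qed.

End Recessive.

(** * Asymptotics of the Hankel function in the closed upper half-plane *)

Section HankelAsymptotics.
Context (n : nat) (H1 H2 : C -> C) (HD : Cdiff2 (HankelH n) H1 H2).
Context (bessel : forall z : C, z <> 0%C -> 0 <= Im z ->
  (H2 z + H1 z / z + (1 - RtoC (INR n ^ 2) / z ^ 2) * HankelH n z = 0)%C).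

Let nu : R := INR n ^ 2 - 1 / 4.

(** No integer has square [1 / 4]. Strict positivity lets the condition [|nu| <= |z|^2] imply
    [z <> 0]. *)
Lemma bessel_index_pos : 0 < Rabs nu.
Proof.
  apply Rabs_pos_lt; unfold nu; destruct n as [|p]; [simpl; lra|].
  rewrite S_INR; assert (H := pos_INR p); nra.
Qed.

(** Built from [Clog] so that it inherits the branch and is differentiable along curves off the cut;
    only its modulus, its nonvanishing and its logarithmic derivative are used. *)
Definition csqrt (z : C) : C := Cexp (Clog z / 2).

(** [sqrt z * H_n z], which solves [y'' = - (1 - nu / z^2) y], and its derivative. *)
Definition hy (z : C) : C := (csqrt z * HankelH n z)%C.
Definition hy1 (z : C) : C := (csqrt z * (H1 z + HankelH n z / (2 * z)))%C.

Lemma Cmod_csqrt (z : C) : z <> 0%C -> Cmod (csqrt z) = sqrt (Cmod z).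
Proof.
  intros Hz; apply Cmod_gt_0 in Hz.
  unfold csqrt; rewrite Cmod_Cexp.
  replace (Re (Clog z / 2)) with (/ 2 * ln (Cmod z)) by (unfold Clog, Re; simpl; field).
  rewrite <- Rpower_sqrt by exact Hz; reflexivity.
Qed.

Lemma is_CDerive_csqrt (gam : R -> C) (t : R) (v : C) :
  off_cut (gam t) -> is_CDerive gam t v ->
  is_CDerive (fun s => csqrt (gam s)) t (v * (csqrt (gam t) / (2 * gam t)))%C.
Proof.
  intros Hc Hg; unfold csqrt; eapply is_CDerive_eq.
  - apply is_CDerive_Cexp.
    apply (is_CDerive_mult (fun s => Clog (gam s)) (fun _ => / 2)%C).
    + exact (is_CDerive_Clog_path gam t v Hc Hg).
    + apply is_CDerive_const.
  - cbv beta; set (e := Cexp _); change (Cexp (Clog (gam t) / 2)) with e.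
    field; now apply off_cut_neq_0.
Qed.

Lemma is_CDerive_HankelH (gam : R -> C) (t : R) (v : C) :
  off_cut (gam t) -> is_CDerive gam t v ->
  is_CDerive (fun s => HankelH n (gam s)) t (v * H1 (gam t))%C.
Proof.
  intros Hc Hg; eapply is_CDerive_eq; [|apply Cmult_comm].
  apply (is_Cdiff_path off_cut); [apply HD, Hc | now apply (off_cut_path gam t v) | exact Hg].
Qed.

Lemma is_CDerive_HankelH1 (gam : R -> C) (t : R) (v : C) :
  off_cut (gam t) -> is_CDerive gam t v ->
  is_CDerive (fun s => H1 (gam s)) t (v * H2 (gam t))%C.
Proof.
  intros Hc Hg; eapply is_CDerive_eq; [|apply Cmult_comm].
  apply (is_Cdiff_path off_cut); [apply HD, Hc | now apply (off_cut_path gam t v) | exact Hg].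
Qed.

Lemma is_CDerive_hy (gam : R -> C) (t : R) (v : C) :
  off_cut (gam t) -> is_CDerive gam t v ->
  is_CDerive (fun s => hy (gam s)) t (v * hy1 (gam t))%C.
Proof.
  intros Hc Hg; unfold hy, hy1; eapply is_CDerive_eq.
  - apply (is_CDerive_mult (fun s => csqrt (gam s)) (fun s => HankelH n (gam s)));
      [exact (is_CDerive_csqrt gam t v Hc Hg) | exact (is_CDerive_HankelH gam t v Hc Hg)].
  - field; now apply off_cut_neq_0.
Qed.

Lemma is_CDerive_hy1 (gam : R -> C) (t : R) (v : C) :
  gam t <> 0%C -> 0 <= Im (gam t) -> is_CDerive gam t v ->
  is_CDerive (fun s => hy1 (gam s)) t (v * - ((1 - RtoC nu / gam t ^ 2) * hy (gam t)))%C.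
Proof.
  intros Hz Hi Hg.
  assert (Hc : off_cut (gam t)) by now apply off_cut_upper.
  assert (N2 := C2_neq_0).
  unfold hy, hy1; eapply is_CDerive_eq.
  - apply (is_CDerive_mult (fun s => csqrt (gam s))
      (fun s => H1 (gam s) + HankelH n (gam s) / (2 * gam s))%C);
      [exact (is_CDerive_csqrt gam t v Hc Hg)|].
    apply is_CDerive_plus; [exact (is_CDerive_HankelH1 gam t v Hc Hg)|].
    apply is_CDerive_div; [now apply Cmult_neq_0 | exact (is_CDerive_HankelH gam t v Hc Hg)|].
    apply (is_CDerive_scal 2%C gam t v), Hg.
  - assert (B := bessel _ Hz Hi).
    set (z := gam t) in *; set (h := HankelH n z) in *; set (h1 := H1 z) in *.
    assert (E : H2 z = (- (h1 / z) - (1 - RtoC (INR n ^ 2) / z ^ 2) * h)%C).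
    { replace (H2 z) with ((H2 z + h1 / z + (1 - RtoC (INR n ^ 2) / z ^ 2) * h)
        - (h1 / z) - (1 - RtoC (INR n ^ 2) / z ^ 2) * h)%C by ring.
      rewrite B; ring. }
    rewrite E.
    assert (En : RtoC nu = (RtoC (INR n ^ 2) - / 4)%C).
    { unfold nu; apply C_ext; unfold Re, Im; simpl; field. }
    rewrite En; cbv beta; fold z; fold h h1; set (sq := csqrt z); field; auto.
Qed.

Lemma hy_rate_bound (z : C) (r : R) :
  0 < r -> r <= Cmod z -> Cmod (RtoC nu / z ^ 2) <= Rabs nu / r ^ 2.
Proof.
  intros Hr Hz.
  assert (Nz : z <> 0%C) by (apply Cmod_neq_0; lra).
  rewrite Cmod_div by (now apply Cpow_nz).
  rewrite Cmod_R, Cmod_pow; apply Rmult_le_compat_l; [apply Rabs_pos|].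
  apply Rinv_le_contravar; [nra | now apply pow_incr; split; [lra|]].
Qed.

(** The series bounds the function only. Its derivative is recovered by interpolation on
    [[s, s + 1]]: the equation bounds the second derivative by twice the function, so [hy1] is
    nearly constant there and is read off from the increment of [hy]. *)
Lemma hy_imaginary_growth (eps : R) :
  0 < eps -> exists S, forall s, S <= s ->
    Cmod (hy (Ci * RtoC s)) + Cmod (hy1 (Ci * RtoC s)) <= eps * exp s.
Proof.
  intros Heps.
  destruct (HankelH_imaginary_bound n) as (K & PK & HK).
  assert (Pnu := bessel_index_pos).
  set (gam := fun s : R => (Ci * RtoC s)%C).
  assert (Hg : forall s, is_CDerive gam s Ci).
  { intros s; unfold gam; eapply is_CDerive_eq; [apply is_CDerive_scal, is_CDerive_id | ring]. }
  assert (Cg : forall s, 0 < s -> Cmod (gam s) = s).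
  { intros s Hs; unfold gam; rewrite Cmod_mult, Cmod_Ci, Cmod_R, Rabs_pos_eq; lra. }
  assert (Ig : forall s, Im (gam s) = s) by (intros s; unfold gam, Im; simpl; ring).
  assert (Bhy : forall s, 2 <= s -> Cmod (hy (gam s)) <= K * (exp s / sqrt s)).
  { intros s Hs; unfold hy; rewrite Cmod_mult, Cmod_csqrt by (apply Cmod_neq_0; rewrite Cg; lra).
    rewrite Cg by lra; specialize (HK s Hs); fold (gam s) in HK.
    assert (Psq : 0 < sqrt s) by (apply sqrt_lt_R0; lra).
    apply Rle_trans with (sqrt s * (K * (exp s / s))); [apply Rmult_le_compat_l; lra|].
    apply Req_le; rewrite <- (sqrt_sqrt s) at 3 by lra; field; lra. }
  (* The total is at most [5 M] with [M = K e exp s / sqrt s], so the requirement is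
     [sqrt s >= T]. *)
  set (T := 5 * K * exp 1 / eps).
  exists (2 + Rabs nu + T ^ 2); intros s Hs.
  assert (PT : 0 <= T ^ 2) by apply pow2_ge_0.
  assert (Hs2 : 2 <= s) by lra.
  assert (Psq : 0 < sqrt s) by (apply sqrt_lt_R0; lra).
  set (M := K * (exp (s + 1) / sqrt s)).
  assert (PM : forall u, s <= u <= s + 1 -> Cmod (hy (gam u)) <= M).
  { intros u Hu; eapply Rle_trans; [apply Bhy; lra|].
    apply Rmult_le_compat_l; [exact PK|]; apply Rmult_le_compat.
    - left; apply exp_pos.
    - left; apply Rinv_0_lt_compat, sqrt_lt_R0; lra.
    - destruct (Req_dec u (s + 1)) as [->|]; [lra | left; apply exp_increasing; lra].
    - apply Rinv_le_contravar; [exact Psq | apply sqrt_le_1; lra]. }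
  assert (Ngam : forall u, s <= u -> gam u <> 0%C) by (intros; apply Cmod_neq_0; rewrite Cg; lra).
  assert (Oc : forall u, s <= u -> off_cut (gam u)).
  { intros u Hu; apply off_cut_upper; [now apply Ngam | rewrite Ig; lra]. }
  assert (D2 : forall u, s <= u <= s + 1 ->
    Cmod (hy1 (gam u) - hy1 (gam s)) <= 2 * M).
  { intros u Hu.
    assert (PM0 : 0 <= M) by (eapply Rle_trans; [apply Cmod_ge_0 | apply (PM s); lra]).
    apply Rle_trans with (2 * M * (u - s)); [|nra].
    apply (Cmod_increment_le_lin (fun v => hy1 (gam v))
      (fun v => Ci * - ((1 - RtoC nu / gam v ^ 2) * hy (gam v)))%C); [lra| |].
    - intros v Hv; apply is_CDerive_hy1; [apply Ngam; lra | rewrite Ig; lra | apply Hg].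
    - intros v Hv; rewrite Cmod_mult, Cmod_Ci, Rmult_1_l, Cmod_opp.
      apply Cmod_mult_le; [|apply PM; lra].
      replace 2 with (1 + 1) by ring; apply Cmod_minus_le; [rewrite Cmod_1; lra|].
      eapply Rle_trans; [apply (hy_rate_bound _ s); [lra | rewrite Cg; lra]|].
      apply Rle_div_l; nra. }
  assert (D1 : Cmod (hy1 (gam s)) <= 4 * M).
  { assert (I := Cmod_increment_le_lin
      (fun u => hy (gam u) - RtoC u * (Ci * hy1 (gam s)))%C
      (fun u => Ci * hy1 (gam u) - Ci * hy1 (gam s))%C (2 * M) s (s + 1) ltac:(lra)).
    assert (I' := I
      ltac:(intros u Hu; apply is_CDerive_minus;
        [apply is_CDerive_hy; [apply Oc; lra | apply Hg]
        | eapply is_CDerive_eq;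
          [apply is_CDerive_mult; [apply is_CDerive_id | apply is_CDerive_const] | cbv beta; ring]])
      ltac:(intros u Hu; cbv beta; replace (Ci * hy1 (gam u) - Ci * hy1 (gam s))%C with
        (Ci * (hy1 (gam u) - hy1 (gam s)))%C by ring;
        rewrite Cmod_mult, Cmod_Ci, Rmult_1_l; now apply D2)).
    replace (Cmod (hy1 (gam s))) with (Cmod ((hy (gam (s + 1)) - hy (gam s)) -
      (hy (gam (s + 1)) - RtoC (s + 1) * (Ci * hy1 (gam s)) -
       (hy (gam s) - RtoC s * (Ci * hy1 (gam s)))))).
    - replace (4 * M) with ((M + M) + 2 * M * (s + 1 - s)) by ring.
      apply Cmod_minus_le; [|exact I'].
      apply Cmod_minus_le; apply PM; lra.
    - transitivity (Cmod (Ci * hy1 (gam s))); [|rewrite Cmod_mult, Cmod_Ci; ring].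
      f_equal; rewrite RtoC_plus; ring. }
  fold (gam s).
  apply Rle_trans with (5 * M); [assert (X := PM s ltac:(lra)); lra|].
  unfold M; rewrite exp_plus.
  assert (Pe := exp_pos s); assert (Pe1 := exp_pos 1).
  apply Rle_trans with ((5 * K * exp 1 / sqrt s) * exp s); [apply Req_le; field; lra|].
  apply Rmult_le_compat_r; [lra|].
  apply Rle_div_l; [exact Psq|].
  assert (PT' : 0 <= T) by (apply Rmult_le_pos; [nra | left; now apply Rinv_0_lt_compat]).
  assert (Ts : T <= sqrt s).
  { rewrite <- (sqrt_pow2 T) by exact PT'; apply sqrt_le_1; lra. }
  apply Rle_trans with (eps * T); [apply Req_le; unfold T; field; lra|].
  apply Rmult_le_compat_l; lra.
Qed.

(** The estimate is carried from the imaginary axis along a horizontal segment at height [s]. Its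
    length is [|x|] whatever [s] is, so the Gronwall factor [G] does not depend on [s]. *)
Lemma hy_vertical_growth (x eps : R) :
  0 < eps -> exists S, forall s, S <= s ->
    Cmod (hy (RtoC x + Ci * RtoC s)) + Cmod (hy1 (RtoC x + Ci * RtoC s)) <= eps * exp s.
Proof.
  intros Heps.
  (* The energy estimate bounds the left end by the right one. The parameter therefore runs over
     [[a, 0]] with the axis at [0], and the sign [sg] selects the side. *)
  set (a := - Rabs x); assert (Ha : a <= 0) by (unfold a; assert (H := Rabs_pos x); lra).
  set (sg := if Rle_dec 0 x then -1 else 1).
  assert (Hsg : sg * a = x).
  { unfold sg, a; destruct (Rle_dec 0 x); [rewrite Rabs_pos_eq | rewrite Rabs_left]; lra. }
  assert (Csg : Cmod (RtoC sg) = 1).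
  { rewrite Cmod_R; unfold sg; destruct (Rle_dec 0 x);
      [rewrite Rabs_left | rewrite Rabs_pos_eq]; lra. }
  set (G := exp ((2 + 2) * (0 - a))).
  assert (PG : 0 < sqrt G) by (apply sqrt_lt_R0, exp_pos).
  destruct (hy_imaginary_growth (eps / (2 * sqrt G))) as (S & HS).
  { apply Rdiv_lt_0_compat; lra. }
  exists (Rmax S (1 + Rabs nu)); intros s Hs.
  assert (Hs1 := Rle_trans _ _ _ (Rmax_l _ _) Hs); assert (Hs2 := Rle_trans _ _ _ (Rmax_r _ _) Hs).
  assert (Pnu := bessel_index_pos).
  specialize (HS s Hs1).
  set (gam := fun t : R => (RtoC (sg * t) + Ci * RtoC s)%C).
  assert (Hg : forall t, is_CDerive gam t (RtoC sg)).
  { intros t; unfold gam; eapply is_CDerive_eq.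
    - apply is_CDerive_plus; [|apply is_CDerive_const].
      apply (is_CDerive_RtoC (fun t => sg * t) t sg); auto_derive; auto; ring.
    - ring. }
  assert (Ig : forall t, Im (gam t) = s) by (intros t; unfold gam, Im; simpl; ring).
  assert (Mg : forall t, s <= Cmod (gam t)).
  { intros t; rewrite <- (Ig t) at 1; apply Im_le_Cmod. }
  assert (Ng : forall t, gam t <> 0%C) by (intros t; apply Cmod_neq_0; specialize (Mg t); lra).
  assert (W := second_order_gronwall (fun t => hy (gam t)) (fun t => RtoC sg * hy1 (gam t))%C
    (fun t => RtoC sg * (RtoC sg * - ((1 - RtoC nu / gam t ^ 2) * hy (gam t))))%C 2 0 a 0
    ltac:(lra) ltac:(lra) Ha).
  cbv beta in W; rewrite !(Cmod_mult _ (hy1 _)), Csg, !Rmult_1_l in W.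
  assert (W' : Cmod (hy (gam a)) ^ 2 + Cmod (hy1 (gam a)) ^ 2 <=
    G * (Cmod (hy (gam 0)) ^ 2 + Cmod (hy1 (gam 0)) ^ 2 + 0 ^ 2 * (0 - a))).
  { apply W.
    - intros t _; apply is_CDerive_hy; [apply off_cut_upper; [apply Ng | rewrite Ig; lra] | apply Hg].
    - intros t _; apply is_CDerive_scal, is_CDerive_hy1; [apply Ng | rewrite Ig; lra | apply Hg].
    - intros t _; rewrite !Cmod_mult, Csg, Cmod_opp, !Rmult_1_l, Rplus_0_r.
      apply Cmod_mult_le; [|lra].
      replace 2 with (1 + 1) by ring; apply Cmod_minus_le; [rewrite Cmod_1; lra|].
      eapply Rle_trans; [apply (hy_rate_bound _ s); [lra | apply Mg]|].
      apply Rle_div_l; nra. }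
  assert (E0 : gam 0 = (Ci * RtoC s)%C) by (unfold gam; rewrite Rmult_0_r; ring).
  assert (Ea : gam a = (RtoC x + Ci * RtoC s)%C) by (unfold gam; rewrite Hsg; ring).
  rewrite E0, Ea in W'.
  set (u := Cmod (hy (RtoC x + Ci * RtoC s))) in *; set (v := Cmod (hy1 (RtoC x + Ci * RtoC s))) in *.
  set (u0 := Cmod (hy (Ci * RtoC s))) in *; set (v0 := Cmod (hy1 (Ci * RtoC s))) in *.
  assert (Pu : 0 <= u) by apply Cmod_ge_0; assert (Pv : 0 <= v) by apply Cmod_ge_0.
  assert (Pu0 : 0 <= u0) by apply Cmod_ge_0; assert (Pv0 : 0 <= v0) by apply Cmod_ge_0.
  assert (EG : sqrt G * sqrt G = G) by (apply sqrt_sqrt; left; apply exp_pos).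
  assert (X : (u + v) ^ 2 <= (2 * (sqrt G * (u0 + v0))) ^ 2).
  { replace ((2 * (sqrt G * (u0 + v0))) ^ 2) with (4 * ((sqrt G * sqrt G) * (u0 + v0) ^ 2)) by ring.
    rewrite EG.
    assert (PG' : 0 < G) by apply exp_pos.
    assert (0 <= (u - v) ^ 2) by apply pow2_ge_0.
    assert (G * (u0 ^ 2 + v0 ^ 2) <= G * (u0 + v0) ^ 2) by (apply Rmult_le_compat_l; nra).
    assert (0 <= G * (u0 + v0) ^ 2) by (apply Rmult_le_pos; [lra | apply pow2_ge_0]).
    nra. }
  assert (Y : u + v <= 2 * (sqrt G * (u0 + v0))).
  { apply Rsqr_incr_0_var; [rewrite !Rsqr_pow2; exact X|].
    apply Rmult_le_pos; [lra|]; apply Rmult_le_pos; lra. }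
  eapply Rle_trans; [exact Y|].
  apply Rle_trans with (2 * (sqrt G * (eps / (2 * sqrt G) * exp s))).
  - apply Rmult_le_compat_l; [lra|]; apply Rmult_le_compat_l; lra.
  - apply Req_le; field; lra.
Qed.

(** Along the upward vertical ray from [z] the equation reads [Y'' = (1 - nu / z^2) Y]. The modulus
    only increases on the way up, so the perturbation is at most [|nu| / |z|^2] throughout, and it
    is at most [|nu| / s^2] at height [s]. *)
Lemma hy_recessive (z : C) :
  0 <= Im z -> Rabs nu <= Cmod z ^ 2 ->
  Cmod (Ci * hy1 z + hy z) <= Rabs nu / Cmod z ^ 2 * Cmod (hy z).
Proof.
  intros Hi Hz; assert (Pnu := bessel_index_pos).
  assert (Pz : 0 < Cmod z) by (assert (H := Cmod_ge_0 z); nra).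
  set (gam := fun s : R => (RtoC (Re z) + Ci * RtoC s)%C).
  assert (Hg : forall s, is_CDerive gam s Ci).
  { intros s; unfold gam; eapply is_CDerive_eq.
    - apply is_CDerive_plus; [apply is_CDerive_const | apply is_CDerive_scal, is_CDerive_id].
    - ring. }
  assert (Ig : forall s, Im (gam s) = s) by (intros s; unfold gam, Im; simpl; ring).
  assert (Rg : forall s, Re (gam s) = Re z) by (intros s; unfold gam, Re; simpl; ring).
  assert (Mg : forall s, Im z <= s -> Cmod z <= Cmod (gam s)).
  { intros s Hs; apply Cmod_le_of_sqr; [apply Cmod_ge_0|].
    rewrite !Cmod2_alt, Ig, Rg; nra. }
  assert (Ng : forall s, Im z <= s -> gam s <> 0%C).
  { intros s Hs; apply Cmod_neq_0; specialize (Mg s Hs); lra. }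
  assert (Ez : gam (Im z) = z) by (apply C_ext; [apply Rg | apply Ig]).
  replace z with (gam (Im z)) at 1 2 4 by exact Ez.
  apply (recessive_log_derivative (fun s => hy (gam s)) (fun s => Ci * hy1 (gam s))%C
    (fun s => RtoC nu / gam s ^ 2)%C (Im z) (Rabs nu / Cmod z ^ 2) (Rabs nu)).
  - intros s Hs; apply is_CDerive_hy; [|apply Hg].
    apply off_cut_upper; [now apply Ng | rewrite Ig; lra].
  - intros s Hs; eapply is_CDerive_eq.
    + apply is_CDerive_scal, is_CDerive_hy1; [now apply Ng | rewrite Ig; lra | apply Hg].
    + cbv beta; transitivity ((Ci * Ci) * - ((1 - RtoC nu / gam s ^ 2) * hy (gam s)))%C; [ring|].
      replace (Ci * Ci)%C with (- (1))%C by (apply C_ext; unfold Re, Im; simpl; ring).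
      ring.
  - apply Rle_div_l; nra.
  - intros s Hs; apply hy_rate_bound; [exact Pz | now apply Mg].
  - lra.
  - intros s Hs Hs1; apply hy_rate_bound; [lra|].
    rewrite <- (Ig s) at 1; apply Im_le_Cmod.
  - intros eps Heps.
    destruct (hy_vertical_growth (Re z) eps Heps) as (S & HS).
    exists S; intros s Hs; rewrite Cmod_mult, Cmod_Ci, Rmult_1_l; now apply HS.
Qed.

Lemma csqrt_neq_0 (z : C) : csqrt z <> 0%C.
Proof. apply Cexp_neq_0. Qed.

(** A zero far out would be a double zero of [hy], which uniqueness would propagate
    along the ray down to the origin. *)
Lemma hy_neq_0 (z : C) : 0 <= Im z -> Rabs nu <= Cmod z ^ 2 -> hy z <> 0%C.
Proof.
  intros Hi Hz H0; assert (Pnu := bessel_index_pos).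
  assert (Pz : 0 < Cmod z) by (assert (H := Cmod_ge_0 z); nra).
  assert (R0 := hy_recessive z Hi Hz).
  rewrite H0, Cmod_0, Rmult_0_r, Cplus_0_r, Cmod_mult, Cmod_Ci, Rmult_1_l in R0.
  assert (H01 : hy1 z = 0%C) by (apply Cmod_eq_0; assert (H := Cmod_ge_0 (hy1 z)); lra).
  destruct (HankelH_log_derivative_near_0 n) as (d & K & Hd & HK & Hnear).
  (* The ray is followed down to the disc of radius [d], where the Hankel function is already known
     not to vanish. *)
  set (t0 := Rmin 1 (d / Cmod z)).
  assert (Pt0 : 0 < t0) by (apply Rmin_pos; [lra | now apply Rdiv_lt_0_compat]).
  assert (T1 : t0 <= 1) by apply Rmin_l.
  set (gam := fun t : R => (RtoC t * z)%C).
  assert (Hg : forall t, is_CDerive gam t z).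
  { intros t; unfold gam; eapply is_CDerive_eq.
    - apply is_CDerive_mult; [apply is_CDerive_id | apply is_CDerive_const].
    - cbv beta; ring. }
  assert (Cg : forall t, 0 < t -> Cmod (gam t) = t * Cmod z).
  { intros t Ht; unfold gam; rewrite Cmod_mult, Cmod_R, Rabs_pos_eq; lra. }
  assert (Ng : forall t, 0 < t -> gam t <> 0%C) by (intros t Ht; apply Cmod_neq_0; rewrite Cg; nra).
  assert (Ig : forall t, 0 < t -> 0 <= Im (gam t)).
  { intros t Ht; replace (Im (gam t)) with (t * Im z) by (unfold gam, Im; simpl; ring).
    apply Rmult_le_pos; lra. }
  set (A := Cmod z * (Cmod z * (1 + Rabs nu / (t0 * Cmod z) ^ 2))).
  assert (W := second_order_gronwall (fun t => hy (gam t)) (fun t => z * hy1 (gam t))%C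
    (fun t => z * (z * - ((1 - RtoC nu / gam t ^ 2) * hy (gam t))))%C A 0 t0 1).
  assert (E1 : gam 1 = z) by (unfold gam; ring).
  cbv beta in W; rewrite E1, H0, H01, Cmult_0_r, Cmod_0 in W.
  assert (PA : 0 <= A).
  { unfold A; repeat apply Rmult_le_pos; try lra.
    assert (0 <= Rabs nu / (t0 * Cmod z) ^ 2); [|lra].
    apply Rmult_le_pos; [lra | left; apply Rinv_0_lt_compat, pow_lt; nra]. }
  assert (W' : Cmod (hy (gam t0)) ^ 2 + Cmod (z * hy1 (gam t0)) ^ 2 <=
    exp ((2 + A) * (1 - t0)) * (0 ^ 2 + 0 ^ 2 + 0 ^ 2 * (1 - t0))).
  { apply W; auto; try lra.
    - intros t Ht; apply is_CDerive_hy; [apply off_cut_upper; [apply Ng | apply Ig]; lra | apply Hg].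
    - intros t Ht; apply is_CDerive_scal, is_CDerive_hy1; [apply Ng; lra | apply Ig; lra | apply Hg].
    - intros t Ht; rewrite Rplus_0_r; unfold A.
      replace (Cmod z * (Cmod z * (1 + Rabs nu / (t0 * Cmod z) ^ 2)) * Cmod (hy (gam t))) with
        (Cmod z * (Cmod z * ((1 + Rabs nu / (t0 * Cmod z) ^ 2) * Cmod (hy (gam t))))) by ring.
      apply Cmod_mult_le; [lra|]; apply Cmod_mult_le; [lra|].
      rewrite Cmod_opp; apply Cmod_mult_le; [|lra].
      apply Cmod_minus_le; [rewrite Cmod_1; lra|].
      apply hy_rate_bound; [nra|]; rewrite Cg by lra; nra. }
  replace (exp ((2 + A) * (1 - t0)) * (0 ^ 2 + 0 ^ 2 + 0 ^ 2 * (1 - t0))) with 0 in W' by ring.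
  assert (Hy0 : hy (gam t0) = 0%C).
  { apply Cmod_eq_0.
    assert (0 <= Cmod (z * hy1 (gam t0)) ^ 2) by apply pow2_ge_0.
    assert (X := Cmod_ge_0 (hy (gam t0))); nra. }
  destruct (Hnear (gam t0)) as [Nh _].
  - apply off_cut_upper; [now apply Ng | now apply Ig].
  - rewrite Cg by exact Pt0.
    apply Rle_trans with (d / Cmod z * Cmod z); [|apply Req_le; field; lra].
    apply Rmult_le_compat_r; [lra | apply Rmin_r].
  - revert Hy0; unfold hy; apply Cmult_neq_0; [apply csqrt_neq_0 | exact Nh].
Qed.

(** The bracket [H' / H + 1 / (2 z)] is the logarithmic derivative of [hy], so dividing
    [hy_recessive] by [hy] gives the bound, and [hy_neq_0] permits the division. *)
Theorem HankelH_asymptotics (z : C) :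
  0 <= Im z -> Rabs nu <= Cmod z ^ 2 ->
  HankelH n z <> 0%C /\
  Cmod (H1 z / HankelH n z + / (2 * z) - Ci) <= Rabs nu / Cmod z ^ 2.
Proof.
  intros Hi Hz; assert (Pnu := bessel_index_pos).
  assert (Pz : 0 < Cmod z) by (assert (H := Cmod_ge_0 z); nra).
  assert (Nz : z <> 0%C) by now apply Cmod_neq_0.
  assert (Ny := hy_neq_0 z Hi Hz).
  assert (NH : HankelH n z <> 0%C).
  { intros E; apply Ny; unfold hy; rewrite E; ring. }
  split; [exact NH|].
  assert (R := hy_recessive z Hi Hz).
  assert (Py : 0 < Cmod (hy z)) by now apply Cmod_gt_0.
  apply Rmult_le_reg_r with (Cmod (hy z)); [exact Py|].
  eapply Rle_trans; [|exact R].
  rewrite <- Cmod_mult.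
  apply Req_le; transitivity (Cmod (Ci * ((H1 z / HankelH n z + / (2 * z) - Ci) * hy z)));
    [rewrite (Cmod_mult Ci), Cmod_Ci; ring|].
  f_equal; unfold hy, hy1.
  transitivity (Ci * (csqrt z * (H1 z + HankelH n z / (2 * z))) - (Ci * Ci) * (csqrt z * HankelH n z))%C.
  - field; repeat split; auto using C2_neq_0.
  - replace (Ci * Ci)%C with (- (1))%C by (apply C_ext; unfold Re, Im; simpl; ring). ring.
Qed.

End HankelAsymptotics.

(** * The free wave *)

(** The set of wave numbers of the scattering problem: the real axis is included, since the trace
    formula integrates over it, and the origin is not. *)
Definition upper (k : C) : Prop := k <> 0%C /\ 0 <= Im k.

Lemma upper_scal (k : C) (r : R) : upper k -> 0 < r -> upper (k * RtoC r).
Proof.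
  intros [K1 K2] Hr; split.
  - apply Cmult_neq_0; [exact K1|]; intros E; apply RtoC_inj in E; lra.
  - replace (Im (k * RtoC r)) with (r * Im k) by (unfold Im; simpl; ring).
    apply Rmult_le_pos; lra.
Qed.

Lemma upper_off_cut (k : C) : upper k -> off_cut k.
Proof. intros [K1 K2]; now apply off_cut_upper. Qed.

Lemma upper_Cmod_pos (k : C) : upper k -> 0 < Cmod k.
Proof. intros [K1 _]; now apply Cmod_gt_0. Qed.

Lemma RtoC_neq_0 (r : R) : r <> 0 -> RtoC r <> 0%C.
Proof. intros Hr E; apply RtoC_inj in E; contradiction. Qed.

Section Free.
Context (n : nat) (H1 H2 : C -> C) (HD : Cdiff2 (HankelH n) H1 H2).

Definition free_psi1 (k : C) (r : R) : C :=
  (RtoC (/ (2 * sqrt r)) * HankelH n (k * RtoC r) +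
   RtoC (sqrt r) * (k * H1 (k * RtoC r)))%C.

Definition free_psi2 (k : C) (r : R) : C :=
  (RtoC (sqrt r) * (k ^ 2 * H2 (k * RtoC r) + k * H1 (k * RtoC r) / RtoC r
    - HankelH n (k * RtoC r) / (4 * RtoC r ^ 2)))%C.

Lemma is_CDerive_ray (k : C) (r : R) : is_CDerive (fun s => k * RtoC s)%C r k.
Proof.
  eapply is_CDerive_eq; [apply is_CDerive_scal, is_CDerive_id | ring].
Qed.

Lemma is_derive_sqrt_at (r : R) : 0 < r -> is_derive sqrt r (/ (2 * sqrt r)).
Proof. intros Hr; auto_derive; [lra|]; field; apply Rgt_not_eq, sqrt_lt_R0, Hr. Qed.

Lemma is_CDerive_free_psi (k : C) (r : R) :
  upper k -> 0 < r -> is_CDerive (free_psi n k) r (free_psi1 k r).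
Proof.
  intros Hk Hr; unfold free_psi, free_psi1.
  apply (is_CDerive_mult (fun s => RtoC (sqrt s)) (fun s => HankelH n (k * RtoC s))).
  - now apply is_CDerive_RtoC, is_derive_sqrt_at.
  - apply (is_CDerive_HankelH n H1 H2 HD (fun s => k * RtoC s)%C r k).
    + now apply upper_off_cut, upper_scal.
    + apply is_CDerive_ray.
Qed.

Lemma is_CDerive_free_psi1 (k : C) (r : R) :
  upper k -> 0 < r -> is_CDerive (free_psi1 k) r (free_psi2 k r).
Proof.
  intros Hk Hr; unfold free_psi1, free_psi2.
  assert (Hs : 0 < sqrt r) by now apply sqrt_lt_R0.
  assert (Hc : off_cut (k * RtoC r)%C) by now apply upper_off_cut, upper_scal.
  assert (Nr : RtoC r <> 0%C) by (apply RtoC_neq_0; lra).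
  assert (Ns : RtoC (sqrt r) <> 0%C) by (apply RtoC_neq_0; lra).
  eapply is_CDerive_eq.
  - apply is_CDerive_plus.
    + apply (is_CDerive_mult (fun s => RtoC (/ (2 * sqrt s))) (fun s => HankelH n (k * RtoC s))).
      * apply (is_CDerive_RtoC (fun s => / (2 * sqrt s)) r (- / (4 * (sqrt r * r)))).
        auto_derive; [repeat split; auto; lra|].
        rewrite <- (sqrt_sqrt r) at 5 by lra; field; lra.
      * exact (is_CDerive_HankelH n H1 H2 HD _ r k Hc (is_CDerive_ray k r)).
    + apply (is_CDerive_mult (fun s => RtoC (sqrt s)) (fun s => k * H1 (k * RtoC s))%C).
      * now apply is_CDerive_RtoC, is_derive_sqrt_at.
      * apply (is_CDerive_scal k (fun s => H1 (k * RtoC s))).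
        exact (is_CDerive_HankelH1 n H1 H2 HD _ r k Hc (is_CDerive_ray k r)).
  - set (h := HankelH n (k * RtoC r)); set (h1 := H1 (k * RtoC r)); set (h2 := H2 (k * RtoC r)).
    assert (Er : RtoC r = (RtoC (sqrt r) * RtoC (sqrt r))%C)
      by (rewrite <- RtoC_mult, sqrt_sqrt; [reflexivity | lra]).
    rewrite RtoC_opp, !RtoC_inv, !RtoC_mult by nra.
    cbv beta; fold h h1 h2; rewrite Er.
    set (w := RtoC (sqrt r)) in *; field; exact Ns.
Qed.

Lemma free_psi_log_derivative (k : C) (r : R) :
  upper k -> 0 < r -> HankelH n (k * RtoC r) <> 0%C ->
  (free_psi1 k r / free_psi n k r =
   k * (H1 (k * RtoC r) / HankelH n (k * RtoC r) + / (2 * (k * RtoC r))))%C.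
Proof.
  intros Hk Hr Hh; unfold free_psi1, free_psi.
  assert (Hs : 0 < sqrt r) by now apply sqrt_lt_R0.
  assert (Ns : RtoC (sqrt r) <> 0%C) by (apply RtoC_neq_0; lra).
  assert (Er : RtoC r = (RtoC (sqrt r) * RtoC (sqrt r))%C)
    by (rewrite <- RtoC_mult, sqrt_sqrt; [reflexivity | lra]).
  set (h := HankelH n (k * RtoC r)) in *; set (h1 := H1 (k * RtoC r)) in *.
  rewrite !RtoC_inv, !RtoC_mult, Er by nra.
  set (w := RtoC (sqrt r)) in *; field; repeat split; auto; apply Hk.
Qed.

Lemma free_psi_neq_0 (k : C) (r : R) :
  0 < r -> HankelH n (k * RtoC r) <> 0%C -> free_psi n k r <> 0%C.
Proof.
  intros Hr Hh; apply Cmult_neq_0; [|exact Hh].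
  apply RtoC_neq_0, Rgt_not_eq, sqrt_lt_R0, Hr.
Qed.

Context (bessel : forall z : C, z <> 0%C -> 0 <= Im z ->
  (H2 z + H1 z / z + (1 - RtoC (INR n ^ 2) / z ^ 2) * HankelH n z = 0)%C).

Lemma free_psi2_eq (k : C) (r : R) :
  upper k -> 0 < r ->
  free_psi2 k r = ((RtoC ((INR n ^ 2 - 1 / 4) / r ^ 2) - k ^ 2) * free_psi n k r)%C.
Proof.
  intros Hk Hr; unfold free_psi2, free_psi.
  destruct (upper_scal k r Hk Hr) as [Z1 Z2].
  assert (B := bessel _ Z1 Z2).
  assert (Nr : RtoC r <> 0%C) by (apply RtoC_neq_0; lra).
  assert (Nk : k <> 0%C) by apply Hk.
  set (h := HankelH n (k * RtoC r)) in *; set (h1 := H1 (k * RtoC r)) in *.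
  set (h2 := H2 (k * RtoC r)) in *.
  assert (E : h2 = (- (h1 / (k * RtoC r)) - (1 - RtoC (INR n ^ 2) / (k * RtoC r) ^ 2) * h)%C).
  { replace h2 with ((h2 + h1 / (k * RtoC r) + (1 - RtoC (INR n ^ 2) / (k * RtoC r) ^ 2) * h)
      - (h1 / (k * RtoC r)) - (1 - RtoC (INR n ^ 2) / (k * RtoC r) ^ 2) * h)%C by ring.
    rewrite B; ring. }
  assert (Ev : RtoC ((INR n ^ 2 - 1 / 4) / r ^ 2) = ((RtoC (INR n ^ 2) - / 4) / RtoC r ^ 2)%C).
  { rewrite RtoC_div by (apply pow_nonzero; lra).
    rewrite (RtoC_pow r), RtoC_minus, RtoC_div by lra; unfold Cdiv; ring. }
  rewrite Ev, E; field; auto.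
Qed.

End Free.

(** * The Wronskian-type functional *)

Section Scattering.
Context (n : nat) (H1 H2 : C -> C) (HD : Cdiff2 (HankelH n) H1 H2).
Context (bessel : forall z : C, z <> 0%C -> 0 <= Im z ->
  (H2 z + H1 z / z + (1 - RtoC (INR n ^ 2) / z ^ 2) * HankelH n z = 0)%C).
Context (q : R -> R) (q_pos : forall r, 0 < 1 + q r) (b : R) (hb : 0 < b).
Context (k : C) (hk : upper k) (f f1 : R -> C).
Context (Hf : forall r, 0 < r -> is_CDerive f r (f1 r)).
Context (Hf1 : forall r, 0 < r ->
  is_CDerive f1 r ((RtoC ((INR n ^ 2 - 1 / 4) / r ^ 2) - k ^ 2 * RtoC (1 + q r)) * f r)%C).
Context (Hfree : forall r, b <= r -> f r = free_psi n k r).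

Let nu : R := INR n ^ 2 - 1 / 4.

(** For [r > b] the two functions agree in a neighbourhood. At [r = b] they agree only to the right,
    and the equality follows from the continuity of both derivatives. *)
Lemma scattering_derivative_free (r : R) : b <= r -> f1 r = free_psi1 n H1 k r.
Proof.
  intros Hr.
  assert (Strict : forall s, b < s -> f1 s = free_psi1 n H1 k s).
  { intros s Hs.
    rewrite <- (is_CDerive_unique f s (f1 s)) by (apply Hf; lra).
    apply is_CDerive_unique.
    apply (is_CDerive_ext_loc (free_psi n k)).
    - assert (P : 0 < s - b) by lra.
      exists (mkposreal _ P); intros u Hu; symmetry; apply Hfree.
      change (Rabs (u - s) < s - b) in Hu; apply Rabs_def2 in Hu; lra.
    - apply (is_CDerive_free_psi n H1 H2 HD); [exact hk | lra]. }
  destruct (Req_dec r b) as [->|]; [|apply Strict; lra].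
  assert (C1 := is_CDerive_continuous_eps _ _ _ (Hf1 b hb)).
  assert (C2 := is_CDerive_continuous_eps _ _ _
    (is_CDerive_free_psi1 n H1 H2 HD k b hk hb)).
  assert (E : Cmod (f1 b - free_psi1 n H1 k b) <= 0).
  { apply Rnot_lt_le; intros Hpos.
    set (e := Cmod (f1 b - free_psi1 n H1 k b)) in *.
    destruct (C1 (e / 2) ltac:(lra)) as (d1 & Hd1 & F1).
    destruct (C2 (e / 2) ltac:(lra)) as (d2 & Hd2 & F2).
    set (s := b + Rmin d1 d2 / 2).
    assert (Pm : 0 < Rmin d1 d2) by now apply Rmin_pos.
    assert (Ms : Rabs (s - b) < Rmin d1 d2).
    { unfold s; replace (b + Rmin d1 d2 / 2 - b) with (Rmin d1 d2 / 2) by ring.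
      rewrite Rabs_pos_eq; lra. }
    specialize (F1 s (Rlt_le_trans _ _ _ Ms (Rmin_l _ _))).
    specialize (F2 s (Rlt_le_trans _ _ _ Ms (Rmin_r _ _))).
    rewrite Strict in F1 by (unfold s; lra).
    assert (T : e <= Cmod (free_psi1 n H1 k s - f1 b) +
      Cmod (free_psi1 n H1 k s - free_psi1 n H1 k b)).
    { unfold e; rewrite Cmod_minus_sym.
      replace (free_psi1 n H1 k b - f1 b)%C with
        ((free_psi1 n H1 k s - f1 b) - (free_psi1 n H1 k s - free_psi1 n H1 k b))%C by ring.
      apply Cmod_triangle_minus. }
    lra. }
  assert (Z : Cmod (f1 b - free_psi1 n H1 k b) = 0)
    by (apply Rle_antisym; [exact E | apply Cmod_ge_0]).
  apply Cmod_eq_0 in Z.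
  replace (f1 b) with ((f1 b - free_psi1 n H1 k b) + free_psi1 n H1 k b)%C by ring.
  rewrite Z; ring.
Qed.

Let D (r : R) : C := (f1 r - f r / RtoC (2 * r))%C.
(** In terms of [u = f / sqrt r] this is [r Im (u' conj u / k)]. Subtracting [f / (2 r)] replaces
    the coefficient [n^2 - 1/4], negative for [n = 0], by [n^2], so the centrifugal term has a
    sign. *)
Definition flux (r : R) : R := Im ((f1 r - f r / RtoC (2 * r)) * Cconj (f r) / k).

Let dflux (r : R) : R :=
  - Im k * ((Cmod (D r) ^ 2 + INR n ^ 2 * Cmod (f r) ^ 2 / r ^ 2) / Cmod k ^ 2
            + (1 + q r) * Cmod (f r) ^ 2).

(** Dividing by [k] before taking the imaginary part aligns the signs: the kinetic and centrifugal
    terms carry [Im (1 / k) = - Im k / |k|^2], the potential term carries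
    [Im (- k^2 / k) = - Im k]. *)
Lemma is_derive_flux (r : R) : 0 < r -> is_derive flux r (dflux r).
Proof.
  intros Hr.
  assert (Nr : RtoC (2 * r) <> 0%C) by (apply RtoC_neq_0; lra).
  assert (G : is_CDerive (fun s => (f1 s - f s / RtoC (2 * s)) * Cconj (f s) * / k)%C r
    ((((RtoC (nu / r ^ 2) - k ^ 2 * RtoC (1 + q r)) * f r
       - (f1 r * RtoC (2 * r) - f r * RtoC 2) / (RtoC (2 * r) * RtoC (2 * r))) * Cconj (f r)
      + (f1 r - f r / RtoC (2 * r)) * Cconj (f1 r)) * / k
      + (f1 r - f r / RtoC (2 * r)) * Cconj (f r) * 0)%C).
  { apply (is_CDerive_mult (fun s => (f1 s - f s / RtoC (2 * s)) * Cconj (f s))%C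
      (fun _ => / k)%C); [|apply is_CDerive_const].
    apply (is_CDerive_mult (fun s => f1 s - f s / RtoC (2 * s))%C (fun s => Cconj (f s))).
    - apply is_CDerive_minus; [now apply Hf1|].
      apply (is_CDerive_div f (fun s => RtoC (2 * s))); [exact Nr | now apply Hf|].
      apply (is_CDerive_RtoC (fun s => 2 * s)); auto_derive; auto; ring.
    - now apply is_CDerive_conj, Hf. }
  destruct G as [_ G].
  unfold flux.
  replace (dflux r) with (Im ((((RtoC (nu / r ^ 2) - k ^ 2 * RtoC (1 + q r)) * f r
       - (f1 r * RtoC (2 * r) - f r * RtoC 2) / (RtoC (2 * r) * RtoC (2 * r))) * Cconj (f r)
      + (f1 r - f r / RtoC (2 * r)) * Cconj (f1 r)) * / k
      + (f1 r - f r / RtoC (2 * r)) * Cconj (f r) * 0)%C); [exact G|].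
  unfold dflux, D; rewrite !Cmod2_alt.
  assert (Pk := Cmod_sqr_pos k (proj1 hk)).
  unfold nu.
  destruct (f r) as [x y], (f1 r) as [x1 y1], k as [ka et].
  unfold Re, Im in *; simpl in *.
  field; repeat split; nra.
Qed.

Lemma flux_le (r : R) : flux r <= Cmod (D r) * Cmod (f r) / Cmod k.
Proof.
  unfold flux; eapply Rle_trans; [apply Im_le_Cmod|].
  rewrite Cmod_div by apply hk; rewrite Cmod_mult, Cmod_conj; unfold D; lra.
Qed.

(** AM-GM on [|D| / |k|] and [sqrt (1 + q) |f|], whose product dominates the flux; the centrifugal
    term is dropped. The rate is the one of the WKB exponential, which makes the later lower bound
    uniform in [k]. *)
Lemma dflux_le (r : R) : 0 < r -> dflux r <= - 2 * Im k * sqrt (1 + q r) * flux r.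
Proof.
  intros Hr; unfold dflux.
  assert (Pk := upper_Cmod_pos k hk); assert (Ik : 0 <= Im k) by apply hk.
  assert (Ep : sqrt (1 + q r) * sqrt (1 + q r) = 1 + q r)
    by (apply sqrt_sqrt; left; apply q_pos).
  set (p := sqrt (1 + q r)) in *; assert (Pp : 0 <= p) by apply sqrt_pos.
  assert (F := flux_le r).
  rewrite <- Ep.
  assert (PD := Cmod_ge_0 (D r)); assert (Pf := Cmod_ge_0 (f r)).
  assert (A : 2 * p * (Cmod (D r) * Cmod (f r) / Cmod k) <=
    Cmod (D r) ^ 2 / Cmod k ^ 2 + p * p * Cmod (f r) ^ 2).
  { assert (0 <= (Cmod (D r) / Cmod k - p * Cmod (f r)) ^ 2) by apply pow2_ge_0.
    replace ((Cmod (D r) / Cmod k - p * Cmod (f r)) ^ 2) with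
      (Cmod (D r) ^ 2 / Cmod k ^ 2 + p * p * Cmod (f r) ^ 2 -
       2 * p * (Cmod (D r) * Cmod (f r) / Cmod k)) in H by (field; lra).
    lra. }
  assert (B : 0 <= INR n ^ 2 * Cmod (f r) ^ 2 / r ^ 2 / Cmod k ^ 2).
  { apply Rmult_le_pos; [apply Rmult_le_pos|];
      [apply Rmult_le_pos; apply pow2_ge_0 | |];
      left; apply Rinv_0_lt_compat, pow_lt; assumption. }
  assert (C : 2 * p * flux r <= 2 * p * (Cmod (D r) * Cmod (f r) / Cmod k))
    by (apply Rmult_le_compat_l; lra).
  unfold Rdiv in *; rewrite Rmult_plus_distr_r.
  assert (X : Im k * (2 * p * flux r) <=
    Im k * (Cmod (D r) ^ 2 * / Cmod k ^ 2 + INR n ^ 2 * Cmod (f r) ^ 2 * / r ^ 2 * / Cmod k ^ 2 +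
      p * p * Cmod (f r) ^ 2)) by (apply Rmult_le_compat_l; lra).
  lra.
Qed.

Lemma dflux_nonpos (r : R) : dflux r <= 0.
Proof.
  unfold dflux; assert (Ik : 0 <= Im k) by apply hk.
  assert (P : 0 <= (Cmod (D r) ^ 2 + INR n ^ 2 * Cmod (f r) ^ 2 / r ^ 2) / Cmod k ^ 2
            + (1 + q r) * Cmod (f r) ^ 2).
  { assert (Pinv : forall x, 0 <= / x ^ 2).
    { intros x; destruct (Req_dec x 0) as [->|Hx].
      - simpl; rewrite Rmult_0_l, Rinv_0; lra.
      - left; apply Rinv_0_lt_compat; nra. }
    apply Rplus_le_le_0_compat.
    - apply Rmult_le_pos; [|apply Pinv].
      apply Rplus_le_le_0_compat; [apply pow2_ge_0|].
      apply Rmult_le_pos; [|apply Pinv].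
      apply Rmult_le_pos; apply pow2_ge_0.
    - apply Rmult_le_pos; [left; apply q_pos | apply pow2_ge_0]. }
  nra.
Qed.

Lemma flux_decreasing (r s : R) : 0 < r -> r <= s -> flux s <= flux r.
Proof.
  intros Hr Hs.
  assert (H : - flux r <= - flux s); [|lra].
  apply (derive_nonneg_le (fun t => - flux t) (fun t => - dflux t)); auto.
  - intros t Ht; apply @is_derive_opp, is_derive_flux; lra.
  - intros t Ht; assert (X := dflux_nonpos t); lra.
Qed.

(** Beyond [b] the solution is the free wave, so the Hankel asymptotics apply. They provide the
    starting value for the monotonicity argument and the matching condition at [b] for high
    frequencies. *)
Lemma flux_far (r : R) :
  b <= r -> 2 + 2 * Rabs nu <= Cmod k * r ->
  f r <> 0%C /\ Cmod (f r) ^ 2 / 2 <= flux r /\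
  Cmod (f1 r / f r - Ci * k) <= Rabs nu / (Cmod k * r ^ 2).
Proof.
  intros Hbr Hkr.
  assert (Hr : 0 < r) by lra.
  assert (Pk := upper_Cmod_pos k hk); assert (Pnu := Rabs_pos nu).
  destruct (upper_scal k r hk Hr) as [Z1 Z2].
  set (z := (k * RtoC r)%C) in *.
  assert (Cz : Cmod z = Cmod k * r) by (unfold z; rewrite Cmod_mult, Cmod_R, Rabs_pos_eq; lra).
  destruct (HankelH_asymptotics n H1 H2 HD bessel z Z2) as [NH A].
  { rewrite Cz; fold nu; nra. }
  fold nu in A.
  assert (Nf : f r <> 0%C) by (rewrite Hfree by exact Hbr; now apply free_psi_neq_0).
  assert (E : (f1 r / f r)%C = (k * (H1 z / HankelH n z + / (2 * z)))%C).
  { rewrite scattering_derivative_free, Hfree by exact Hbr.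
    now apply free_psi_log_derivative. }
  set (w := (H1 z / HankelH n z + / (2 * z))%C) in *.
  assert (Nr : RtoC r <> 0%C) by (apply RtoC_neq_0; lra).
  split; [exact Nf|]; split.
  - assert (F : flux r = Cmod (f r) ^ 2 * Im (w - / (2 * z))).
    { unfold flux.
      replace ((f1 r - f r / RtoC (2 * r)) * Cconj (f r) / k)%C with
        ((f1 r / f r - / RtoC (2 * r)) / k * RtoC (Cmod (f r) ^ 2))%C.
      - rewrite E.
        replace ((k * w - / RtoC (2 * r)) / k)%C with (w - / (2 * z))%C.
        + unfold Im; simpl; ring.
        + unfold z; rewrite RtoC_mult; field; split; [exact Nr | apply hk].
      - rewrite RtoC_mult, Cmod2_conj; field; repeat split; auto; apply hk. }
    rewrite F.
    (* The flux is [|f|^2 Im (w - 1 / (2 z))]; with [w] within [1 / 4] of [i] and [1 / (2 z)] at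
       most [1 / 4], the imaginary part is at least [1 / 2]. *)
    assert (B1 : Rabs nu / Cmod z ^ 2 <= / 4).
    { apply Rle_div_l; rewrite Cz; nra. }
    assert (B2 : Cmod (/ (2 * z)) <= / 4).
    { rewrite Cmod_inv, Cmod_mult, Cmod_R, Rabs_pos_eq by (try apply Cmult_neq_0; auto using C2_neq_0; lra).
      apply Rinv_le_contravar; [lra|]; rewrite Cz; lra. }
    assert (B3 := Im_abs_le_Cmod (w - Ci)); assert (B4 := Im_abs_le_Cmod (/ (2 * z))).
    apply Rabs_le_between in B3; apply Rabs_le_between in B4.
    replace (Im (w - Ci)) with (Im w - 1) in B3 by (unfold Im; simpl; ring).
    rewrite Im_minus.
    assert (0 <= Cmod (f r) ^ 2) by apply pow2_ge_0; nra.
  - rewrite E; replace (k * w - Ci * k)%C with (k * (w - Ci))%C by ring.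
    rewrite Cmod_mult.
    apply Rle_trans with (Cmod k * (Rabs nu / Cmod z ^ 2)); [apply Rmult_le_compat_l; lra|].
    rewrite Cz; apply Req_le; field; lra.
Qed.

Lemma flux_pos (r : R) : 0 < r -> 0 < flux r.
Proof.
  intros Hr.
  assert (Pk := upper_Cmod_pos k hk); assert (Pnu := Rabs_pos nu).
  set (s := Rmax (Rmax r b) ((2 + 2 * Rabs nu) / Cmod k)).
  assert (S1 : r <= s) by (eapply Rle_trans; [apply Rmax_l | apply Rmax_l]).
  assert (S2 : b <= s) by (eapply Rle_trans; [apply Rmax_r | apply Rmax_l]).
  assert (S3 : (2 + 2 * Rabs nu) / Cmod k <= s) by apply Rmax_r.
  destruct (flux_far s S2) as (Nf & Fl & _).
  { apply Rle_trans with (Cmod k * ((2 + 2 * Rabs nu) / Cmod k)); [apply Req_le; field; lra|].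
    apply Rmult_le_compat_l; lra. }
  apply Cmod_gt_0 in Nf.
  assert (M := flux_decreasing r s Hr S1); nra.
Qed.

(** At a zero the bound [flux_le] would make the flux nonpositive, against [flux_pos]. *)
Lemma scattering_neq_0 (r : R) : 0 < r -> f r <> 0%C.
Proof.
  intros Hr E; assert (F := flux_pos r Hr); assert (L := flux_le r).
  rewrite E, Cmod_0 in L; unfold Rdiv in L; rewrite Rmult_0_r, Rmult_0_l in L; lra.
Qed.

Lemma flux_growth (T : R -> R) (r s : R) :
  0 < r -> r <= s ->
  (forall t, r <= t <= s -> is_derive T t (sqrt (1 + q t))) ->
  flux s * exp (2 * Im k * (T s - T r)) <= flux r.
Proof.
  intros Hr Hs HT.
  assert (H : - (flux r * exp (2 * Im k * (T r - T r))) <= - (flux s * exp (2 * Im k * (T s - T r)))).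
  { apply (derive_nonneg_le (fun t => - (flux t * exp (2 * Im k * (T t - T r))))
      (fun t => - ((dflux t + 2 * Im k * sqrt (1 + q t) * flux t) * exp (2 * Im k * (T t - T r))))); auto.
    - intros t Ht; apply @is_derive_opp.
      assert (D1 := is_derive_flux t ltac:(lra)); assert (D2 := HT t Ht).
      assert (E1 : Derive (fun x => flux x) t = dflux t) by now apply is_derive_unique.
      assert (E2 : Derive (fun x => T x) t = sqrt (1 + q t)) by now apply is_derive_unique.
      auto_derive; [split; [now eexists; apply D1 | split; [now eexists; apply D2 | auto]]|].
      rewrite E1, E2; unfold Rminus; ring.
    - intros t Ht.
      assert (X := dflux_le t ltac:(lra)).
      assert (Pe := exp_pos (2 * Im k * (T t - T r))); nra. }
  rewrite Rminus_diag, Rmult_0_r, exp_0 in H; lra.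
Qed.

End Scattering.

(** * Comparison with an approximate solution *)

Section Comparison.
Context (r b : R) (Hrb : r <= b) (f f1 P m md E : R -> C).
Context (Hf : forall t, r <= t <= b -> is_CDerive f t (f1 t)).
Context (Hf1 : forall t, r <= t <= b -> is_CDerive f1 t (P t * f t)%C).
Context (Hm : forall t, r <= t <= b -> is_CDerive m t (md t)).
Context (HE : forall t, r <= t <= b -> is_CDerive E t (m t * E t)%C).
Context (NE : forall t, r <= t <= b -> E t <> 0%C).

(** Variation of constants: [f = E g] with [E' = m E]. Then [amplitude1] is [g'], and the error
    [f1 / f - m] of the approximate logarithmic derivative is exactly [g' / g]. *)
Definition amplitude (t : R) : C := (f t / E t)%C.
Definition amplitude1 (t : R) : C := ((f1 t - m t * f t) / E t)%C.
(** The defect of [m] in the Riccati equation [m' + m^2 = P]; it is the only source term in the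
    equation for [amplitude1]. *)
Definition residual (t : R) : C := (P t - md t - m t ^ 2)%C.

Lemma is_CDerive_amplitude (t : R) :
  r <= t <= b -> is_CDerive amplitude t (amplitude1 t).
Proof.
  intros Ht; eapply is_CDerive_eq.
  - apply (is_CDerive_div f E); [now apply NE | now apply Hf | now apply HE].
  - unfold amplitude1; field; now apply NE.
Qed.

Lemma is_CDerive_amplitude1 (t : R) :
  r <= t <= b ->
  is_CDerive amplitude1 t (- (2 * m t * amplitude1 t) + residual t * amplitude t)%C.
Proof.
  intros Ht; eapply is_CDerive_eq.
  - apply (is_CDerive_div (fun t => f1 t - m t * f t)%C E); [now apply NE | | now apply HE].
    apply is_CDerive_minus; [now apply Hf1|].
    apply (is_CDerive_mult m f); [now apply Hm | now apply Hf].
  - unfold amplitude1, residual, amplitude; field; now apply NE.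
Qed.

Lemma amplitude_recover (t : R) :
  r <= t <= b -> (f t = E t * amplitude t)%C /\ (f1 t = E t * (amplitude1 t + m t * amplitude t))%C.
Proof.
  intros Ht; unfold amplitude, amplitude1; split; field; now apply NE.
Qed.

Lemma amplitude_log_derivative (t : R) :
  r <= t <= b -> f t <> 0%C -> (f1 t / f t - m t = amplitude1 t / amplitude t)%C.
Proof.
  intros Ht Nf; unfold amplitude, amplitude1; field; split; [now apply NE | exact Nf].
Qed.

Context (sig : R) (Hsig : forall t, r <= t <= b -> Cmod (residual t) <= sig).

Lemma residual_bound_nonneg : 0 <= sig.
Proof. eapply Rle_trans; [apply Cmod_ge_0 | apply (Hsig b); lra]. Qed.

Lemma amplitude1_sqr_derivative (t : R) :
  r <= t <= b ->
  is_derive (fun s => Cmod (amplitude1 s) ^ 2) t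
    (2 * Re ((- (2 * m t * amplitude1 t) + residual t * amplitude t) * Cconj (amplitude1 t))).
Proof. intros Ht; now apply is_derive_Cmod_sqr, is_CDerive_amplitude1. Qed.

Lemma amplitude1_sqr_derivative_lower (t mu G : R) :
  r <= t <= b -> Re (m t) <= mu -> Cmod (amplitude t) <= G ->
  - 4 * mu * Cmod (amplitude1 t) ^ 2 - 2 * sig * G * Cmod (amplitude1 t) <=
  2 * Re ((- (2 * m t * amplitude1 t) + residual t * amplitude t) * Cconj (amplitude1 t)).
Proof.
  intros Ht Hmu HG; assert (Ps := residual_bound_nonneg); assert (Hst := Hsig t Ht).
  assert (X : Re ((- (2 * m t * amplitude1 t) + residual t * amplitude t) * Cconj (amplitude1 t)) =
    - 2 * Re (m t) * Cmod (amplitude1 t) ^ 2 +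
    Re ((residual t * amplitude t) * Cconj (amplitude1 t))).
  { rewrite Cmod2_alt; unfold Re, Im; simpl; ring. }
  rewrite X.
  assert (Y := Re_mult_conj_le (residual t * amplitude t) (amplitude1 t)).
  apply Rabs_le_between in Y; rewrite Cmod_mult in Y.
  assert (Ph := Cmod_ge_0 (amplitude1 t)); assert (Pg := Cmod_ge_0 (amplitude t)).
  assert (Pr := Cmod_ge_0 (residual t)).
  set (y := Cmod (amplitude1 t)) in *; set (x := Cmod (amplitude t)) in *.
  assert (Z : Cmod (residual t) * x * y <= sig * G * y).
  { apply Rmult_le_compat_r; [exact Ph|]; apply Rmult_le_compat; lra. }
  assert (0 <= y ^ 2) by apply pow2_ge_0; nra.
Qed.

(** Going down from [b], the term [- 2 m amplitude1] is harmful only where [Re m > 0], so just an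
    upper bound on [Re m] is needed. A large negative real part, as for large [Im k], costs
    nothing. *)
Lemma amplitude_energy_bound (mu : R) :
  0 <= mu -> (forall t, r <= t <= b -> Re (m t) <= mu) ->
  forall t, r <= t <= b ->
  Cmod (amplitude t) ^ 2 + Cmod (amplitude1 t) ^ 2 <=
  exp ((1 + 4 * mu + sig) * (b - r)) * (Cmod (amplitude b) ^ 2 + Cmod (amplitude1 b) ^ 2).
Proof.
  intros Pmu Hmu t Ht; assert (Ps := residual_bound_nonneg).
  set (A := 1 + 4 * mu + sig).
  assert (G : Cmod (amplitude t) ^ 2 + Cmod (amplitude1 t) ^ 2 <= exp (A * (b - t)) *
    (Cmod (amplitude b) ^ 2 + Cmod (amplitude1 b) ^ 2 + 0 * (b - t))).
  { apply (gronwall_backward (fun s => Cmod (amplitude s) ^ 2 + Cmod (amplitude1 s) ^ 2)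
      (fun s => 2 * Re (amplitude1 s * Cconj (amplitude s)) + 2 * Re
        ((- (2 * m s * amplitude1 s) + residual s * amplitude s) * Cconj (amplitude1 s))));
      try lra; [unfold A; lra | |].
    - intros s Hs; apply @is_derive_plus.
      + apply is_derive_Cmod_sqr, is_CDerive_amplitude; lra.
      + apply amplitude1_sqr_derivative; lra.
    - intros s Hs.
      assert (Y := Re_mult_conj_le (amplitude1 s) (amplitude s)); apply Rabs_le_between in Y.
      assert (Z := amplitude1_sqr_derivative_lower s mu (Cmod (amplitude s)) ltac:(lra)
        (Hmu s ltac:(lra)) (Rle_refl _)).
      assert (Ph := Cmod_ge_0 (amplitude1 s)); assert (Pg := Cmod_ge_0 (amplitude s)).
      set (y := Cmod (amplitude1 s)) in *; set (x := Cmod (amplitude s)) in *.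
      assert (Q : 0 <= (x - y) ^ 2) by apply pow2_ge_0.
      assert (Q' : 2 * (x * y) <= x ^ 2 + y ^ 2) by nra.
      assert (Q2 : sig * (2 * (x * y)) <= sig * (x ^ 2 + y ^ 2)) by now apply Rmult_le_compat_l.
      assert (0 <= mu * x ^ 2) by (apply Rmult_le_pos; [exact Pmu | apply pow2_ge_0]).
      unfold A; nra. }
  rewrite Rmult_0_l, Rplus_0_r in G.
  eapply Rle_trans; [exact G|]; apply Rmult_le_compat_r.
  - apply Rplus_le_le_0_compat; apply pow2_ge_0.
  - assert (PA : 0 <= A) by (unfold A; lra).
    destruct (Req_dec (A * (b - t)) (A * (b - r))) as [->|Hn]; [lra|].
    left; apply exp_increasing; assert (A * (b - t) <= A * (b - r)) by nra; lra.
Qed.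

(** Unlike the energy bound, this keeps the factor [sig] of the source, so with vanishing data at
    [b] the derivative is as small as the residual; low frequencies rest on this. *)
Lemma amplitude1_bound (mu G : R) :
  0 <= mu -> (forall t, r <= t <= b -> Re (m t) <= mu) ->
  (forall t, r <= t <= b -> Cmod (amplitude t) <= G) ->
  forall t, r <= t <= b ->
  Cmod (amplitude1 t) ^ 2 <=
  exp ((4 * mu + 1) * (b - r)) * (Cmod (amplitude1 b) ^ 2 + (sig * G) ^ 2 * (b - r)).
Proof.
  intros Pmu Hmu HG t Ht; assert (Ps := residual_bound_nonneg).
  assert (W := gronwall_backward (fun s => Cmod (amplitude1 s) ^ 2)
    (fun s => 2 * Re ((- (2 * m s * amplitude1 s) + residual s * amplitude s) * Cconj (amplitude1 s)))
    (4 * mu + 1) ((sig * G) ^ 2) t b ltac:(lra) (pow2_ge_0 _) ltac:(lra)).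
  assert (W' : Cmod (amplitude1 t) ^ 2 <= exp ((4 * mu + 1) * (b - t)) *
    (Cmod (amplitude1 b) ^ 2 + (sig * G) ^ 2 * (b - t))).
  { apply W.
    - intros s Hs; apply amplitude1_sqr_derivative; lra.
    - intros s Hs.
      assert (Z := amplitude1_sqr_derivative_lower s mu G ltac:(lra) (Hmu s ltac:(lra))
        (HG s ltac:(lra))).
      set (y := Cmod (amplitude1 s)) in *.
      assert (Q : 0 <= (y - sig * G) ^ 2) by apply pow2_ge_0; nra. }
  eapply Rle_trans; [exact W'|].
  assert (P1 := pow2_ge_0 (Cmod (amplitude1 b))); assert (P2 := pow2_ge_0 (sig * G)).
  apply Rmult_le_compat.
  - left; apply exp_pos.
  - apply Rplus_le_le_0_compat; [exact P1 | apply Rmult_le_pos; lra].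
  - destruct (Req_dec t r) as [->|Hn]; [lra|].
    left; apply exp_increasing; nra.
  - apply Rplus_le_compat_l, Rmult_le_compat_l; lra.
Qed.

(** Completing the square in [2 lam (y - sig G / (2 lam))^2 >= 0] gives
    [(|h|^2 - ka)' >= 2 lam (|h|^2 - ka)] for [h = amplitude1]. Going down to [r] the source thus
    contributes at most [sig G / (2 lam)]: this is the origin of the rate [1 / Im k]. *)
Lemma amplitude1_damped_bound (lam G : R) :
  0 < lam -> (forall t, r <= t <= b -> Re (m t) <= - lam) ->
  (forall t, r <= t <= b -> Cmod (amplitude t) <= G) ->
  Cmod (amplitude1 r) ^ 2 <= Cmod (amplitude1 b) ^ 2 + (sig * G) ^ 2 / (4 * lam ^ 2).
Proof.
  intros Pl Hl HG; assert (Ps := residual_bound_nonneg).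
  set (ka := (sig * G) ^ 2 / (4 * lam ^ 2)).
  assert (Pka : 0 <= ka).
  { apply Rmult_le_pos; [apply pow2_ge_0 | left; apply Rinv_0_lt_compat; nra]. }
  assert (W : exp (- 2 * lam * (r - r)) * (Cmod (amplitude1 r) ^ 2 - ka) <=
    exp (- 2 * lam * (b - r)) * (Cmod (amplitude1 b) ^ 2 - ka)).
  { apply (derive_nonneg_le (fun s => exp (- 2 * lam * (s - r)) * (Cmod (amplitude1 s) ^ 2 - ka))
      (fun s => exp (- 2 * lam * (s - r)) *
        (2 * Re ((- (2 * m s * amplitude1 s) + residual s * amplitude s) * Cconj (amplitude1 s))
         - 2 * lam * (Cmod (amplitude1 s) ^ 2 - ka)))); auto.
    - intros s Hs.
      assert (D := amplitude1_sqr_derivative s Hs).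
      set (y := fun s => Cmod (amplitude1 s) ^ 2) in *.
      assert (ED : Derive (fun x => y x) s = 2 * Re ((- (2 * m s * amplitude1 s) +
        residual s * amplitude s) * Cconj (amplitude1 s))) by now apply is_derive_unique.
      apply (is_derive_ext (fun s => exp (- 2 * lam * (s - r)) * (y s - ka))); [reflexivity|].
      change (Cmod (amplitude1 s) ^ 2) with (y s).
      auto_derive; [now eexists; apply D|].
      rewrite ED; unfold Rminus; ring.
    - intros s Hs; apply Rmult_le_pos; [left; apply exp_pos|].
      assert (Z := amplitude1_sqr_derivative_lower s (- lam) G Hs (Hl s Hs) (HG s Hs)).
      set (y := Cmod (amplitude1 s)) in *.
      assert (Q : 0 <= 2 * lam * (y - sig * G / (2 * lam)) ^ 2).
      { apply Rmult_le_pos; [lra | apply pow2_ge_0]. }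
      replace (2 * lam * (y - sig * G / (2 * lam)) ^ 2) with
        (2 * lam * y ^ 2 - 2 * sig * G * y + 2 * lam * ka) in Q by (unfold ka; field; lra).
      lra. }
  rewrite Rminus_diag, Rmult_0_r, exp_0, Rmult_1_l in W.
  assert (Pe := exp_pos (- 2 * lam * (b - r))).
  assert (Le : exp (- 2 * lam * (b - r)) <= 1).
  { rewrite <- exp_0; destruct (Req_dec (- 2 * lam * (b - r)) 0) as [->|Hn]; [lra|].
    left; apply exp_increasing; assert (- 2 * lam * (b - r) <= 0) by nra; lra. }
  assert (Pb := pow2_ge_0 (Cmod (amplitude1 b))).
  nra.
Qed.

End Comparison.

Lemma continuous_bounded (f : R -> R) (a b : R) :
  a <= b -> (forall t, a <= t <= b -> continuous f t) ->
  exists M, 0 <= M /\ forall t, a <= t <= b -> Rabs (f t) <= M.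
Proof.
  intros Hab Hc.
  destruct (continuity_ab_maj (fun t => Rabs (f t)) a b Hab) as (x & Hx & _).
  - intros c Hcab; apply continuity_pt_filterlim.
    apply (continuous_comp f Rabs); [now apply Hc | apply continuous_Rabs].
  - exists (Rabs (f x)); split; [apply Rabs_pos | exact Hx].
Qed.

(** * High frequencies *)

Section HighFrequency.
Context (n : nat) (H1 H2 : C -> C) (HD : Cdiff2 (HankelH n) H1 H2).
Context (bessel : forall z : C, z <> 0%C -> 0 <= Im z ->
  (H2 z + H1 z / z + (1 - RtoC (INR n ^ 2) / z ^ 2) * HankelH n z = 0)%C).
Context (q q1 q2 : R -> R) (c0 : R) (hc0 : 0 < c0) (q_low : forall t, c0 <= 1 + q t).
Context (Hq : forall t, is_derive q t (q1 t)) (Hq1 : forall t, is_derive q1 t (q2 t)).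
Context (Hq2 : forall t, continuous q2 t).
Context (b : R) (hb : 0 < b) (qb : q b = 0) (q1b : q1 b = 0).
Context (psi psi1 : C -> R -> C).
Context (Hpsi : forall k r, upper k -> 0 < r -> is_CDerive (psi k) r (psi1 k r)).
Context (Hpsi1 : forall k r, upper k -> 0 < r ->
  is_CDerive (psi1 k) r
    ((RtoC ((INR n ^ 2 - 1 / 4) / r ^ 2) - k ^ 2 * RtoC (1 + q r)) * psi k r)%C).
Context (Hfree : forall k r, upper k -> b <= r -> psi k r = free_psi n k r).

Let nu : R := INR n ^ 2 - 1 / 4.

(** The logarithmic derivative of [(1 + q)^(1/4)], that is, minus that of the classical WKB
    amplitude [(1 + q)^(-1/4)]. *)
Definition wkb_shift (t : R) : R := q1 t / (4 * (1 + q t)).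
Let s (t : R) : R := wkb_shift t.
Let s' (t : R) : R := q2 t / (4 * (1 + q t)) - q1 t ^ 2 / (4 * (1 + q t) ^ 2).
Let p (t : R) : R := sqrt (1 + q t).

Lemma potential_pos (t : R) : 0 < 1 + q t.
Proof. specialize (q_low t); lra. Qed.

Lemma refractive_index_pos (t : R) : 0 < p t.
Proof. apply sqrt_lt_R0, potential_pos. Qed.

Lemma refractive_index_sqr (t : R) : p t * p t = 1 + q t.
Proof. apply sqrt_sqrt; left; apply potential_pos. Qed.

Lemma is_derive_p (t : R) : is_derive p t (q1 t / (2 * p t)).
Proof.
  unfold p; assert (P := potential_pos t).
  assert (E : Derive (fun x => q x) t = q1 t) by apply is_derive_unique, Hq.
  auto_derive; [split; [now eexists; apply Hq | split; [lra | auto]]|].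
  rewrite E; field; apply Rgt_not_eq, refractive_index_pos.
Qed.

Lemma is_derive_wkb_shift (t : R) : is_derive s t (s' t).
Proof.
  unfold s, wkb_shift, s'; assert (P := potential_pos t).
  assert (E : Derive (fun x => q x) t = q1 t) by apply is_derive_unique, Hq.
  assert (E1 : Derive (fun x => q1 x) t = q2 t) by apply is_derive_unique, Hq1.
  auto_derive; [repeat split; auto; [now eexists; apply Hq1 | now eexists; apply Hq | lra]|].
  rewrite E, E1; field; lra.
Qed.

Lemma is_derive_continuous (f : R -> R) (t l : R) : is_derive f t l -> continuous f t.
Proof.
  intros H; exact (ex_derive_continuous (K := R_AbsRing) (V := R_NormedModule) f t (ex_intro _ l H)).
Qed.

Let T (r t : R) : R := RInt p r t.
Let S (t : R) : R := ln (1 + q t) / 4.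

Lemma is_derive_phase (r t : R) : is_derive (T r) t (p t).
Proof.
  apply is_derive_RInt with r.
  - apply filter_forall; intros u; apply (RInt_correct p).
    apply (ex_RInt_continuous p); intros v _.
    eapply is_derive_continuous, is_derive_p.
  - eapply is_derive_continuous, is_derive_p.
Qed.

Lemma is_derive_log_amplitude (t : R) : is_derive S t (s t).
Proof.
  unfold S, s, wkb_shift; assert (P := potential_pos t).
  assert (E : Derive (fun x => q x) t = q1 t) by apply is_derive_unique, Hq.
  auto_derive; [split; [now eexists; apply Hq | split; [lra | auto]]|].
  rewrite E; field; lra.
Qed.

Let m (k : C) (t : R) : C := (Ci * k * RtoC (p t) - RtoC (s t))%C.
Let md (k : C) (t : R) : C := (Ci * k * RtoC (q1 t / (2 * p t)) - RtoC (s' t))%C.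
Let E (k : C) (r t : R) : C := Cexp (Ci * k * RtoC (T r t) - RtoC (S t)).
Let P (k : C) (t : R) : C := (RtoC (nu / t ^ 2) - k ^ 2 * RtoC (1 + q t))%C.

Lemma is_CDerive_wkb_m (k : C) (t : R) : is_CDerive (m k) t (md k t).
Proof.
  apply is_CDerive_minus.
  - apply (is_CDerive_scal (Ci * k) (fun t => RtoC (p t))), is_CDerive_RtoC, is_derive_p.
  - apply is_CDerive_RtoC, is_derive_wkb_shift.
Qed.

Lemma is_CDerive_wkb_E (k : C) (r t : R) : is_CDerive (E k r) t (m k t * E k r t)%C.
Proof.
  apply (is_CDerive_Cexp (fun t => Ci * k * RtoC (T r t) - RtoC (S t))%C).
  apply is_CDerive_minus.
  - apply (is_CDerive_scal (Ci * k) (fun t => RtoC (T r t))), is_CDerive_RtoC, is_derive_phase.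
  - apply is_CDerive_RtoC, is_derive_log_amplitude.
Qed.

(** The WKB ansatz is exact up to a residual that does not involve [k]. *)
Lemma wkb_residual (k : C) (t : R) :
  residual (P k) (m k) (md k) t = RtoC (nu / t ^ 2 + s' t - s t ^ 2).
Proof.
  unfold residual, P, m, md.
  assert (Pp := refractive_index_pos t); assert (Pq := potential_pos t).
  assert (Es : q1 t / (2 * p t) = 2 * p t * s t).
  { unfold s, wkb_shift; rewrite <- refractive_index_sqr; field; lra. }
  rewrite Es, <- refractive_index_sqr.
  apply C_ext; unfold Re, Im; simpl; ring.
Qed.

Lemma Re_wkb_m (k : C) (t : R) : Re (m k t) = - Im k * p t - s t.
Proof. unfold m, Re, Im; simpl; ring. Qed.

Lemma Cmod_wkb_E (k : C) (r t : R) : Cmod (E k r t) = exp (- Im k * T r t - S t).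
Proof. unfold E; rewrite Cmod_Cexp; f_equal; unfold Re, Im; simpl; ring. Qed.

(** The error is [h / g] at [r], with [g] the amplitude relative to the WKB exponential and
    [h = g']. The energy bound controls both from above by [|g b|], the flux controls [|g r|] from
    below by [|g b|], and this unknown normalization cancels. *)
Theorem high_frequency (r : R) :
  0 < r <= b ->
  exists K K0, 0 <= K /\ 0 < K0 /\ forall k, upper k -> K0 <= Cmod k ->
    Cmod (psi1 k r / psi k r - (Ci * k * RtoC (sqrt (1 + q r)) - RtoC (wkb_shift r))) <= K /\
    (K0 <= Im k ->
     Cmod (psi1 k r / psi k r - (Ci * k * RtoC (sqrt (1 + q r)) - RtoC (wkb_shift r))) <= K / Im k).
Proof.
  intros Hr.
  assert (Pnu := Rabs_pos nu).
  destruct (continuous_bounded s r b ltac:(lra)) as (S1 & PS1 & HS1).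
  { intros t _; eapply is_derive_continuous, is_derive_wkb_shift. }
  assert (Cs' : forall t, continuous s' t).
  { intros t; unfold s'.
    assert (Cq : continuous q t) by (eapply is_derive_continuous, Hq).
    assert (Cq1 : continuous q1 t) by (eapply is_derive_continuous, Hq1).
    assert (Pq := potential_pos t).
    apply (continuous_minus (fun t => q2 t / (4 * (1 + q t)))
      (fun t => q1 t ^ 2 / (4 * (1 + q t) ^ 2))).
    - apply (continuous_mult q2 (fun t => / (4 * (1 + q t)))); [apply Hq2|].
      apply (continuous_comp (fun t => 1 + q t) (fun y => / (4 * y))).
      + apply (continuous_plus (fun _ => 1) q); [apply continuous_const | exact Cq].
      + eapply is_derive_continuous; auto_derive; [lra | reflexivity].
    - apply (continuous_mult (fun t => q1 t ^ 2) (fun t => / (4 * (1 + q t) ^ 2))).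
      + apply (continuous_comp q1 (fun y => y ^ 2)); [exact Cq1|].
        eapply is_derive_continuous; auto_derive; [auto | reflexivity].
      + apply (continuous_comp (fun t => 1 + q t) (fun y => / (4 * y ^ 2))).
        * apply (continuous_plus (fun _ => 1) q); [apply continuous_const | exact Cq].
        * eapply is_derive_continuous; auto_derive; [nra | reflexivity]. }
  destruct (continuous_bounded s' r b ltac:(lra)) as (S2 & PS2 & HS2); [auto|].
  set (sig := Rabs nu / r ^ 2 + S2 + S1 ^ 2).
  assert (Psig : 0 <= sig).
  { unfold sig; assert (0 <= Rabs nu / r ^ 2); [|nra].
    apply Rmult_le_pos; [exact Pnu | left; apply Rinv_0_lt_compat; nra]. }
  assert (Hsig : forall k t, r <= t <= b -> Cmod (residual (P k) (m k) (md k) t) <= sig).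
  { intros k t Ht; rewrite wkb_residual, Cmod_R; unfold sig.
    assert (X1 := HS1 t Ht); assert (X2 := HS2 t Ht).
    assert (X3 : Rabs (nu / t ^ 2) <= Rabs nu / r ^ 2).
    { unfold Rdiv; rewrite Rabs_mult, (Rabs_pos_eq (/ t ^ 2)).
      - apply Rmult_le_compat_l; [exact Pnu|].
        apply Rinv_le_contravar; [nra | apply pow_incr; lra].
      - left; apply Rinv_0_lt_compat; nra. }
    apply Rabs_le_between in X1; apply Rabs_le_between in X2; apply Rabs_le_between in X3.
    apply Rabs_le_between; nra. }
  set (c1 := Rabs nu / b ^ 2).
  assert (Pc1 : 0 <= c1).
  { apply Rmult_le_pos; [exact Pnu | left; apply Rinv_0_lt_compat; nra]. }
  set (C1 := sqrt (exp ((1 + 4 * S1 + sig) * (b - r)) * (1 + c1 ^ 2))).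
  assert (PC1 : 0 < C1).
  { apply sqrt_lt_R0, Rmult_lt_0_compat; [apply exp_pos | nra]. }
  assert (EC1 : C1 * C1 = exp ((1 + 4 * S1 + sig) * (b - r)) * (1 + c1 ^ 2)).
  { apply sqrt_sqrt, Rmult_le_pos; [left; apply exp_pos | nra]. }
  (* Bounds [|h + m g - g / (2 r)|] at [r] by [|k| C2 |g b|], using [|k| >= 1]; the factor [|k|]
     cancels against the division by [k] in the flux. *)
  set (C2 := C1 * (1 + (p r + S1) + / (2 * r))).
  assert (Ppr := refractive_index_pos r).
  assert (Pir : 0 < / (2 * r)) by (apply Rinv_0_lt_compat; lra).
  assert (PC2 : 0 < C2) by (apply Rmult_lt_0_compat; lra).
  set (c2 := exp (2 * S r - 2 * S b) / (2 * C2)).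
  assert (Pc2 : 0 < c2) by (apply Rdiv_lt_0_compat; [apply exp_pos | lra]).
  assert (Pc0 : 0 < sqrt c0) by now apply sqrt_lt_R0.
  (* The first term gives [|k| >= 1], the second the condition of [flux_far] at [b], the third lets
     [Im k sqrt c0 / 2] absorb the shift [S1] in [Re m]. *)
  set (K0 := 1 + (2 + 2 * Rabs nu) / b + 2 * S1 / sqrt c0).
  assert (Q1 : 0 <= (2 + 2 * Rabs nu) / b).
  { apply Rmult_le_pos; [lra | left; now apply Rinv_0_lt_compat]. }
  assert (Q2 : 0 <= 2 * S1 / sqrt c0).
  { apply Rmult_le_pos; [lra | left; now apply Rinv_0_lt_compat]. }
  set (C3 := c1 + sig * C1 / sqrt c0).
  assert (PC3 : 0 <= C3).
  { unfold C3; assert (0 <= sig * C1 / sqrt c0); [|lra].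
    apply Rmult_le_pos; [nra | left; now apply Rinv_0_lt_compat]. }
  exists (C1 / c2 + C3 / c2), K0.
  assert (R1 : 0 <= C1 / c2) by (apply Rmult_le_pos; [lra | left; now apply Rinv_0_lt_compat]).
  assert (R2 : 0 <= C3 / c2) by (apply Rmult_le_pos; [lra | left; now apply Rinv_0_lt_compat]).
  split; [lra|]; split; [unfold K0; lra|].
  intros k Hk Hk0.
  assert (Ik : 0 <= Im k) by apply Hk.
  assert (Hk1 : 1 <= Cmod k) by (unfold K0 in Hk0; lra).
  assert (Hkb : 2 + 2 * Rabs nu <= Cmod k * b).
  { apply Rle_trans with ((2 + 2 * Rabs nu) / b * b); [apply Req_le; field; lra|].
    apply Rmult_le_compat_r; unfold K0 in Hk0; lra. }
  assert (Dp : forall t, r <= t <= b -> is_CDerive (psi k) t (psi1 k t))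
    by (intros t Ht; apply Hpsi; [exact Hk | lra]).
  assert (Dp1 : forall t, r <= t <= b -> is_CDerive (psi1 k) t (P k t * psi k t)%C)
    by (intros t Ht; apply Hpsi1; [exact Hk | lra]).
  assert (Dm : forall t, r <= t <= b -> is_CDerive (m k) t (md k t))
    by (intros; apply is_CDerive_wkb_m).
  assert (DE : forall t, r <= t <= b -> is_CDerive (E k r) t (m k t * E k r t)%C)
    by (intros; apply is_CDerive_wkb_E).
  assert (NE : forall t, r <= t <= b -> E k r t <> 0%C)
    by (intros; apply Cexp_neq_0).
  assert (Npsi : forall t, 0 < t -> psi k t <> 0%C).
  { intros t Ht; apply (scattering_neq_0 n H1 H2 HD bessel q potential_pos b hb k Hk (psi k) (psi1 k));
      auto. }
  destruct (flux_far n H1 H2 HD bessel q b hb k Hk (psi k) (psi1 k)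
    (fun t Ht => Hpsi k t Hk Ht) (fun t Ht => Hpsi1 k t Hk Ht) (fun t Ht => Hfree k t Hk Ht)
    b (Rle_refl b) Hkb) as (Nb & Fb & Ab).
  assert (Grow := flux_growth n q potential_pos b k Hk (psi k) (psi1 k)
    (fun t Ht => Hpsi k t Hk Ht) (fun t Ht => Hpsi1 k t Hk Ht) (fun t Ht => Hfree k t Hk Ht)
    (T r) r b
    ltac:(lra) ltac:(lra) (fun t _ => is_derive_phase r t)).
  assert (Fr := flux_le k Hk (psi k) (psi1 k) r).
  set (g := amplitude (psi k) (E k r)) in *.
  set (h := amplitude1 (psi k) (psi1 k) (m k) (E k r)) in *.
  assert (Rb : r <= b <= b) by lra; assert (Rr : r <= r <= b) by lra.
  assert (Lb := amplitude_log_derivative r b (psi k) (psi1 k) (m k) (E k r) NE b Rb Nb).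
  assert (Lr := amplitude_log_derivative r b (psi k) (psi1 k) (m k) (E k r) NE r Rr
    (Npsi r ltac:(lra))).
  fold g h in Lb, Lr.
  assert (Rec : forall t, r <= t <= b ->
    (psi k t = E k r t * g t)%C /\ (psi1 k t = E k r t * (h t + m k t * g t))%C)
    by (intros t Ht; now apply (amplitude_recover r b)).
  assert (Ng : forall t, r <= t <= b -> g t <> 0%C).
  { intros t Ht Eg; destruct (Rec t Ht) as [X _]; rewrite Eg, Cmult_0_r in X.
    apply (Npsi t); [lra | exact X]. }
  set (gb := Cmod (g b)) in *.
  assert (Pgb : 0 < gb) by (apply Cmod_gt_0, Ng, Rb).
  (* As [q] and its derivative vanish at [b], the ansatz matches the free wave there up to
     [O(1 / |k|)], so the initial value of [h] is small as well. *)
  assert (Mb : m k b = (Ci * k)%C).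
  { unfold m, p, s, wkb_shift; rewrite qb, q1b, Rplus_0_r, sqrt_1.
    unfold Rdiv; rewrite Rmult_0_l; ring. }
  assert (Hb : Cmod (h b) <= c1 / Cmod k * gb).
  { rewrite Mb in Lb; rewrite Lb, Cmod_div in Ab by now apply Ng.
    fold gb in Ab; apply (proj1 (Rle_div_l _ _ _ Pgb)) in Ab.
    eapply Rle_trans; [exact Ab|]; apply Req_le; unfold c1, nu; field; lra. }
  assert (Pik : 0 < / Cmod k <= 1).
  { split; [apply Rinv_0_lt_compat; lra|].
    rewrite <- Rinv_1; apply Rinv_le_contravar; lra. }
  assert (Hb' : Cmod (h b) <= c1 * gb).
  { eapply Rle_trans; [exact Hb|]; apply Rmult_le_compat_r; [lra|].
    unfold Rdiv; rewrite <- (Rmult_1_r c1) at 2; apply Rmult_le_compat_l; lra. }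
  assert (Phb := Cmod_ge_0 (h b)).
  assert (Mmu : forall t, r <= t <= b -> Re (m k t) <= S1).
  { intros t Ht; rewrite Re_wkb_m.
    assert (X := HS1 t Ht); apply Rabs_le_between in X.
    assert (Y := refractive_index_pos t); assert (0 <= Im k * p t) by (apply Rmult_le_pos; lra); lra. }
  assert (En := amplitude_energy_bound r b ltac:(lra) (psi k) (psi1 k) (P k) (m k) (md k) (E k r)
    Dp Dp1 Dm DE NE sig (Hsig k) S1 PS1 Mmu).
  fold g h in En; fold gb in En.
  assert (En' : forall t, r <= t <= b -> Cmod (g t) <= C1 * gb /\ Cmod (h t) <= C1 * gb).
  { intros t Ht; specialize (En t Ht).
    assert (X : gb ^ 2 + Cmod (h b) ^ 2 <= (1 + c1 ^ 2) * gb ^ 2) by nra.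
    assert (Y : Cmod (g t) ^ 2 + Cmod (h t) ^ 2 <= (C1 * gb) ^ 2).
    { eapply Rle_trans; [exact En|].
      replace ((C1 * gb) ^ 2) with ((C1 * C1) * gb ^ 2) by ring; rewrite EC1, Rmult_assoc.
      apply Rmult_le_compat_l; [left; apply exp_pos | exact X]. }
    assert (Z : 0 <= C1 * gb) by nra.
    assert (0 <= Cmod (g t) ^ 2) by apply pow2_ge_0; assert (0 <= Cmod (h t) ^ 2) by apply pow2_ge_0.
    split; apply Cmod_le_of_sqr; lra. }
  (* The flux at [r] is at most [|E r|^2 C2 |g b| |g r|], and at least the flux at [b] times its
     growth factor, hence at least a multiple of [|g b|^2]. *)
  assert (Low : c2 * gb <= Cmod (g r)).
  { destruct (En' r Rr) as [Gr Hr'].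
    destruct (Rec r Rr) as [Xr Yr]; destruct (Rec b Rb) as [Xb _].
    assert (PEr : 0 < Cmod (E k r r)) by (apply Cmod_gt_0, NE, Rr).
    assert (PEb : 0 < Cmod (E k r b)) by (apply Cmod_gt_0, NE, Rb).
    assert (Dr : Cmod (psi1 k r - psi k r / RtoC (2 * r)) <= Cmod (E k r r) * (Cmod k * (C2 * gb))).
    { rewrite Xr, Yr.
      replace (E k r r * (h r + m k r * g r) - E k r r * g r / RtoC (2 * r))%C with
        (E k r r * (h r + m k r * g r - / RtoC (2 * r) * g r))%C
        by (field; apply RtoC_neq_0; lra).
      apply Cmod_mult_le; [lra|].
      assert (Bm : Cmod (m k r) <= Cmod k * (p r + S1)).
      { unfold m; eapply Rle_trans; [apply Cmod_triangle_minus|].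
        rewrite !Cmod_mult, Cmod_Ci, !Cmod_R, (Rabs_pos_eq (p r)) by lra.
        assert (X := HS1 r Rr); nra. }
      assert (Bi : Cmod (/ RtoC (2 * r)) <= Cmod k * / (2 * r)).
      { rewrite Cmod_inv by (apply RtoC_neq_0; lra).
        rewrite Cmod_R, Rabs_pos_eq by lra; nra. }
      apply Rle_trans with ((C1 * gb + Cmod k * (p r + S1) * (C1 * gb)) +
        Cmod k * / (2 * r) * (C1 * gb)).
      - apply Cmod_minus_le; [apply Cmod_plus_le; [exact Hr'|]|]; now apply Cmod_mult_le.
      - unfold C2; assert (0 <= C1 * gb) by nra; nra. }
    assert (F1 : flux k (psi k) (psi1 k) r <= Cmod (E k r r) ^ 2 * (C2 * gb * Cmod (g r))).
    { eapply Rle_trans; [exact Fr|].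
      apply Rle_div_l; [lra|].
      rewrite Xr at 2; rewrite Cmod_mult.
      apply Rle_trans with (Cmod (E k r r) * (Cmod k * (C2 * gb)) * (Cmod (E k r r) * Cmod (g r))).
      - apply Rmult_le_compat_r; [apply Rmult_le_pos; [lra | apply Cmod_ge_0] | exact Dr].
      - apply Req_le; ring. }
    assert (F2 : Cmod (E k r b) ^ 2 * gb ^ 2 / 2 * exp (2 * Im k * (T r b - T r r)) <=
      Cmod (E k r r) ^ 2 * (C2 * gb * Cmod (g r))).
    { eapply Rle_trans; [|exact F1]; eapply Rle_trans; [|exact Grow].
      apply Rmult_le_compat_r; [left; apply exp_pos|].
      eapply Rle_trans; [|exact Fb]; rewrite Xb, Cmod_mult; fold gb; apply Req_le; field. }
    (* The growth of the flux and the decay of the WKB exponential cancel exactly; what remains does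
       not involve [k]. *)
    assert (EE : Cmod (E k r b) ^ 2 * exp (2 * Im k * (T r b - T r r)) =
      Cmod (E k r r) ^ 2 * exp (2 * S r - 2 * S b)).
    { rewrite !Cmod_wkb_E.
      replace (exp (- Im k * T r b - S b) ^ 2) with
        (exp (- Im k * T r b - S b) * exp (- Im k * T r b - S b)) by ring.
      replace (exp (- Im k * T r r - S r) ^ 2) with
        (exp (- Im k * T r r - S r) * exp (- Im k * T r r - S r)) by ring.
      rewrite <- !exp_plus; f_equal; ring. }
    replace (Cmod (E k r b) ^ 2 * gb ^ 2 / 2 * exp (2 * Im k * (T r b - T r r))) with
      (Cmod (E k r b) ^ 2 * exp (2 * Im k * (T r b - T r r)) * (gb ^ 2 / 2)) in F2 by field.
    rewrite EE, Rmult_assoc in F2.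
    apply Rmult_le_reg_l in F2; [|nra].
    apply Rmult_le_reg_l with (C2 * gb); [nra|].
    eapply Rle_trans; [|exact F2]; apply Req_le; unfold c2; field; lra. }
  assert (Pgr : 0 < Cmod (g r)) by (apply Cmod_gt_0, Ng, Rr).
  change (Ci * k * RtoC (sqrt (1 + q r)) - RtoC (wkb_shift r))%C with (m k r).
  rewrite Lr, Cmod_div by now apply Ng.
  split.
  - apply Rle_trans with (C1 / c2); [|lra].
    apply Rle_div_l; [exact Pgr|].
    apply Rle_trans with (C1 / c2 * (c2 * gb)).
    + replace (C1 / c2 * (c2 * gb)) with (C1 * gb) by (field; lra); now apply En'.
    + now apply Rmult_le_compat_l.
  - intros HIk.
    assert (PIk : 0 < Im k) by (unfold K0 in HIk; lra).
    set (lam := Im k * sqrt c0 / 2).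
    assert (Plam : 0 < lam) by (unfold lam; nra).
    assert (Mlam : forall t, r <= t <= b -> Re (m k t) <= - lam).
    { intros t Ht; rewrite Re_wkb_m.
      assert (X := HS1 t Ht); apply Rabs_le_between in X.
      assert (Y : sqrt c0 <= p t) by (apply sqrt_le_1; [lra | left; apply potential_pos | apply q_low]).
      assert (Z : S1 <= lam).
      { unfold lam; apply Rle_trans with (2 * S1 / sqrt c0 * sqrt c0 / 2);
          [apply Req_le; field; lra|].
        unfold Rdiv at 1; apply Rmult_le_compat_r; [lra|].
        apply Rmult_le_compat_r; unfold K0 in HIk; lra. }
      assert (W : Im k * sqrt c0 <= Im k * p t) by (apply Rmult_le_compat_l; lra).
      unfold lam in *; lra. }
    assert (Dm' := amplitude1_damped_bound r b ltac:(lra) (psi k) (psi1 k) (P k) (m k) (md k) (E k r)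
      Dp Dp1 Dm DE NE sig (Hsig k) lam (C1 * gb) Plam Mlam (fun t Ht => proj1 (En' t Ht))).
    fold h in Dm'.
    assert (Ik' : Im k <= Cmod k) by apply Im_le_Cmod.
    assert (Bh : Cmod (h r) <= C3 / Im k * gb).
    { apply Cmod_le_of_sqr.
      { apply Rmult_le_pos; [apply Rmult_le_pos; [lra | left; now apply Rinv_0_lt_compat] | lra]. }
      eapply Rle_trans; [exact Dm'|].
      assert (B1 : Cmod (h b) <= c1 / Im k * gb).
      { eapply Rle_trans; [exact Hb|]; apply Rmult_le_compat_r; [lra|].
        apply Rmult_le_compat_l; [exact Pc1 | now apply Rinv_le_contravar]. }
      replace ((sig * (C1 * gb)) ^ 2 / (4 * lam ^ 2)) with
        ((sig * C1 / sqrt c0 / Im k * gb) ^ 2) by (unfold lam; field; lra).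
      replace (C3 / Im k * gb) with (c1 / Im k * gb + sig * C1 / sqrt c0 / Im k * gb)
        by (unfold C3; field; lra).
      assert (X2 : 0 <= sig * C1 / sqrt c0 / Im k * gb).
      { apply Rmult_le_pos; [|lra].
        apply Rmult_le_pos; [|left; now apply Rinv_0_lt_compat].
        apply Rmult_le_pos; [nra | left; now apply Rinv_0_lt_compat]. }
      set (x := c1 / Im k * gb) in *; set (y := sig * C1 / sqrt c0 / Im k * gb) in *.
      nra. }
    apply Rle_trans with (C3 / c2 / Im k).
    + apply Rle_div_l; [exact Pgr|].
      apply Rle_trans with (C3 / c2 / Im k * (c2 * gb)).
      * replace (C3 / c2 / Im k * (c2 * gb)) with (C3 / Im k * gb) by (field; lra); exact Bh.
      * apply Rmult_le_compat_l; [|exact Low].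
        apply Rmult_le_pos; [exact R2 | left; now apply Rinv_0_lt_compat].
    + apply Rmult_le_compat_r; [left; now apply Rinv_0_lt_compat | lra].
Qed.

End HighFrequency.

(** * Low frequencies *)

Section LowFrequency.
Context (n : nat) (H1 H2 : C -> C) (HD : Cdiff2 (HankelH n) H1 H2).
Context (bessel : forall z : C, z <> 0%C -> 0 <= Im z ->
  (H2 z + H1 z / z + (1 - RtoC (INR n ^ 2) / z ^ 2) * HankelH n z = 0)%C).

Let nu : R := INR n ^ 2 - 1 / 4.

Lemma is_CDerive_free_psi1_ode (k : C) (r : R) :
  upper k -> 0 < r ->
  is_CDerive (free_psi1 n H1 k) r
    ((RtoC (nu / r ^ 2) - k ^ 2 * RtoC (1 + 0)) * free_psi n k r)%C.
Proof.
  intros Hk Hr; eapply is_CDerive_eq; [exact (is_CDerive_free_psi1 n H1 H2 HD k r Hk Hr)|].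
  rewrite (free_psi2_eq n H1 H2 bessel k r Hk Hr), Rplus_0_r; fold nu; ring.
Qed.

(** The free wave is the scattering solution for [q = 0] with any matching radius; [1] is taken.
    This also rules out zeros of the Hankel function in the whole closed upper half-plane, not only
    far out. *)
Lemma free_psi_nonzero (k : C) (r : R) : upper k -> 0 < r -> free_psi n k r <> 0%C.
Proof.
  intros Hk Hr.
  apply (scattering_neq_0 n H1 H2 HD bessel (fun _ => 0) ltac:(intros; lra) 1 Rlt_0_1 k Hk
    (free_psi n k) (free_psi1 n H1 k)); auto.
  - intros t Ht; now apply (is_CDerive_free_psi n H1 H2 HD).
  - intros t Ht; now apply is_CDerive_free_psi1_ode.
Qed.

Lemma HankelH_nonzero (z : C) : upper z -> HankelH n z <> 0%C.
Proof.
  intros Hz E; apply (free_psi_nonzero z 1 Hz Rlt_0_1).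
  unfold free_psi; rewrite Cmult_1_r, E; ring.
Qed.

Context (q : R -> R) (q_pos : forall r, 0 < 1 + q r) (Hqc : forall t, continuous q t).
Context (b : R) (hb : 0 < b).
Context (psi psi1 : C -> R -> C).
Context (Hpsi : forall k r, upper k -> 0 < r -> is_CDerive (psi k) r (psi1 k r)).
Context (Hpsi1 : forall k r, upper k -> 0 < r ->
  is_CDerive (psi1 k) r
    ((RtoC ((INR n ^ 2 - 1 / 4) / r ^ 2) - k ^ 2 * RtoC (1 + q r)) * psi k r)%C).
Context (Hfree : forall k r, upper k -> b <= r -> psi k r = free_psi n k r).

(** Here the comparison function is the free wave itself. The residual is then [- k^2 q], the data
    at [b] are exactly [g = 1], [h = 0], and hence [h = O(|k|^2)] while [g] stays near [1]. *)
Theorem low_frequency (r : R) :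
  0 < r <= b ->
  exists K d, 0 <= K /\ 0 < d /\ forall k, upper k -> Cmod k <= d ->
    Cmod (psi1 k r / psi k r - free_psi1 n H1 k r / free_psi n k r) <= K * Cmod k ^ 2.
Proof.
  intros Hr.
  destruct (HankelH_log_derivative_near_0 n) as (d0 & K0 & Pd0 & PK0 & Hnear).
  destruct (continuous_bounded q r b ltac:(lra)) as (Q & PQ & HQ); [intros; apply Hqc|].
  (* The free logarithmic derivative at [t] is [(z H' / H + 1 / 2) / t] with [z = k t], so it is
     bounded by [mu] independently of small [k]. *)
  set (mu := (K0 + 1) / r).
  assert (Pmu : 0 < mu) by (apply Rdiv_lt_0_compat; lra).
  set (G := sqrt (exp ((1 + 4 * mu + Q) * (b - r)))).
  assert (PG : 0 < G) by apply sqrt_lt_R0, exp_pos.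
  assert (EG : G * G = exp ((1 + 4 * mu + Q) * (b - r))) by (apply sqrt_sqrt; left; apply exp_pos).
  set (C0 := sqrt (exp ((4 * mu + 1) * (b - r)) * ((Q * G) ^ 2 * (b - r)))).
  assert (PX0 : 0 <= exp ((4 * mu + 1) * (b - r)) * ((Q * G) ^ 2 * (b - r))).
  { apply Rmult_le_pos; [left; apply exp_pos|]; apply Rmult_le_pos; [apply pow2_ge_0 | lra]. }
  assert (PC0 : 0 <= C0) by apply sqrt_pos.
  assert (EC0 : C0 * C0 = exp ((4 * mu + 1) * (b - r)) * ((Q * G) ^ 2 * (b - r)))
    by now apply sqrt_sqrt.
  (* The entries ensure, in turn, [|k|^2 <= |k| <= 1], [|k t| <= d0] for all [t <= b], and a change
     of [g] by at most [1 / 2]. *)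
  set (d := Rmin (Rmin 1 (d0 / b)) (/ (2 * (C0 * (b - r) + 1)))).
  assert (PCb : 0 <= C0 * (b - r)) by (apply Rmult_le_pos; lra).
  exists (2 * C0), d; split; [lra|]; split.
  { apply Rmin_pos; [apply Rmin_pos; [lra | now apply Rdiv_lt_0_compat]|].
    apply Rinv_0_lt_compat; lra. }
  intros k Hk Hkd.
  assert (Pk := upper_Cmod_pos k Hk).
  assert (D1 : Cmod k <= 1)
    by (eapply Rle_trans; [exact Hkd | eapply Rle_trans; [apply Rmin_l | apply Rmin_l]]).
  assert (D2 : Cmod k <= d0 / b)
    by (eapply Rle_trans; [exact Hkd | eapply Rle_trans; [apply Rmin_l | apply Rmin_r]]).
  assert (D3 : Cmod k <= / (2 * (C0 * (b - r) + 1)))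
    by (eapply Rle_trans; [exact Hkd | apply Rmin_r]).
  set (E := free_psi n k); set (E1 := free_psi1 n H1 k).
  set (m := fun t => (E1 t / E t)%C).
  set (P := fun t : R => (RtoC (nu / t ^ 2) - k ^ 2 * RtoC (1 + q t))%C).
  set (P0 := fun t : R => (RtoC (nu / t ^ 2) - k ^ 2 * RtoC (1 + 0))%C).
  set (md := fun t => ((P0 t * E t * E t - E1 t * E1 t) / (E t * E t))%C).
  assert (NE : forall t, r <= t <= b -> E t <> 0%C)
    by (intros t Ht; apply free_psi_nonzero; [exact Hk | lra]).
  assert (DE' : forall t, r <= t <= b -> is_CDerive E t (E1 t)).
  { intros t Ht; apply (is_CDerive_free_psi n H1 H2 HD); [exact Hk | lra]. }
  assert (DE1 : forall t, r <= t <= b -> is_CDerive E1 t (P0 t * E t)%C).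
  { intros t Ht; apply is_CDerive_free_psi1_ode; [exact Hk | lra]. }
  assert (Dm : forall t, r <= t <= b -> is_CDerive m t (md t)).
  { intros t Ht; apply (is_CDerive_div E1 E); [now apply NE | now apply DE1 | now apply DE']. }
  assert (DE : forall t, r <= t <= b -> is_CDerive E t (m t * E t)%C).
  { intros t Ht; eapply is_CDerive_eq; [now apply DE'|].
    unfold m; field; now apply NE. }
  assert (Dp : forall t, r <= t <= b -> is_CDerive (psi k) t (psi1 k t))
    by (intros t Ht; apply Hpsi; [exact Hk | lra]).
  assert (Dp1 : forall t, r <= t <= b -> is_CDerive (psi1 k) t (P t * psi k t)%C)
    by (intros t Ht; apply Hpsi1; [exact Hk | lra]).
  set (sig := Cmod k ^ 2 * Q).
  assert (Pk2 : 0 < Cmod k ^ 2 <= 1) by nra.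
  assert (Hsig : forall t, r <= t <= b -> Cmod (residual P m md t) <= sig).
  { intros t Ht.
    replace (residual P m md t) with (- (k ^ 2 * RtoC (q t)))%C.
    - rewrite Cmod_opp, Cmod_mult, Cmod_pow, Cmod_R; apply Rmult_le_compat_l; [lra | now apply HQ].
    - unfold residual, P, m, md, P0; rewrite !RtoC_plus; field; now apply NE. }
  assert (Mmu : forall t, r <= t <= b -> Re (m t) <= mu).
  { intros t Ht; eapply Rle_trans; [apply Re_le_Cmod|].
    set (z := (k * RtoC t)%C).
    assert (Hz : upper z) by (apply upper_scal; [exact Hk | lra]).
    assert (Nh := HankelH_nonzero z Hz).
    assert (Cz : Cmod z = Cmod k * t) by (unfold z; rewrite Cmod_mult, Cmod_R, Rabs_pos_eq; lra).
    assert (Zd : Cmod z <= d0).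
    { rewrite Cz; apply Rle_trans with (d0 / b * b); [|apply Req_le; field; lra].
      apply Rmult_le_compat; lra. }
    destruct (Hnear z (upper_off_cut z Hz) Zd) as [_ B].
    specialize (B (H1 z) (proj1 (HD z (upper_off_cut z Hz)))).
    assert (Nt : RtoC t <> 0%C) by (apply RtoC_neq_0; lra).
    unfold m, E, E1; rewrite free_psi_log_derivative by (auto; lra); fold z.
    replace (k * (H1 z / HankelH n z + / (2 * z)))%C with
      ((z * H1 z / HankelH n z + / 2) / RtoC t)%C
      by (unfold z in *; field; repeat split; auto; apply Hk).
    rewrite Cmod_div, Cmod_R, (Rabs_pos_eq t) by (auto; lra).
    assert (Pt : / t <= / r) by (apply Rinv_le_contravar; lra).
    unfold mu; apply Rmult_le_compat; try apply Cmod_ge_0; [left; apply Rinv_0_lt_compat; lra | |exact Pt].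
    apply Cmod_plus_le.
    - rewrite Cmod_div by exact Nh; apply Rle_div_l; [now apply Cmod_gt_0 | exact B].
    - rewrite Cmod_inv, Cmod_R, Rabs_pos_eq by (auto using C2_neq_0; lra); lra. }
  set (g := amplitude (psi k) E); set (h := amplitude1 (psi k) (psi1 k) m E).
  assert (Rb : r <= b <= b) by lra; assert (Rr : r <= r <= b) by lra.
  assert (Gb : g b = 1%C).
  { unfold g, amplitude; rewrite Hfree by (auto; lra); fold (E b); field; now apply NE. }
  assert (Hb : h b = 0%C).
  { unfold h, amplitude1.
    rewrite (scattering_derivative_free n H1 H2 HD q b hb k Hk (psi k) (psi1 k)
      (fun t Ht => Hpsi k t Hk Ht) (fun t Ht => Hpsi1 k t Hk Ht) (fun t Ht => Hfree k t Hk Ht)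
      b (Rle_refl b)), Hfree by (auto; lra).
    unfold m; fold E E1; field; now apply NE. }
  assert (En := amplitude_energy_bound r b ltac:(lra) (psi k) (psi1 k) P m md E
    Dp Dp1 Dm DE NE sig Hsig mu ltac:(lra) Mmu).
  fold g h in En; rewrite Gb, Hb, Cmod_1, Cmod_0 in En.
  assert (HG : forall t, r <= t <= b -> Cmod (g t) <= G).
  { intros t Ht; apply Cmod_le_of_sqr; [lra|].
    specialize (En t Ht); assert (0 <= Cmod (h t) ^ 2) by apply pow2_ge_0.
    assert (Le : exp ((1 + 4 * mu + sig) * (b - r)) <= G ^ 2).
    { replace (G ^ 2) with (G * G) by ring; rewrite EG.
      assert (S : sig <= Q) by (unfold sig; nra).
      destruct (Req_dec ((1 + 4 * mu + sig) * (b - r)) ((1 + 4 * mu + Q) * (b - r))) as [->|Hn]; [lra|].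
      left; apply exp_increasing.
      assert ((1 + 4 * mu + sig) * (b - r) <= (1 + 4 * mu + Q) * (b - r))
        by (apply Rmult_le_compat_r; lra).
      lra. }
    replace (1 ^ 2 + 0 ^ 2) with 1 in En by ring; lra. }
  assert (Hh := amplitude1_bound r b ltac:(lra) (psi k) (psi1 k) P m md E
    Dp Dp1 Dm DE NE sig Hsig mu G ltac:(lra) Mmu HG).
  fold h in Hh; rewrite Hb, Cmod_0 in Hh.
  assert (Hh' : forall t, r <= t <= b -> Cmod (h t) <= C0 * Cmod k ^ 2).
  { intros t Ht; apply Cmod_le_of_sqr; [apply Rmult_le_pos; lra|].
    eapply Rle_trans; [exact (Hh t Ht)|]; apply Req_le.
    replace ((C0 * Cmod k ^ 2) ^ 2) with ((C0 * C0) * (Cmod k ^ 2) ^ 2) by ring.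
    rewrite EC0; unfold sig; ring. }
  assert (Hg : / 2 <= Cmod (g r)).
  { assert (I := Cmod_increment_le_lin g h (C0 * Cmod k ^ 2) r b ltac:(lra)
      (fun t Ht => is_CDerive_amplitude r b (psi k) (psi1 k) m E Dp DE NE t Ht) Hh').
    rewrite Gb in I; assert (T := Cmod_triangle_inv 1%C (g r)); rewrite Cmod_1 in T.
    assert (X : C0 * Cmod k ^ 2 * (b - r) <= / 2).
    { apply Rle_trans with (C0 * (b - r) * / (2 * (C0 * (b - r) + 1))).
      - replace (C0 * Cmod k ^ 2 * (b - r)) with (C0 * (b - r) * Cmod k ^ 2) by ring.
        apply Rmult_le_compat_l; [exact PCb | nra].
      - apply Rmult_le_reg_r with (2 * (C0 * (b - r) + 1)); [lra|].
        field_simplify; [lra | nra]. }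
    lra. }
  assert (Np : psi k r <> 0%C).
  { apply (scattering_neq_0 n H1 H2 HD bessel q q_pos b hb k Hk (psi k) (psi1 k)); auto; lra. }
  change (E1 r / E r)%C with (m r).
  rewrite (amplitude_log_derivative r b (psi k) (psi1 k) m E NE r Rr Np); fold g h.
  rewrite Cmod_div by (apply Cmod_neq_0; lra).
  apply Rle_div_l; [lra|].
  eapply Rle_trans; [exact (Hh' r Rr)|].
  assert (0 <= C0 * Cmod k ^ 2) by (apply Rmult_le_pos; lra); nra.
Qed.

End LowFrequency.

(** * Differentiability in the wave number *)

Lemma is_CDerive_continuous_parts (f : R -> C) (t : R) (l : C) :
  is_CDerive f t l -> continuous (fun s => Re (f s)) t /\ continuous (fun s => Im (f s)) t.
Proof.
  intros [F1 F2]; split; eapply is_derive_continuous; eassumption.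
Qed.

Lemma is_CDerive_bounded (f df : R -> C) (a b : R) :
  a <= b -> (forall t, a <= t <= b -> is_CDerive f t (df t)) ->
  exists M, 0 <= M /\ forall t, a <= t <= b -> Cmod (f t) <= M.
Proof.
  intros Hab Hf.
  destruct (continuous_bounded (fun s => Re (f s)) a b Hab) as (M1 & P1 & B1).
  { intros t Ht; exact (proj1 (is_CDerive_continuous_parts f t _ (Hf t Ht))). }
  destruct (continuous_bounded (fun s => Im (f s)) a b Hab) as (M2 & P2 & B2).
  { intros t Ht; exact (proj2 (is_CDerive_continuous_parts f t _ (Hf t Ht))). }
  exists (M1 + M2); split; [lra|]; intros t Ht.
  eapply Rle_trans; [apply Cmod_le_Re_Im|]; specialize (B1 t Ht); specialize (B2 t Ht); lra.
Qed.

Definition primitive (f : R -> C) (b t : R) : C :=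
  (RInt (fun s => Re (f s)) b t, RInt (fun s => Im (f s)) b t).

Lemma is_derive_RInt_pos (f : R -> R) (b t : R) :
  0 < b -> 0 < t -> (forall s, 0 < s -> continuous f s) ->
  is_derive (fun u => RInt f b u) t (f t).
Proof.
  intros Hb Ht Hf; apply is_derive_RInt with b.
  - exists (mkposreal t Ht); intros u Hu.
    change (Rabs (u - t) < t) in Hu; apply Rabs_def2 in Hu.
    apply (RInt_correct f), (ex_RInt_continuous f); intros v Hv; apply Hf.
    assert (X : 0 < Rmin b u) by (apply Rmin_pos; lra); lra.
  - now apply Hf.
Qed.

Lemma is_CDerive_primitive (f : R -> C) (b t : R) :
  0 < b -> 0 < t ->
  (forall s, 0 < s -> continuous (fun u => Re (f u)) s /\ continuous (fun u => Im (f u)) s) ->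
  is_CDerive (primitive f b) t (f t).
Proof.
  intros Hb Ht Hf; split.
  - exact (is_derive_RInt_pos (fun u => Re (f u)) b t Hb Ht (fun s Hs => proj1 (Hf s Hs))).
  - exact (is_derive_RInt_pos (fun u => Im (f u)) b t Hb Ht (fun s Hs => proj2 (Hf s Hs))).
Qed.

Lemma primitive_point (f : R -> C) (b : R) : primitive f b b = 0%C.
Proof. unfold primitive; rewrite !RInt_point; reflexivity. Qed.

(** At a zero of one factor, continuity of the other suffices. It is applied to the Wronskian of two
    wave numbers, which vanishes when they coincide. *)
Lemma is_Cdiff_mult_zero (D : C -> Prop) (w g : C -> C) (z l : C) :
  w z = 0%C -> is_Cdiff D w z l -> Ccont D g z ->
  is_Cdiff D (fun k => w k * g k)%C z (l * g z)%C.
Proof.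
  intros Hw (phi & E & Hc & <-) Hg.
  exists (fun k => phi k * g k)%C; repeat split.
  - intros k Dk; specialize (E k Dk); rewrite Hw in *.
    replace (w k * g k - 0 * g z)%C with ((w k - 0) * g k)%C by ring; rewrite E; ring.
  - now apply Ccont_mult.
Qed.

Section WaveNumber.
Context (n : nat) (H1 H2 : C -> C) (HD : Cdiff2 (HankelH n) H1 H2).
Context (bessel : forall z : C, z <> 0%C -> 0 <= Im z ->
  (H2 z + H1 z / z + (1 - RtoC (INR n ^ 2) / z ^ 2) * HankelH n z = 0)%C).
Context (q : R -> R) (q_pos : forall r, 0 < 1 + q r) (Hqc : forall t, continuous q t).
Context (b : R) (hb : 0 < b).
Context (psi psi1 : C -> R -> C).
Context (Hpsi : forall k r, upper k -> 0 < r -> is_CDerive (psi k) r (psi1 k r)).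
Context (Hpsi1 : forall k r, upper k -> 0 < r ->
  is_CDerive (psi1 k) r
    ((RtoC ((INR n ^ 2 - 1 / 4) / r ^ 2) - k ^ 2 * RtoC (1 + q r)) * psi k r)%C).
Context (Hfree : forall k r, upper k -> b <= r -> psi k r = free_psi n k r).

Let nu : R := INR n ^ 2 - 1 / 4.

Lemma psi_nonzero (k : C) (r : R) : upper k -> 0 < r -> psi k r <> 0%C.
Proof.
  intros Hk Hr.
  apply (scattering_neq_0 n H1 H2 HD bessel q q_pos b hb k Hk (psi k) (psi1 k)); auto.
Qed.

Lemma psi_b (k : C) : upper k -> psi k b = free_psi n k b.
Proof. intros Hk; apply Hfree; [exact Hk | lra]. Qed.

Lemma psi1_b (k : C) : upper k -> psi1 k b = free_psi1 n H1 k b.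
Proof.
  intros Hk; apply (scattering_derivative_free n H1 H2 HD q b hb k Hk (psi k) (psi1 k)); auto; lra.
Qed.

Lemma is_Cdiff_ray (f : C -> C) (k l : C) (r : R) :
  0 < r -> upper k -> is_Cdiff off_cut f (k * RtoC r)%C l ->
  is_Cdiff upper (fun k => f (k * RtoC r)%C) k (RtoC r * l)%C.
Proof.
  intros Hr Hk H; eapply is_Cdiff_eq; [|apply Cmult_comm].
  apply (is_Cdiff_comp upper off_cut f (fun k => k * RtoC r)%C).
  - intros w Hw; now apply upper_off_cut, upper_scal.
  - exact H.
  - eapply is_Cdiff_eq.
    + apply (is_Cdiff_mult upper (fun k => k) (fun _ => RtoC r));
        [apply is_Cdiff_id | apply is_Cdiff_const].
    + cbv beta; ring.
Qed.

Let dpsib (k : C) : C := (RtoC (sqrt b) * (RtoC b * H1 (k * RtoC b)))%C.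
Let dpsi1b (k : C) : C :=
  (RtoC (/ (2 * sqrt b)) * (RtoC b * H1 (k * RtoC b)) +
   RtoC (sqrt b) * (1 * H1 (k * RtoC b) + k * (RtoC b * H2 (k * RtoC b))))%C.

Lemma is_Cdiff_psi_b (k : C) : upper k -> is_Cdiff upper (fun k => psi k b) k (dpsib k).
Proof.
  intros Hk; apply (is_Cdiff_ext upper (fun k => free_psi n k b)); auto.
  { intros w Hw; now rewrite psi_b. }
  apply (is_Cdiff_scal upper (RtoC (sqrt b)) (fun k => HankelH n (k * RtoC b))).
  apply is_Cdiff_ray; auto; apply HD; now apply upper_off_cut, upper_scal.
Qed.

Lemma is_Cdiff_psi1_b (k : C) : upper k -> is_Cdiff upper (fun k => psi1 k b) k (dpsi1b k).
Proof.
  intros Hk; apply (is_Cdiff_ext upper (fun k => free_psi1 n H1 k b)); auto.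
  { intros w Hw; now rewrite psi1_b. }
  assert (Hc : off_cut (k * RtoC b)) by now apply upper_off_cut, upper_scal.
  apply (is_Cdiff_plus upper (fun k => RtoC (/ (2 * sqrt b)) * HankelH n (k * RtoC b))%C
    (fun k => RtoC (sqrt b) * (k * H1 (k * RtoC b)))%C).
  - apply (is_Cdiff_scal upper _ (fun k => HankelH n (k * RtoC b))).
    apply is_Cdiff_ray; auto; now apply HD.
  - apply (is_Cdiff_scal upper _ (fun k => k * H1 (k * RtoC b))%C).
    apply (is_Cdiff_mult upper (fun k => k) (fun k => H1 (k * RtoC b)%C)); [apply is_Cdiff_id|].
    apply is_Cdiff_ray; auto; now apply HD.
Qed.

Context (r : R) (Hr : 0 < r <= b).

(** The difference of two solutions satisfies the equation for [k'] with source
    [(k' - k) (k' + k) (1 + q) psi k]. Its data at [b] are small because they are explicit in the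
    Hankel function; the energy estimate carries this down to [r]. *)
Lemma psi_uniform_continuity (k : C) (eps : R) :
  upper k -> 0 < eps -> exists delta, 0 < delta /\ forall k', upper k' -> Cmod (k' - k) < delta ->
    forall s, r <= s <= b ->
      Cmod (psi k' s - psi k s) < eps /\ Cmod (psi1 k' s - psi1 k s) < eps.
Proof.
  intros Hk Heps.
  destruct (continuous_bounded q r b ltac:(lra)) as (Q & PQ & HQ); [intros; apply Hqc|].
  destruct (is_CDerive_bounded (psi k) (psi1 k) r b ltac:(lra)) as (M & PM & HM).
  { intros t Ht; apply Hpsi; [exact Hk | lra]. }
  assert (Pk := Cmod_ge_0 k); assert (Pnu := Rabs_pos nu).
  set (A := Rabs nu / r ^ 2 + (Cmod k + 1) ^ 2 * (1 + Q)).
  assert (PA : 0 <= A).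
  { unfold A; assert (0 <= Rabs nu / r ^ 2).
    { apply Rmult_le_pos; [lra | left; apply Rinv_0_lt_compat; nra]. }
    assert (0 <= (Cmod k + 1) ^ 2 * (1 + Q)) by (apply Rmult_le_pos; [apply pow2_ge_0 | lra]).
    lra. }
  set (G := exp ((2 + A) * (b - r))); assert (PG : 0 < G) by apply exp_pos.
  set (L := (2 * Cmod k + 1) * (1 + Q) * M).
  assert (PL : 0 <= L) by (unfold L; repeat apply Rmult_le_pos; lra).
  (* The two data terms and the source term each cost at most [e2], so the energy stays below
     [3 / 4 eps^2]. *)
  set (e2 := eps ^ 2 / (4 * G)).
  assert (Pe2 : 0 < e2) by (apply Rdiv_lt_0_compat; nra).
  set (e1 := sqrt e2); assert (Pe1 : 0 < e1) by now apply sqrt_lt_R0.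
  assert (Ee1 : e1 * e1 = e2) by (apply sqrt_sqrt; lra).
  destruct (is_Cdiff_cont _ _ _ _ (is_Cdiff_psi_b k Hk) e1 Pe1) as (d1 & Pd1 & F1).
  destruct (is_Cdiff_cont _ _ _ _ (is_Cdiff_psi1_b k Hk) e1 Pe1) as (d2 & Pd2 & F2).
  set (d3 := e1 / (L * (1 + (b - r)) + 1)).
  assert (PL' : 0 <= L * (1 + (b - r))) by (apply Rmult_le_pos; lra).
  assert (Pd3 : 0 < d3) by (apply Rdiv_lt_0_compat; lra).
  exists (Rmin (Rmin d1 d2) (Rmin 1 d3)); split; [repeat apply Rmin_pos; lra|].
  intros k' Hk' Hd s Hs.
  assert (X1 := Rlt_le_trans _ _ _ (Rlt_le_trans _ _ _ Hd (Rmin_l _ _)) (Rmin_l _ _)).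
  assert (X2 := Rlt_le_trans _ _ _ (Rlt_le_trans _ _ _ Hd (Rmin_l _ _)) (Rmin_r _ _)).
  assert (X3 := Rlt_le_trans _ _ _ (Rlt_le_trans _ _ _ Hd (Rmin_r _ _)) (Rmin_l _ _)).
  assert (X4 := Rlt_le_trans _ _ _ (Rlt_le_trans _ _ _ Hd (Rmin_r _ _)) (Rmin_r _ _)).
  specialize (F1 k' Hk' X1); specialize (F2 k' Hk' X2); cbv beta in F1, F2.
  assert (Pd := Cmod_ge_0 (k' - k)).
  assert (Ck' : Cmod k' <= Cmod k + 1) by (assert (T := Cmod_triangle_inv k' k); lra).
  set (B := Cmod (k' - k) * L).
  assert (PB : 0 <= B) by (now apply Rmult_le_pos).
  assert (HB : B * (1 + (b - r)) <= e1).
  { unfold B; apply Rle_trans with (d3 * (L * (1 + (b - r)))).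
    - rewrite Rmult_assoc; apply Rmult_le_compat_r; lra.
    - unfold d3; unfold Rdiv; rewrite Rmult_assoc.
      rewrite <- (Rmult_1_r e1) at 2; apply Rmult_le_compat_l; [lra|].
      apply Rmult_le_reg_l with (L * (1 + (b - r)) + 1); [lra|].
      rewrite <- Rmult_assoc, Rinv_r by lra; lra. }
  assert (W := second_order_gronwall (fun t => psi k' t - psi k t)%C (fun t => psi1 k' t - psi1 k t)%C
    (fun t => (RtoC (nu / t ^ 2) - k' ^ 2 * RtoC (1 + q t)) * psi k' t -
       (RtoC (nu / t ^ 2) - k ^ 2 * RtoC (1 + q t)) * psi k t)%C A B s b PA PB ltac:(lra)).
  cbv beta in W.
  assert (W' : Cmod (psi k' s - psi k s) ^ 2 + Cmod (psi1 k' s - psi1 k s) ^ 2 <=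
    exp ((2 + A) * (b - s)) * (Cmod (psi k' b - psi k b) ^ 2 + Cmod (psi1 k' b - psi1 k b) ^ 2
      + B ^ 2 * (b - s))).
  { apply W.
    - intros t Ht; apply is_CDerive_minus; apply Hpsi; auto; lra.
    - intros t Ht; apply is_CDerive_minus; apply Hpsi1; auto; lra.
    - intros t Ht.
      assert (Rt : r <= t <= b) by lra.
      assert (Qt : Rabs (1 + q t) <= 1 + Q).
      { eapply Rle_trans; [apply Rabs_triang|]; rewrite Rabs_R1; specialize (HQ t Rt); lra. }
      replace ((RtoC (nu / t ^ 2) - k' ^ 2 * RtoC (1 + q t)) * psi k' t -
        (RtoC (nu / t ^ 2) - k ^ 2 * RtoC (1 + q t)) * psi k t)%C with
        ((RtoC (nu / t ^ 2) - k' ^ 2 * RtoC (1 + q t)) * (psi k' t - psi k t) -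
         (k' - k) * ((k' + k) * RtoC (1 + q t) * psi k t))%C by ring.
      apply Cmod_minus_le.
      + apply Cmod_mult_le; [|lra].
        apply Cmod_minus_le.
        * rewrite Cmod_R; unfold Rdiv; rewrite Rabs_mult, (Rabs_pos_eq (/ t ^ 2))
            by (left; apply Rinv_0_lt_compat; nra).
          apply Rmult_le_compat_l; [lra|]; apply Rinv_le_contravar; [nra | apply pow_incr; lra].
        * apply Cmod_mult_le; [|now rewrite Cmod_R].
          rewrite Cmod_pow; apply pow_incr; split; [apply Cmod_ge_0 | exact Ck'].
      + apply Cmod_mult_le; [lra|]; unfold L.
        apply Cmod_mult_le; [|now apply HM]; apply Cmod_mult_le; [|now rewrite Cmod_R].
        eapply Rle_trans; [apply Cmod_triangle | lra]. }
  assert (Ge : exp ((2 + A) * (b - s)) <= G).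
  { unfold G; destruct (Req_dec s r) as [->|Hn]; [lra|].
    left; apply exp_increasing, Rmult_lt_compat_l; lra. }
  assert (Tot : Cmod (psi k' b - psi k b) ^ 2 + Cmod (psi1 k' b - psi1 k b) ^ 2 + B ^ 2 * (b - s)
    <= 3 * e2).
  { assert (Y1 : Cmod (psi k' b - psi k b) ^ 2 <= e2).
    { rewrite <- Ee1; assert (X := Cmod_ge_0 (psi k' b - psi k b)); nra. }
    assert (Y2 : Cmod (psi1 k' b - psi1 k b) ^ 2 <= e2).
    { rewrite <- Ee1; assert (X := Cmod_ge_0 (psi1 k' b - psi1 k b)); nra. }
    assert (Y3 : B ^ 2 * (b - s) <= e2).
    { rewrite <- Ee1; apply Rle_trans with ((B * (1 + (b - r))) * (B * (1 + (b - r)))).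
      - replace ((B * (1 + (b - r))) * (B * (1 + (b - r)))) with
          (B ^ 2 * ((1 + (b - r)) * (1 + (b - r)))) by ring.
        apply Rmult_le_compat_l; [apply pow2_ge_0 | nra].
      - apply Rmult_le_compat; try exact HB; apply Rmult_le_pos; lra. }
    lra. }
  assert (Fin : Cmod (psi k' s - psi k s) ^ 2 + Cmod (psi1 k' s - psi1 k s) ^ 2 < eps ^ 2).
  { apply Rle_lt_trans with (G * (3 * e2)).
    - eapply Rle_trans; [exact W'|]; apply Rmult_le_compat; auto; [left; apply exp_pos|].
      repeat apply Rplus_le_le_0_compat; try apply pow2_ge_0.
      apply Rmult_le_pos; [apply pow2_ge_0 | lra].
    - unfold e2; replace (G * (3 * (eps ^ 2 / (4 * G)))) with (3 / 4 * eps ^ 2) by (field; lra); nra. }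
  assert (P0 := Cmod_ge_0 (psi k' s - psi k s)); assert (P1 := Cmod_ge_0 (psi1 k' s - psi1 k s)).
  set (x := Cmod (psi k' s - psi k s)) in *; set (y := Cmod (psi1 k' s - psi1 k s)) in *.
  assert (0 <= x ^ 2) by apply pow2_ge_0; assert (0 <= y ^ 2) by apply pow2_ge_0.
  split; apply Rnot_le_lt; intros Hle.
  - assert (eps ^ 2 <= x ^ 2) by (apply pow_incr; lra); lra.
  - assert (eps ^ 2 <= y ^ 2) by (apply pow_incr; lra); lra.
Qed.

Let J (k : C) (s : R) : C := primitive (fun t => RtoC (1 + q t) * (psi k t * psi k t))%C b s.

Lemma is_CDerive_J (k : C) (s : R) :
  upper k -> 0 < s -> is_CDerive (J k) s (RtoC (1 + q s) * (psi k s * psi k s))%C.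
Proof.
  intros Hk Hs; apply (is_CDerive_primitive (fun t => RtoC (1 + q t) * (psi k t * psi k t))%C); auto.
  intros t Ht.
  assert (D := is_CDerive_mult _ _ _ _ _ (Hpsi k t Hk Ht) (Hpsi k t Hk Ht)).
  destruct (is_CDerive_continuous_parts _ _ _ D) as [C1 C2].
  assert (C0 : continuous (fun t => 1 + q t) t)
    by (apply (continuous_plus (fun _ => 1) q); [apply continuous_const | apply Hqc]).
  split.
  - apply (continuous_ext (fun u => (1 + q u) * Re (psi k u * psi k u)%C)).
    { intros u; unfold Re; simpl; ring. }
    now apply (continuous_mult (fun u => 1 + q u) (fun u => Re (psi k u * psi k u)%C)).
  - apply (continuous_ext (fun u => (1 + q u) * Im (psi k u * psi k u)%C)).
    { intros u; unfold Im; simpl; ring. }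
    now apply (continuous_mult (fun u => 1 + q u) (fun u => Im (psi k u * psi k u)%C)).
Qed.

Lemma J_b (k : C) : J k b = 0%C.
Proof. apply primitive_point. Qed.

Lemma Ccont_J (k : C) : upper k -> Ccont upper (fun k => J k r) k.
Proof.
  intros Hk eps Heps.
  destruct (continuous_bounded q r b ltac:(lra)) as (Q & PQ & HQ); [intros; apply Hqc|].
  destruct (is_CDerive_bounded (psi k) (psi1 k) r b ltac:(lra)) as (M & PM & HM).
  { intros t Ht; apply Hpsi; [exact Hk | lra]. }
  set (c := (1 + Q) * (2 * M + 1) * (b - r) + 1).
  assert (Pc : 0 < c).
  { unfold c; assert (0 <= (1 + Q) * (2 * M + 1) * (b - r)) by (repeat apply Rmult_le_pos; lra); lra. }
  assert (He : 0 < Rmin 1 (eps / c)) by (apply Rmin_pos; [lra | now apply Rdiv_lt_0_compat]).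
  destruct (psi_uniform_continuity k _ Hk He) as (d & Pd & F).
  exists d; split; [exact Pd|]; intros k' Hk' Hd.
  assert (I := Cmod_increment_le_lin (fun s => J k' s - J k s)%C
    (fun s => RtoC (1 + q s) * (psi k' s * psi k' s) - RtoC (1 + q s) * (psi k s * psi k s))%C
    ((1 + Q) * (eps / c * (2 * M + 1))) r b ltac:(lra)).
  cbv beta in I; rewrite !J_b in I.
  rewrite <- (Cmod_opp (J k' r - J k r)).
  replace (- (J k' r - J k r))%C with (0 - 0 - (J k' r - J k r))%C by ring.
  eapply Rle_lt_trans; [apply I|].
  - intros t Ht; apply is_CDerive_minus; apply is_CDerive_J; auto; lra.
  - intros t Ht.
    destruct (F k' Hk' Hd t Ht) as [F1 _].
    assert (F2 := Rlt_le_trans _ _ _ F1 (Rmin_l _ _)); assert (F3 := Rlt_le_trans _ _ _ F1 (Rmin_r _ _)).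
    replace (RtoC (1 + q t) * (psi k' t * psi k' t) - RtoC (1 + q t) * (psi k t * psi k t))%C with
      (RtoC (1 + q t) * ((psi k' t - psi k t) * ((psi k' t - psi k t) + 2 * psi k t)))%C by ring.
    apply Cmod_mult_le.
    + rewrite Cmod_R; eapply Rle_trans; [apply Rabs_triang|].
      rewrite Rabs_R1; specialize (HQ t Ht); lra.
    + apply Cmod_mult_le; [lra|].
      rewrite Rplus_comm; apply Cmod_plus_le; [lra|].
      apply Cmod_mult_le; [rewrite Cmod_R, Rabs_pos_eq; lra | now apply HM].
  - replace ((1 + Q) * (eps / c * (2 * M + 1)) * (b - r)) with (eps * ((c - 1) / c))
      by (unfold c; field; fold c; lra).
    rewrite <- (Rmult_1_r eps) at 2; apply Rmult_lt_compat_l; [exact Heps|].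
    apply Rlt_div_l; lra.
Qed.

Let wr (k k' : C) (s : R) : C := (psi1 k' s * psi k s - psi k' s * psi1 k s)%C.

(** Lagrange's identity for the Wronskian of the solutions at [k] and [k']. *)
Lemma is_CDerive_wr (k k' : C) (s : R) :
  upper k -> upper k' -> 0 < s ->
  is_CDerive (wr k k') s ((k ^ 2 - k' ^ 2) * (RtoC (1 + q s) * (psi k s * psi k' s)))%C.
Proof.
  intros Hk Hk' Hs; unfold wr; eapply is_CDerive_eq.
  - apply is_CDerive_minus; apply is_CDerive_mult; eauto.
  - ring.
Qed.

Let dwr (k : C) : C := ((dpsi1b k * psi k b - dpsib k * psi1 k b) - 2 * k * J k r)%C.

Lemma is_Cdiff_wr (k : C) : upper k -> is_Cdiff upper (fun k' => wr k k' r) k (dwr k).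
Proof.
  intros Hk.
  apply (is_Cdiff_ext upper (fun k' => (wr k k' b + (k ^ 2 - k' ^ 2) * J k r) +
    (wr k k' r - wr k k' b - (k ^ 2 - k' ^ 2) * J k r))%C); [exact Hk | intros; ring|].
  apply (is_Cdiff_eq _ _ _ (((dpsi1b k * psi k b - dpsib k * psi1 k b)
    + - (2 * k) * J k r) + 0)%C); [|unfold dwr; ring].
  apply (is_Cdiff_plus upper (fun k' => wr k k' b + (k ^ 2 - k' ^ 2) * J k r)%C
    (fun k' => wr k k' r - wr k k' b - (k ^ 2 - k' ^ 2) * J k r)%C).
  - apply (is_Cdiff_plus upper (fun k' => wr k k' b) (fun k' => (k ^ 2 - k' ^ 2) * J k r)%C).
    + unfold wr.
      apply (is_Cdiff_minus upper (fun k' => psi1 k' b * psi k b)%C (fun k' => psi k' b * psi1 k b)%C).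
      * eapply is_Cdiff_eq.
        -- apply (is_Cdiff_mult upper (fun k' => psi1 k' b) (fun _ => psi k b));
             [now apply is_Cdiff_psi1_b | apply is_Cdiff_const].
        -- cbv beta; ring.
      * eapply is_Cdiff_eq.
        -- apply (is_Cdiff_mult upper (fun k' => psi k' b) (fun _ => psi1 k b));
             [now apply is_Cdiff_psi_b | apply is_Cdiff_const].
        -- cbv beta; ring.
    + eapply is_Cdiff_eq.
      * apply (is_Cdiff_mult upper (fun k' => k ^ 2 - k' ^ 2)%C (fun _ => J k r));
          [|apply is_Cdiff_const].
        apply (is_Cdiff_minus upper (fun _ => (k ^ 2)%C)); [apply is_Cdiff_const|].
        apply (is_Cdiff_pow upper (fun k' => k')), is_Cdiff_id.
      * cbv beta; replace (INR 2) with 2 by (simpl; ring); simpl; ring.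
  - apply is_Cdiff_intro; intros eps Heps.
    destruct (continuous_bounded q r b ltac:(lra)) as (Q & PQ & HQ); [intros; apply Hqc|].
    destruct (is_CDerive_bounded (psi k) (psi1 k) r b ltac:(lra)) as (M & PM & HM).
    { intros t Ht; apply Hpsi; [exact Hk | lra]. }
    assert (Pk := Cmod_ge_0 k).
    set (c := (2 * Cmod k + 1) * ((1 + Q) * M) * (b - r) + 1).
    assert (Pc : 0 < c).
    { unfold c; assert (0 <= (2 * Cmod k + 1) * ((1 + Q) * M) * (b - r))
        by (repeat apply Rmult_le_pos; lra); lra. }
    assert (He : 0 < eps / c) by now apply Rdiv_lt_0_compat.
    destruct (psi_uniform_continuity k _ Hk He) as (d & Pd & F).
    exists (Rmin 1 d); split; [apply Rmin_pos; lra|]; intros k' Hk' Hd.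
    assert (X1 := Rlt_le_trans _ _ _ Hd (Rmin_l _ _)); assert (X2 := Rlt_le_trans _ _ _ Hd (Rmin_r _ _)).
    assert (Pd' := Cmod_ge_0 (k' - k)).
    assert (Ck' : Cmod k' <= Cmod k + 1) by (assert (T := Cmod_triangle_inv k' k); lra).
    assert (W0 : forall s, wr k k s = 0%C) by (intros; unfold wr; ring).
    rewrite !W0.
    assert (I := Cmod_increment_le_lin (fun s => wr k k' s - (k ^ 2 - k' ^ 2) * J k s)%C
      (fun s => (k ^ 2 - k' ^ 2) * (RtoC (1 + q s) * (psi k s * psi k' s)) -
         (k ^ 2 - k' ^ 2) * (RtoC (1 + q s) * (psi k s * psi k s)))%C
      (Cmod (k' - k) * ((2 * Cmod k + 1) * ((1 + Q) * (M * (eps / c))))) r b ltac:(lra)).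
    cbv beta in I; rewrite J_b in I.
    replace (wr k k' r - wr k k' b - (k ^ 2 - k' ^ 2) * J k r -
      (0 - 0 - (k ^ 2 - k ^ 2) * J k r) - 0 * (k' - k))%C with
      (- (wr k k' b - (k ^ 2 - k' ^ 2) * 0 - (wr k k' r - (k ^ 2 - k' ^ 2) * J k r)))%C by ring.
    rewrite Cmod_opp; eapply Rle_trans; [apply I|].
    + intros t Ht; apply is_CDerive_minus; [apply is_CDerive_wr; auto; lra|].
      apply is_CDerive_scal, is_CDerive_J; auto; lra.
    + intros t Ht.
      destruct (F k' Hk' X2 t Ht) as [F1 _].
      replace ((k ^ 2 - k' ^ 2) * (RtoC (1 + q t) * (psi k t * psi k' t)) -
         (k ^ 2 - k' ^ 2) * (RtoC (1 + q t) * (psi k t * psi k t)))%C with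
        (- ((k' - k) * ((k' + k) * (RtoC (1 + q t) * (psi k t * (psi k' t - psi k t))))))%C by ring.
      rewrite Cmod_opp.
      apply Cmod_mult_le; [lra|]; apply Cmod_mult_le; [eapply Rle_trans; [apply Cmod_triangle | lra]|].
      apply Cmod_mult_le.
      * rewrite Cmod_R; eapply Rle_trans; [apply Rabs_triang|].
        rewrite Rabs_R1; specialize (HQ t Ht); lra.
      * apply Cmod_mult_le; [now apply HM | lra].
    + replace (Cmod (k' - k) * ((2 * Cmod k + 1) * ((1 + Q) * (M * (eps / c)))) * (b - r)) with
        (((c - 1) / c) * (eps * Cmod (k' - k))) by (unfold c; field; fold c; lra).
      rewrite <- (Rmult_1_l (eps * Cmod (k' - k))) at 2; apply Rmult_le_compat_r; [nra|].
      apply Rle_div_l; lra.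
Qed.

Definition dlog (k : C) : C := (dwr k * / (psi k r * psi k r))%C.

Lemma Ccont_psi (k : C) : upper k -> Ccont upper (fun k => psi k r) k.
Proof.
  intros Hk eps Heps; destruct (psi_uniform_continuity k eps Hk Heps) as (d & Pd & F).
  exists d; split; [exact Pd|]; intros k' Hk' Hd; apply F; auto; lra.
Qed.

(** The difference of the logarithmic derivatives at [k'] and [k] is
    [wr k k' r / (psi k r * psi k' r)]: a differentiable numerator vanishing at [k' = k] over a
    continuous, nonzero denominator. *)
Theorem is_Cdiff_log_derivative (k : C) :
  upper k -> is_Cdiff upper (fun k => psi1 k r / psi k r)%C k (dlog k).
Proof.
  intros Hk.
  assert (N : forall w, upper w -> psi w r <> 0%C) by (intros; apply psi_nonzero; auto; lra).
  apply (is_Cdiff_ext upper (fun k' => psi1 k r / psi k r +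
    wr k k' r * / (psi k r * psi k' r))%C); [exact Hk | |].
  - intros k' Hk'; unfold wr; field; split; auto.
  - eapply is_Cdiff_eq.
    + apply (is_Cdiff_plus upper (fun _ => psi1 k r / psi k r)%C); [apply is_Cdiff_const|].
      apply (is_Cdiff_mult_zero upper (fun k' => wr k k' r) (fun k' => / (psi k r * psi k' r))%C).
      * unfold wr; ring.
      * now apply is_Cdiff_wr.
      * apply Ccont_inv; [now apply Cmult_neq_0; apply N|].
        apply Ccont_mult; [apply Ccont_const | now apply Ccont_psi].
    + unfold dlog; ring.
Qed.

Lemma Ccont_ray (f : C -> C) (k : C) (s : R) :
  0 < s -> Ccont off_cut f (k * RtoC s)%C -> Ccont upper (fun k => f (k * RtoC s)%C) k.
Proof.
  intros Hs H; apply (Ccont_comp upper off_cut f (fun k => k * RtoC s)%C); auto.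
  - intros w Hw; now apply upper_off_cut, upper_scal.
  - apply Ccont_mult; [apply Ccont_id | apply Ccont_const].
Qed.

(** Up to the real axis the derivative is one-sided, so its continuity is checked on the explicit
    formula; differentiating the half-circle integral in the radius depends on it. *)
Theorem Ccont_dlog (k : C) : upper k -> Ccont upper dlog k.
Proof.
  intros Hk.
  assert (Hc : off_cut (k * RtoC b)) by now apply upper_off_cut, upper_scal.
  destruct (HD _ Hc) as (_ & D1 & C2); apply is_Cdiff_cont in D1.
  assert (CH1 := Ccont_ray H1 k b hb D1); assert (CH2 := Ccont_ray H2 k b hb C2).
  assert (Cb := is_Cdiff_cont _ _ _ _ (is_Cdiff_psi_b k Hk)).
  assert (Cb1 := is_Cdiff_cont _ _ _ _ (is_Cdiff_psi1_b k Hk)).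
  assert (CJ := Ccont_J k Hk); assert (Cp := Ccont_psi k Hk).
  unfold dlog, dwr, dpsib, dpsi1b.
  repeat first [ exact CH1 | exact CH2 | exact Cb | exact Cb1 | exact CJ | exact Cp
    | apply Ccont_const | apply Ccont_id | apply Ccont_plus | apply Ccont_opp
    | apply Ccont_mult | apply (Ccont_inv upper (fun k => psi k r * psi k r)%C) ].
  apply Cmult_neq_0; apply psi_nonzero; auto; lra.
Qed.

End WaveNumber.

(** * Cauchy's theorem in the upper half-plane *)

(** At the end points, the angles [0] and [PI] or the radius [0], only continuity is available. The
    difference between [u] and the integral of [du] has zero derivative inside the interval and is
    therefore constant. *)
Lemma is_RInt_derive_interior (u du : R -> R) (a b : R) :
  a <= b ->
  (forall x, a < x < b -> is_derive u x (du x)) ->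
  (forall x, a <= x <= b -> continuous u x) ->
  (forall x, continuous du x) ->
  is_RInt du a b (u b - u a).
Proof.
  intros Hab Hu Cu Cdu.
  assert (Ex : forall x y, ex_RInt du x y) by (intros; apply (ex_RInt_continuous du); auto).
  assert (DI : forall x, is_derive (fun y => RInt du a y) x (du x)).
  { intros x; apply is_derive_RInt with a; [|apply Cdu].
    apply filter_forall; intros y; apply (RInt_correct du), Ex. }
  destruct (MVT_gen (fun x => u x - RInt du a x) a b (fun _ => 0)) as (c & _ & E).
  - intros x Hx; rewrite Rmin_left, Rmax_right in Hx by exact Hab.
    assert (D := is_derive_minus u (fun y => RInt du a y) x _ _ (Hu x Hx) (DI x)).
    replace 0 with (minus (du x) (du x)) by (unfold minus, plus, opp; simpl; ring).
    exact D.
  - intros x Hx; rewrite Rmin_left, Rmax_right in Hx by exact Hab.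
    apply continuity_pt_filterlim.
    apply (continuous_minus u (fun y => RInt du a y)); [now apply Cu|].
    eapply is_derive_continuous, DI.
  - rewrite RInt_point in E; unfold zero in E; simpl in E.
    replace (u b - u a) with (RInt du a b) by lra.
    apply (RInt_correct du), Ex.
Qed.

(** * Joint continuity and polar coordinates on the half-plane *)

Definition Ccont2 (f : R -> R -> C) (x y : R) : Prop :=
  forall eps, 0 < eps -> exists delta, 0 < delta /\
    forall u v, Rabs (u - x) < delta -> Rabs (v - y) < delta -> Cmod (f u v - f x y) < eps.

Lemma Ccont2_comp (D : C -> Prop) (F : C -> C) (g : R -> R -> C) (x y d : R) :
  0 < d -> (forall u v, Rabs (u - x) < d -> D (g u v)) ->
  Ccont D F (g x y) -> Ccont2 g x y -> Ccont2 (fun u v => F (g u v)) x y.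
Proof.
  intros Hd HD HF Hg eps Heps.
  destruct (HF eps Heps) as (d1 & P1 & F1); destruct (Hg d1 P1) as (d2 & P2 & F2).
  exists (Rmin d d2); split; [now apply Rmin_pos|]; intros u v Hu Hv.
  apply F1.
  - apply HD; eapply Rlt_le_trans; [exact Hu | apply Rmin_l].
  - apply F2; eapply Rlt_le_trans; eauto using Rmin_r.
Qed.

Lemma Ccont2_mult (f g : R -> R -> C) (x y : R) :
  Ccont2 f x y -> Ccont2 g x y -> Ccont2 (fun u v => f u v * g u v)%C x y.
Proof.
  intros Hf Hg eps Heps.
  assert (P1 := Cmod_ge_0 (f x y)); assert (P2 := Cmod_ge_0 (g x y)).
  set (K := Cmod (f x y) + Cmod (g x y) + 1).
  assert (He : 0 < Rmin 1 (eps / (2 * K))).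
  { apply Rmin_pos; [lra | apply Rdiv_lt_0_compat; unfold K; lra]. }
  destruct (Hf _ He) as (d1 & Q1 & F1); destruct (Hg _ He) as (d2 & Q2 & F2).
  exists (Rmin d1 d2); split; [now apply Rmin_pos|]; intros u v Hu Hv.
  specialize (F1 u v (Rlt_le_trans _ _ _ Hu (Rmin_l _ _)) (Rlt_le_trans _ _ _ Hv (Rmin_l _ _))).
  specialize (F2 u v (Rlt_le_trans _ _ _ Hu (Rmin_r _ _)) (Rlt_le_trans _ _ _ Hv (Rmin_r _ _))).
  assert (A1 := Rlt_le_trans _ _ _ F1 (Rmin_l _ _)); assert (A2 := Rlt_le_trans _ _ _ F1 (Rmin_r _ _)).
  assert (A3 := Rlt_le_trans _ _ _ F2 (Rmin_r _ _)).
  replace (f u v * g u v - f x y * g x y)%C with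
    ((f u v - f x y) * (g u v - g x y) +
     ((f u v - f x y) * g x y + f x y * (g u v - g x y)))%C by ring.
  set (e := eps / (2 * K)) in *.
  assert (Ee : e * K = eps / 2) by (unfold e; field; unfold K; lra).
  eapply Rle_lt_trans.
  - apply Cmod_plus_le; [apply Cmod_mult_le; [left; exact A1 | left; exact A3]|].
    apply Cmod_plus_le; (apply Cmod_mult_le; [|]); [left; exact A2 | apply Rle_refl | apply Rle_refl | left; exact A3].
  - replace (1 * e + (e * Cmod (g x y) + Cmod (f x y) * e)) with (e * K) by (unfold K; ring); lra.
Qed.

Lemma Ccont2_const (c : C) (x y : R) : Ccont2 (fun _ _ => c) x y.
Proof.
  intros eps Heps; exists 1; split; [lra|]; intros u v _ _.
  replace (c - c)%C with (RtoC 0) by ring; now rewrite Cmod_0.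
Qed.

Lemma Ccont2_continuity_2d_Re (f : R -> R -> C) (x y : R) :
  Ccont2 f x y -> continuity_2d_pt (fun u v => Re (f u v)) x y.
Proof.
  intros Hf eps; destruct (Hf eps (cond_pos eps)) as (d & Hd & F).
  exists (mkposreal d Hd); intros u v Hu Hv.
  eapply Rle_lt_trans; [|exact (F u v Hu Hv)].
  replace (Re (f u v) - Re (f x y)) with (Re (f u v - f x y)) by reflexivity.
  apply re_le_Cmod.
Qed.

Lemma Ccont2_continuous_r (f : R -> R -> C) (x y : R) :
  Ccont2 f x y -> continuous (fun v => Re (f x v)) y.
Proof.
  intros Hf P [eps HP]; destruct (Hf eps (cond_pos eps)) as (d & Hd & F).
  exists (mkposreal d Hd); intros v Hv; apply HP.
  change (Rabs (Re (f x v) - Re (f x y)) < eps).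
  eapply Rle_lt_trans; [|apply (F x v); [rewrite Rminus_diag, Rabs_R0; exact Hd | exact Hv]].
  replace (Re (f x v) - Re (f x y)) with (Re (f x v - f x y)) by reflexivity.
  apply re_le_Cmod.
Qed.

(** Truncation makes all functions below total and continuous although the
    integrands are only meaningful for [theta] in [[0, PI]] and [rho >= 0]. *)
Definition clamp (t : R) : R := Rmax 0 (Rmin t PI).
Definition pos_part (t : R) : R := Rmax t 0.

Lemma clamp_range (t : R) : 0 <= clamp t <= PI.
Proof.
  assert (HP := PI_RGT_0); unfold clamp; split; [apply Rmax_l|].
  apply Rmax_lub; [lra | apply Rmin_r].
Qed.

Lemma clamp_id (t : R) : 0 <= t <= PI -> clamp t = t.
Proof. intros Ht; unfold clamp; rewrite Rmin_left, Rmax_right; lra. Qed.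

Lemma clamp_lipschitz (t u : R) : Rabs (clamp t - clamp u) <= Rabs (t - u).
Proof.
  unfold clamp, Rmax, Rmin.
  destruct (Rle_dec t PI), (Rle_dec u PI);
    repeat match goal with |- context [Rle_dec 0 ?x] => destruct (Rle_dec 0 x) end;
    unfold Rabs; repeat destruct Rcase_abs; lra.
Qed.

Lemma pos_part_lipschitz (t u : R) : Rabs (pos_part t - pos_part u) <= Rabs (t - u).
Proof.
  unfold pos_part, Rmax; destruct (Rle_dec t 0), (Rle_dec u 0);
    unfold Rabs; repeat destruct Rcase_abs; lra.
Qed.

Definition cis (t : R) : C := (cos t, sin t).

Lemma Cmod_cis (t : R) : Cmod (cis t) = 1.
Proof.
  unfold cis, Cmod; simpl; rewrite !Rmult_1_r.
  assert (H := sin2_cos2 t); unfold Rsqr in H; rewrite Rplus_comm, H; apply sqrt_1.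
Qed.

Lemma is_CDerive_cis (t : R) : is_CDerive cis t (Ci * cis t)%C.
Proof.
  split.
  - apply (is_derive_ext cos); [reflexivity|].
    auto_derive; auto; unfold Re; simpl; ring.
  - apply (is_derive_ext sin); [reflexivity|].
    auto_derive; auto; unfold Im; simpl; ring.
Qed.

Lemma cis_lipschitz (t u : R) : Cmod (cis t - cis u) <= Rabs (t - u).
Proof.
  assert (W : forall x y, x <= y -> Cmod (cis y - cis x) <= Rabs (y - x)).
  { intros x y Hxy; rewrite Rabs_pos_eq by lra.
    eapply Rle_trans; [apply (Cmod_increment_le_lin cis (fun s => Ci * cis s)%C 1 x y Hxy)|lra].
    - intros; apply is_CDerive_cis.
    - intros; rewrite Cmod_mult, Cmod_Ci, Cmod_cis; lra. }
  destruct (Rle_lt_dec u t) as [H|H]; [now apply W|].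
  rewrite Cmod_minus_sym, Rabs_minus_sym; apply W; lra.
Qed.

Definition closed_upper (k : C) : Prop := 0 <= Im k.

Definition polar (rho t : R) : C := (RtoC (pos_part rho) * cis (clamp t))%C.

Lemma cis_clamp_Im (t : R) : 0 <= Im (cis (clamp t)).
Proof. apply sin_ge_0; apply clamp_range. Qed.

Lemma polar_closed_upper (rho t : R) : closed_upper (polar rho t).
Proof.
  unfold closed_upper, polar.
  replace (Im (RtoC (pos_part rho) * cis (clamp t))) with (pos_part rho * Im (cis (clamp t)))
    by (unfold Im; simpl; ring).
  apply Rmult_le_pos; [apply Rmax_r | apply cis_clamp_Im].
Qed.

Lemma polar_pos (rho t : R) : 0 < rho -> polar rho t = (RtoC rho * cis (clamp t))%C.
Proof. intros H; unfold polar, pos_part; now rewrite Rmax_left by lra. Qed.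

Lemma Cmod_polar (rho t : R) : 0 <= rho -> Cmod (polar rho t) = rho.
Proof.
  intros H; unfold polar, pos_part; rewrite Rmax_left by lra.
  rewrite Cmod_mult, Cmod_cis, Cmod_R, Rabs_pos_eq; lra.
Qed.

Lemma polar_upper (rho t : R) : 0 < rho -> upper (polar rho t).
Proof.
  intros H; split; [|apply polar_closed_upper].
  apply Cmod_neq_0; rewrite Cmod_polar; lra.
Qed.

Lemma Ccont2_cis_clamp (x y : R) : Ccont2 (fun _ v => cis (clamp v)) x y.
Proof.
  intros eps Heps; exists eps; split; [exact Heps|]; intros u v _ Hv.
  eapply Rle_lt_trans; [apply cis_lipschitz|].
  eapply Rle_lt_trans; [apply clamp_lipschitz | exact Hv].
Qed.

Lemma Ccont2_polar (x y : R) : Ccont2 polar x y.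
Proof.
  apply (Ccont2_mult (fun u _ => RtoC (pos_part u)) (fun _ v => cis (clamp v)));
    [|apply Ccont2_cis_clamp].
  intros eps Heps; exists eps; split; [exact Heps|]; intros u v Hu _.
  rewrite <- RtoC_minus, Cmod_R; eapply Rle_lt_trans; [apply pos_part_lipschitz | exact Hu].
Qed.

Lemma Ccont_closed_upper (F : C -> C) (k : C) :
  k <> 0%C -> Ccont upper F k -> Ccont closed_upper F k.
Proof.
  intros Hk H eps Heps; destruct (H eps Heps) as (d & Hd & F1).
  assert (Pk : 0 < Cmod k) by now apply Cmod_gt_0.
  exists (Rmin d (Cmod k)); split; [now apply Rmin_pos|]; intros w Dw Hw.
  apply F1; [split; [|exact Dw]|eapply Rlt_le_trans; [exact Hw | apply Rmin_l]].
  intros ->; assert (X := Rlt_le_trans _ _ _ Hw (Rmin_r _ _)).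
  replace (0 - k)%C with (- k)%C in X by ring; rewrite Cmod_opp in X; lra.
Qed.

Section Cauchy.
Context (F dF : C -> C) (HF : forall k, upper k -> is_Cdiff upper F k (dF k)).
Context (HdF : forall k, upper k -> Ccont upper dF k).
Context (F0 : F 0%C = 0%C) (CF0 : Ccont closed_upper F 0%C).

Lemma Ccont_F (k : C) : closed_upper k -> Ccont closed_upper F k.
Proof.
  intros Hk; destruct (Ceq_dec k 0%C) as [->|N]; [exact CF0|].
  apply Ccont_closed_upper; [exact N|].
  eapply is_Cdiff_cont, HF; now split.
Qed.

Lemma Ccont2_F_polar (x y : R) : Ccont2 (fun u v => F (polar u v)) x y.
Proof.
  apply (Ccont2_comp closed_upper F polar x y 1 Rlt_0_1).
  - intros; apply polar_closed_upper.
  - apply Ccont_F, polar_closed_upper.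
  - apply Ccont2_polar.
Qed.

Lemma Ccont2_dF_polar (x y : R) : 0 < x -> Ccont2 (fun u v => dF (polar u v)) x y.
Proof.
  intros Hx; apply (Ccont2_comp upper dF polar x y x Hx).
  - intros u v Hu; apply polar_upper; apply Rabs_def2 in Hu; lra.
  - now apply HdF, polar_upper.
  - apply Ccont2_polar.
Qed.

Lemma is_CDerive_F_radial (rho t : R) :
  0 < rho -> is_CDerive (fun u => F (polar u t)) rho (dF (polar rho t) * cis (clamp t))%C.
Proof.
  intros Hr.
  assert (Loc : locally rho (fun u => 0 < u)).
  { exists (mkposreal rho Hr); intros u Hu; change (Rabs (u - rho) < rho) in Hu.
    apply Rabs_def2 in Hu; lra. }
  apply (is_CDerive_ext_loc (fun u => F (RtoC u * cis (clamp t))%C)).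
  { revert Loc; apply filter_imp; intros u Hu; now rewrite polar_pos. }
  rewrite polar_pos by exact Hr.
  apply (is_Cdiff_path upper F (fun u => RtoC u * cis (clamp t))%C rho).
  - rewrite <- polar_pos by exact Hr; now apply HF, polar_upper.
  - revert Loc; apply filter_imp; intros u Hu; rewrite <- polar_pos by exact Hu; now apply polar_upper.
  - eapply is_CDerive_eq.
    + apply is_CDerive_mult; [apply is_CDerive_id | apply is_CDerive_const].
    + cbv beta; ring.
Qed.

Lemma is_CDerive_F_angular (rho t : R) :
  0 < rho -> 0 < t < PI ->
  is_CDerive (fun v => F (polar rho v)) t (dF (polar rho t) * (RtoC rho * (Ci * cis (clamp t))))%C.
Proof.
  intros Hr Ht.
  assert (Loc : locally t (fun v => 0 <= v <= PI)).
  { assert (P : 0 < Rmin t (PI - t)) by (apply Rmin_pos; lra).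
    exists (mkposreal _ P); intros v Hv; change (Rabs (v - t) < Rmin t (PI - t)) in Hv.
    assert (X1 := Rlt_le_trans _ _ _ Hv (Rmin_l _ _)); assert (X2 := Rlt_le_trans _ _ _ Hv (Rmin_r _ _)).
    apply Rabs_def2 in X1; apply Rabs_def2 in X2; lra. }
  apply (is_Cdiff_path upper F (fun v => polar rho v) t).
  - now apply HF, polar_upper.
  - apply filter_forall; intros v; now apply polar_upper.
  - apply (is_CDerive_ext_loc (fun v => RtoC rho * cis v)%C).
    + revert Loc; apply filter_imp; intros v Hv; now rewrite polar_pos, clamp_id.
    + rewrite clamp_id by lra; apply is_CDerive_scal, is_CDerive_cis.
Qed.

(** As [dk / k = i dt] on a circle, this is the half-circle integral of [F (k) / k] up to the factor
    [i]. The constant [c] selects real or imaginary part, so that real integration is enough. *)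
Definition arc (c : C) (rho : R) : R := RInt (fun t => Re (c * F (polar rho t))) 0 PI.

Lemma Ccont2_scal_F (c : C) (x y : R) : Ccont2 (fun u v => c * F (polar u v))%C x y.
Proof.
  apply (Ccont2_mult (fun _ _ => c) (fun u v => F (polar u v)));
    [apply Ccont2_const | apply Ccont2_F_polar].
Qed.

Lemma ex_RInt_arc (c : C) (rho a b : R) : ex_RInt (fun t => Re (c * F (polar rho t))) a b.
Proof.
  apply (ex_RInt_continuous (fun t => Re (c * F (polar rho t)))); intros t _.
  apply (Ccont2_continuous_r (fun u v => c * F (polar u v))%C), Ccont2_scal_F.
Qed.

Lemma arc_0 (c : C) : arc c 0 = 0.
Proof.
  unfold arc; rewrite (RInt_ext _ (fun _ => 0)).
  - rewrite RInt_const; unfold scal; simpl; unfold mult; simpl; ring.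
  - intros t _; unfold polar, pos_part; rewrite Rmax_left by lra.
    rewrite Cmult_0_l, F0, Cmult_0_r; reflexivity.
Qed.

Lemma polar_0 (rho : R) : 0 < rho -> polar rho 0 = RtoC rho.
Proof.
  intros H; rewrite polar_pos, clamp_id by (assert (X := PI_RGT_0); lra).
  unfold cis; rewrite cos_0, sin_0; apply C_ext; unfold Re, Im; simpl; ring.
Qed.

Lemma polar_PI (rho : R) : 0 < rho -> polar rho PI = RtoC (- rho).
Proof.
  intros H; rewrite polar_pos, clamp_id by (assert (X := PI_RGT_0); lra).
  unfold cis; rewrite cos_PI, sin_PI; apply C_ext; unfold Re, Im; simpl; ring.
Qed.

(** On a circle the radial derivative is the angular one divided by [i rho]. *)
Lemma is_RInt_radial_derivative (c : C) (rho : R) :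
  0 < rho ->
  is_RInt (fun t => Re (c * (dF (polar rho t) * cis (clamp t)))) 0 PI
    (Re (c * (/ (Ci * RtoC rho)) * (F (RtoC (- rho)) - F (RtoC rho)))).
Proof.
  intros Hr; assert (HP := PI_RGT_0).
  assert (Nr : RtoC rho <> 0%C) by (apply RtoC_neq_0; lra).
  assert (Ni : Ci <> 0%C) by (intros E; assert (X := Cmod_Ci); rewrite E, Cmod_0 in X; lra).
  replace (Re (c * / (Ci * RtoC rho) * (F (RtoC (- rho)) - F (RtoC rho)))) with
    (Re (c * / (Ci * RtoC rho) * F (polar rho PI)) - Re (c * / (Ci * RtoC rho) * F (polar rho 0))).
  2:{ rewrite polar_0, polar_PI by exact Hr; unfold Re; simpl; ring. }
  apply (is_RInt_derive_interior (fun t => Re (c * / (Ci * RtoC rho) * F (polar rho t)))).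
  - lra.
  - intros t Ht.
    replace (Re (c * (dF (polar rho t) * cis (clamp t)))) with
      (Re (c * / (Ci * RtoC rho) * (dF (polar rho t) * (RtoC rho * (Ci * cis (clamp t)))))).
    + now apply is_derive_Re_scal, is_CDerive_F_angular.
    + f_equal; field; auto.
  - intros t _.
    apply (Ccont2_continuous_r (fun u v => c * / (Ci * RtoC rho) * F (polar u v))%C), Ccont2_scal_F.
  - intros t.
    apply (Ccont2_continuous_r (fun u v => c * (dF (polar u v) * cis (clamp v)))%C).
    apply (Ccont2_mult (fun _ _ => c)); [apply Ccont2_const|].
    apply (Ccont2_mult (fun u v => dF (polar u v)) (fun _ v => cis (clamp v)));
      [now apply Ccont2_dF_polar | apply Ccont2_cis_clamp].
Qed.

(** Cauchy's theorem in differential form: under the integral the radial derivative is an angular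
    one, hence integrates to boundary values at [rho] and [- rho]. *)
Lemma is_derive_arc (c : C) (rho : R) :
  0 < rho ->
  is_derive (arc c) rho (Re (c * (/ (Ci * RtoC rho)) * (F (RtoC (- rho)) - F (RtoC rho)))).
Proof.
  intros Hr.
  assert (Loc : locally rho (fun u => 0 < u)).
  { exists (mkposreal rho Hr); intros u Hu; change (Rabs (u - rho) < rho) in Hu.
    apply Rabs_def2 in Hu; lra. }
  assert (DR : forall u t, 0 < u -> is_derive (fun v => Re (c * F (polar v t))) u
    (Re (c * (dF (polar u t) * cis (clamp t))))).
  { intros u t Hu; now apply is_derive_Re_scal, is_CDerive_F_radial. }
  rewrite <- (is_RInt_unique _ _ _ _ (is_RInt_radial_derivative c rho Hr)).
  rewrite <- (RInt_ext (fun t => Derive (fun u => Re (c * F (polar u t))) rho)).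
  2:{ intros t _; apply is_derive_unique, DR, Hr. }
  apply (is_derive_RInt_param (fun u t => Re (c * F (polar u t)))).
  - revert Loc; apply filter_imp; intros u Hu t _; eexists; now apply DR.
  - intros t _.
    apply (continuity_2d_pt_ext_loc (fun u v => Re (c * (dF (polar u v) * cis (clamp v))))).
    + exists (mkposreal rho Hr); intros u v Hu _; symmetry; apply is_derive_unique, DR.
      simpl in Hu; apply Rabs_def2 in Hu; lra.
    + apply (Ccont2_continuity_2d_Re (fun u v => c * (dF (polar u v) * cis (clamp v)))%C).
      apply (Ccont2_mult (fun _ _ => c)); [apply Ccont2_const|].
      apply (Ccont2_mult (fun u v => dF (polar u v)) (fun _ v => cis (clamp v)));
        [now apply Ccont2_dF_polar | apply Ccont2_cis_clamp].
  - apply filter_forall; intros u; apply ex_RInt_arc.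
Qed.

(** Continuity down to radius [0], where the differentiability of [F] ends, lets the derivative be
    integrated from the origin; [F] is uniformly small on small half-circles. *)
Lemma arc_continuous (c : C) (rho : R) : 0 <= rho -> continuous (arc c) rho.
Proof.
  intros Hr; destruct (Req_dec rho 0) as [->|Hn].
  2:{ eapply is_derive_continuous, is_derive_arc; lra. }
  assert (HP := PI_RGT_0); assert (Pc := Cmod_ge_0 c).
  intros P [eps HeP].
  assert (Pe := cond_pos eps).
  set (e := eps / (2 * PI * (Cmod c + 1))).
  assert (Pe' : 0 < e).
  { apply Rdiv_lt_0_compat; [exact Pe|].
    apply Rmult_lt_0_compat; lra. }
  destruct (CF0 e Pe') as (d & Hd & Fd).
  exists (mkposreal d Hd); intros u Hu; apply HeP; change (Rabs (u - 0) < d) in Hu.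
  change (Rabs (arc c u - arc c 0) < eps); rewrite arc_0, Rminus_0_r.
  assert (B : forall t, Rabs (Re (c * F (polar u t))) <= Cmod c * e).
  { intros t; eapply Rle_trans; [apply re_le_Cmod|].
    apply Cmod_mult_le; [lra|].
    assert (D := Fd (polar u t) (polar_closed_upper u t)).
    rewrite F0 in D; replace (F (polar u t)) with (F (polar u t) - 0)%C by ring.
    left; apply D.
    replace (polar u t - 0)%C with (polar u t) by ring.
    unfold polar; rewrite Cmod_mult, Cmod_cis, Cmod_R, Rmult_1_r.
    assert (L := pos_part_lipschitz u 0).
    replace (pos_part 0) with 0 in L by (unfold pos_part; rewrite Rmax_left; lra).
    rewrite Rminus_0_r in L; lra. }
  eapply Rle_lt_trans.
  - apply abs_RInt_le_const with (M := Cmod c * e); [lra | apply ex_RInt_arc | intros; apply B].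
  - rewrite Rminus_0_r.
    apply Rle_lt_trans with (PI * ((Cmod c + 1) * e)).
    + apply Rmult_le_compat_l; [lra|]; nra.
    + replace (PI * ((Cmod c + 1) * e)) with (eps / 2) by (unfold e; field; lra); lra.
Qed.

(** * The half-circle integral at infinity and the real-line integral *)

Context (L : C) (K K0 : R) (HK : 0 <= K) (HK0 : 0 < K0).
Context (Hbd : forall k, upper k -> K0 <= Cmod k -> Cmod (F k - L) <= K).
Context (Hdec : forall k, upper k -> K0 <= Im k -> Cmod (F k - L) <= K / Im k).

Lemma sin_lower (e t : R) : 0 < e < PI / 2 -> e <= t <= PI - e -> sin e <= sin t.
Proof.
  intros He Ht; destruct (Rle_lt_dec t (PI / 2)) as [H|H].
  - apply sin_incr_1; lra.
  - rewrite <- (sin_PI_x t); apply sin_incr_1; lra.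
Qed.

(** Within angle [e] of the real axis only boundedness is used, on a set of small measure. In
    between [Im k >= rho sin e], so the decay hypothesis gives a uniform bound of order
    [1 / rho]. *)
Lemma arc_limit (c : C) (eps : R) :
  0 < eps -> exists M, forall rho, M <= rho -> Rabs (arc c rho - PI * Re (c * L)) <= eps.
Proof.
  intros Heps; assert (HP := PI_RGT_0); assert (Pc := Cmod_ge_0 c).
  set (A := (Cmod c + 1) * (K + 1)).
  assert (PA : 0 < A) by (apply Rmult_lt_0_compat; lra).
  (* Each of the two end pieces contributes at most [e A <= eps / 4], which leaves [eps / 2] for the
     middle. *)
  set (e := Rmin (PI / 4) (eps / (4 * A))).
  assert (Pe : 0 < e) by (apply Rmin_pos; [lra | apply Rdiv_lt_0_compat; lra]).
  assert (e1 : e <= PI / 4) by apply Rmin_l.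
  assert (e2 : e <= eps / (4 * A)) by apply Rmin_r.
  assert (Ps : 0 < sin e) by (apply sin_gt_0; lra).
  (* The terms guarantee the boundedness hypothesis on the whole arc, [Im k >= K0 + 1] on the middle
     piece, and a middle contribution of at most [eps / 2]. *)
  set (M := K0 + (K0 + 1) / sin e + 2 * PI * A / (eps * sin e)).
  assert (PM1 : 0 < (K0 + 1) / sin e) by (apply Rdiv_lt_0_compat; lra).
  assert (PM2 : 0 < 2 * PI * A / (eps * sin e)).
  { apply Rdiv_lt_0_compat; apply Rmult_lt_0_compat; lra. }
  exists M; intros rho Hrho.
  assert (Hr : 0 < rho) by (unfold M in Hrho; lra).
  set (h := fun t => Re (c * F (polar rho t)) - Re (c * L)).
  assert (Ex : forall a b, ex_RInt h a b).
  { intros a b; apply (ex_RInt_minus (fun t => Re (c * F (polar rho t))) (fun _ => Re (c * L)));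
      [apply ex_RInt_arc | apply ex_RInt_const]. }
  assert (E : arc c rho - PI * Re (c * L) = RInt h 0 PI).
  { unfold h; rewrite (RInt_minus (fun t => Re (c * F (polar rho t))) (fun _ => Re (c * L)));
      [|apply ex_RInt_arc | apply ex_RInt_const].
    rewrite RInt_const.
    change (arc c rho - PI * Re (c * L) = arc c rho + - ((PI - 0) * Re (c * L))); ring. }
  rewrite E.
  assert (E2 : RInt h 0 PI = RInt h 0 e + (RInt h e (PI - e) + RInt h (PI - e) PI)).
  { rewrite <- (RInt_Chasles h 0 e PI) by auto.
    rewrite <- (RInt_Chasles h e (PI - e) PI) by auto; reflexivity. }
  rewrite E2.
  assert (B0 : forall t, Rabs (h t) <= Cmod c * Cmod (F (polar rho t) - L)).
  { intros t; unfold h.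
    replace (Re (c * F (polar rho t)) - Re (c * L)) with (Re (c * (F (polar rho t) - L)))
      by (unfold Re; simpl; ring).
    eapply Rle_trans; [apply re_le_Cmod | rewrite Cmod_mult; lra]. }
  assert (B1 : forall t, Rabs (h t) <= A).
  { intros t; eapply Rle_trans; [apply B0|].
    unfold A; apply Rmult_le_compat; try apply Cmod_ge_0; [lra|].
    eapply Rle_trans; [apply Hbd; [now apply polar_upper | rewrite Cmod_polar; unfold M in Hrho; lra]|lra]. }
  assert (B2 : forall t, e <= t <= PI - e -> Rabs (h t) <= A / (rho * sin e)).
  { intros t Ht; eapply Rle_trans; [apply B0|].
    assert (Im1 : rho * sin e <= Im (polar rho t)).
    { rewrite polar_pos, clamp_id by lra.
      replace (Im (RtoC rho * cis t)) with (rho * sin t) by (unfold Im; simpl; ring).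
      apply Rmult_le_compat_l; [lra | apply sin_lower; lra]. }
    assert (Big : K0 + 1 <= rho * sin e).
    { apply Rle_trans with ((K0 + 1) / sin e * sin e); [apply Req_le; field; lra|].
      apply Rmult_le_compat_r; unfold M in Hrho; lra. }
    unfold A, Rdiv; rewrite Rmult_assoc; apply Rmult_le_compat; try apply Cmod_ge_0; [lra|].
    eapply Rle_trans; [apply Hdec; [now apply polar_upper | lra]|].
    unfold Rdiv; apply Rmult_le_compat; try lra; [left; apply Rinv_0_lt_compat; lra|].
    apply Rinv_le_contravar; lra. }
  assert (X1 := abs_RInt_le_const h 0 e A ltac:(lra) (Ex _ _) (fun t _ => B1 t)).
  assert (X2 := abs_RInt_le_const h e (PI - e) _ ltac:(lra) (Ex _ _) B2).
  assert (X3 := abs_RInt_le_const h (PI - e) PI A ltac:(lra) (Ex _ _) (fun t _ => B1 t)).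
  assert (Y1 : e * A <= eps / 4).
  { apply Rle_trans with (eps / (4 * A) * A); [apply Rmult_le_compat_r; lra|].
    apply Req_le; field; lra. }
  assert (Y2 : (PI - e - e) * (A / (rho * sin e)) <= eps / 2).
  { apply Rle_trans with (PI * (A / (rho * sin e))).
    - apply Rmult_le_compat_r; [|lra].
      left; apply Rdiv_lt_0_compat; [lra | now apply Rmult_lt_0_compat].
    - replace (PI * (A / (rho * sin e))) with (PI * A / (rho * sin e))
        by (field; split; lra).
      apply Rle_div_l; [now apply Rmult_lt_0_compat|].
      apply Rle_trans with (eps / 2 * (2 * PI * A / (eps * sin e) * sin e)).
      + apply Req_le; field; lra.
      + apply Rmult_le_compat_l; [lra|]; apply Rmult_le_compat_r; unfold M in Hrho; lra. }
  eapply Rle_trans; [apply Rabs_triang|].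
  eapply Rle_trans; [apply Rplus_le_compat_l, Rabs_triang|].
  lra.
Qed.

Context (l0 : C) (Hl0 : forall eps, 0 < eps -> exists delta, 0 < delta /\
  forall rho : R, rho <> 0 -> Rabs rho < delta -> Cmod (F (RtoC rho) / RtoC rho - l0) < eps).

(** The integrand, extended continuously to the origin. *)
Definition quotient (rho : R) : C :=
  if Req_dec_T rho 0 then l0 else (F (RtoC rho) / RtoC rho)%C.

Lemma RtoC_upper (rho : R) : rho <> 0 -> upper (RtoC rho).
Proof. intros H; split; [now apply RtoC_neq_0 | simpl; lra]. Qed.

Lemma quotient_nonzero (rho : R) : rho <> 0 -> quotient rho = (F (RtoC rho) / RtoC rho)%C.
Proof. intros H; unfold quotient; destruct (Req_dec_T rho 0); congruence. Qed.

Lemma continuous_quotient (c : C) (rho : R) : continuous (fun u => Re (c * quotient u)) rho.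
Proof.
  destruct (Req_dec rho 0) as [->|Hn].
  - intros P [eps HeP]; assert (Pe := cond_pos eps); assert (Pc := Cmod_ge_0 c).
    destruct (Hl0 (eps / (Cmod c + 1))) as (d & Hd & Fd); [apply Rdiv_lt_0_compat; lra|].
    exists (mkposreal d Hd); intros u Hu; apply HeP.
    change (Rabs (u - 0) < d) in Hu; rewrite Rminus_0_r in Hu.
    change (Rabs (Re (c * quotient u) - Re (c * quotient 0)) < eps).
    replace (Re (c * quotient u) - Re (c * quotient 0)) with (Re (c * (quotient u - quotient 0)))
      by (unfold Re; simpl; ring).
    eapply Rle_lt_trans; [apply re_le_Cmod|]; rewrite Cmod_mult.
    unfold quotient at 2; destruct (Req_dec_T 0 0) as [_|]; [|congruence].
    unfold quotient; destruct (Req_dec_T u 0) as [Eu|Nu].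
    + replace (l0 - l0)%C with (RtoC 0) by ring; rewrite Cmod_0; lra.
    + specialize (Fd u Nu Hu).
      assert (X := Cmod_ge_0 (F (RtoC u) / RtoC u - l0)).
      apply Rle_lt_trans with ((Cmod c + 1) * Cmod (F (RtoC u) / RtoC u - l0)); [nra|].
      apply Rlt_le_trans with ((Cmod c + 1) * (eps / (Cmod c + 1))).
      * apply Rmult_lt_compat_l; lra.
      * apply Req_le; field; lra.
  - assert (Pn : 0 < Rabs rho) by now apply Rabs_pos_lt.
    assert (Loc : locally rho (fun u => u <> 0)).
    { exists (mkposreal _ Pn); intros u Hu ->; change (Rabs (0 - rho) < Rabs rho) in Hu.
      rewrite Rminus_0_l, Rabs_Ropp in Hu; lra. }
    assert (D : is_CDerive (fun u => F (RtoC u)) rho (dF (RtoC rho) * 1)%C).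
    { apply (is_Cdiff_path upper F RtoC rho).
      - now apply HF, RtoC_upper.
      - revert Loc; apply filter_imp; intros u Hu; now apply RtoC_upper.
      - apply is_CDerive_id. }
    assert (D' := is_CDerive_div _ RtoC rho _ _ (RtoC_neq_0 rho Hn) D (is_CDerive_id rho)).
    assert (D2 : is_CDerive quotient rho
      ((dF (RtoC rho) * 1 * RtoC rho - F (RtoC rho) * 1) / (RtoC rho * RtoC rho))%C).
    { eapply is_CDerive_ext_loc; [|exact D'].
      revert Loc; apply filter_imp; intros u Hu; symmetry; now apply quotient_nonzero. }
    eapply is_derive_continuous, is_derive_Re_scal, D2.
Qed.

(** With [i c] as constant, the derivative of [arc] at [u] is minus the sum of the integrand at [u]
    and [- u]. Integration over [[0, W]] and folding the negative half-line give the claim, as [arc]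
    vanishes at radius [0]. *)
Lemma RInt_quotient (c : C) (W : R) :
  0 < W -> RInt (fun u => Re (c * quotient u)) (- W) W = - arc (Ci * c) W.
Proof.
  intros HW; set (g := fun u => Re (c * quotient u)).
  assert (Cg : forall x, continuous g x) by (intros; apply continuous_quotient).
  assert (Cg' : forall x, continuous (fun y => g (- y)) x).
  { intros x; apply (continuous_comp (fun y => - y) g); [|apply Cg].
    apply (is_derive_continuous (fun y => - y) x (- 1)); auto_derive; auto; ring. }
  assert (Ex : forall a b, ex_RInt g a b) by (intros; apply (ex_RInt_continuous g); auto).
  assert (Ex' : forall a b, ex_RInt (fun y => g (- y)) a b)
    by (intros; apply (ex_RInt_continuous (fun y => g (- y))); auto).
  assert (A : is_RInt (fun u => - (g u + g (- u))) 0 W (arc (Ci * c) W - arc (Ci * c) 0)).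
  { apply is_RInt_derive_interior; [lra| | |].
    - intros u Hu.
      replace (- (g u + g (- u))) with
        (Re (Ci * c * (/ (Ci * RtoC u)) * (F (RtoC (- u)) - F (RtoC u)))).
      + apply is_derive_arc; lra.
      + unfold g; rewrite !quotient_nonzero by lra.
        assert (Nu : RtoC u <> 0%C) by (apply RtoC_neq_0; lra).
        assert (Ni : Ci <> 0%C) by (intros E; assert (X := Cmod_Ci); rewrite E, Cmod_0 in X; lra).
        replace (Ci * c * / (Ci * RtoC u) * (F (RtoC (- u)) - F (RtoC u)))%C with
          (- (c * (F (RtoC u) / RtoC u) + c * (F (RtoC (- u)) / RtoC (- u))))%C
          by (rewrite RtoC_opp; field; auto).
        reflexivity.
    - intros u Hu; apply arc_continuous; lra.
    - intros u; apply (continuous_opp (V := R_NormedModule) (fun u => g u + g (- u))).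
      apply (continuous_plus (V := R_NormedModule) g (fun u => g (- u))); auto. }
  rewrite arc_0, Rminus_0_r in A.
  apply (is_RInt_unique (V := R_CompleteNormedModule)) in A.
  assert (Exs : ex_RInt (fun u => g u + g (- u)) 0 W)
    by exact (ex_RInt_plus g (fun u => g (- u)) 0 W (Ex 0 W) (Ex' 0 W)).
  assert (A1 : RInt (fun u => - (g u + g (- u))) 0 W = - RInt (fun u => g u + g (- u)) 0 W)
    by exact (RInt_opp (V := R_CompleteNormedModule) (fun u => g u + g (- u)) 0 W Exs).
  assert (A2 : RInt (fun u => g u + g (- u)) 0 W = RInt g 0 W + RInt (fun u => g (- u)) 0 W)
    by exact (RInt_plus (V := R_CompleteNormedModule) g (fun u => g (- u)) 0 W (Ex 0 W) (Ex' 0 W)).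
  assert (S : RInt g (- W) 0 = RInt (fun u => g (- u)) 0 W).
  { assert (H : is_RInt (fun y => - g (- y)) W 0 (RInt g (- W) 0)).
    { apply (is_RInt_comp_opp g W 0); rewrite Ropp_0; apply (RInt_correct g), Ex. }
    assert (H' := is_RInt_unique (V := R_CompleteNormedModule) _ _ _ _
      (is_RInt_opp _ _ _ _ (is_RInt_swap _ _ _ _ H))).
    transitivity (- - RInt g (- W) 0); [symmetry; apply Ropp_involutive|].
    rewrite (RInt_ext (V := R_CompleteNormedModule) (fun u => g (- u)) (fun u => - - g (- u)))
      by (intros; symmetry; apply Ropp_involutive).
    symmetry; exact H'. }
  assert (A3 : RInt g (- W) W = RInt g (- W) 0 + RInt g 0 W)
    by exact (eq_sym (RInt_Chasles (V := R_CompleteNormedModule) g (- W) 0 W (Ex _ _) (Ex _ _))).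
  lra.
Qed.

(** The integrand of the trace formula has a meaningless default value at [k = 0]; a single point
    does not affect the integral, which is split there. *)
Lemma is_RInt_punctured (g h : R -> R) (W : R) :
  0 < W -> (forall x, continuous g x) -> (forall x, x <> 0 -> h x = g x) ->
  is_RInt h (- W) W (RInt g (- W) W).
Proof.
  intros HW Cg E.
  assert (Ex : forall a b, ex_RInt g a b) by (intros; apply (ex_RInt_continuous g); auto).
  rewrite <- (RInt_Chasles g (- W) 0 W) by auto.
  apply (is_RInt_Chasles h (- W) 0 W).
  - apply (is_RInt_ext g); [|apply (RInt_correct g), Ex].
    intros x Hx; rewrite Rmin_left, Rmax_right in Hx by lra; symmetry; apply E; lra.
  - apply (is_RInt_ext g); [|apply (RInt_correct g), Ex].
    intros x Hx; rewrite Rmin_left, Rmax_right in Hx by lra; symmetry; apply E; lra.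
Qed.

(** The components are obtained with [c = 1] and [c = - i], since [Re (- i z) = Im z]; the limit of
    the arcs then supplies [PI L] times the constant. *)
Theorem half_plane_integral (f : R -> C) :
  (forall rho, rho <> 0 -> f rho = (F (RtoC rho) / RtoC rho)%C) ->
  is_RInt_symmetric f (- (Ci * RtoC PI * L))%C.
Proof.
  intros Hf.
  assert (Eq : forall rho, rho <> 0 -> f rho = quotient rho)
    by (intros rho Hr; rewrite quotient_nonzero by exact Hr; auto).
  exists (fun W => (- arc (Ci * 1) W, - arc (Ci * - Ci) W)); split.
  - intros W HW; apply is_RInt_fct_extend_pair.
    + rewrite <- RInt_quotient by exact HW.
      apply is_RInt_punctured; [exact HW | apply continuous_quotient|].
      intros x Hx; rewrite <- Eq by exact Hx; unfold Re; simpl; ring.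
    + rewrite <- RInt_quotient by exact HW.
      apply is_RInt_punctured; [exact HW | apply continuous_quotient|].
      intros x Hx; rewrite <- Eq by exact Hx; unfold Re; simpl; ring.
  - apply filterlim_locally; intros eps; assert (Pe := cond_pos eps).
    destruct (arc_limit (Ci * 1) (eps / 2)) as (M1 & B1); [lra|].
    destruct (arc_limit (Ci * - Ci) (eps / 2)) as (M2 & B2); [lra|].
    exists (Rmax M1 M2); intros W HW.
    assert (W1 : M1 <= W) by (assert (X := Rmax_l M1 M2); lra).
    assert (W2 : M2 <= W) by (assert (X := Rmax_r M1 M2); lra).
    specialize (B1 W W1); specialize (B2 W W2).
    split.
    + change (Rabs (- arc (Ci * 1) W - Re (- (Ci * RtoC PI * L))%C) < eps).
      rewrite <- Rabs_Ropp.
      replace (- (- arc (Ci * 1) W - Re (- (Ci * RtoC PI * L))%C)) with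
        (arc (Ci * 1) W - PI * Re (Ci * 1 * L)) by (unfold Re; simpl; ring).
      lra.
    + change (Rabs (- arc (Ci * - Ci) W - Im (- (Ci * RtoC PI * L))%C) < eps).
      rewrite <- Rabs_Ropp.
      replace (- (- arc (Ci * - Ci) W - Im (- (Ci * RtoC PI * L))%C)) with
        (arc (Ci * - Ci) W - PI * Re (Ci * - Ci * L)) by (unfold Re, Im; simpl; ring).
      lra.
Qed.

End Cauchy.

(** * The trace formula *)

Section BesselEquation.
Context (n : nat) (H1 H2 : C -> C) (HD : Cdiff2 (HankelH n) H1 H2).
Context (q : R -> R) (b : R) (hb : 0 < b) (q_right : forall r, b < r -> q r = 0).
Context (psi psi1 : C -> R -> C).
Context (Hpsi : forall k r, upper k -> 0 < r -> is_CDerive (psi k) r (psi1 k r)).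
Context (Hpsi1 : forall k r, upper k -> 0 < r ->
  is_CDerive (psi1 k) r
    ((RtoC ((INR n ^ 2 - 1 / 4) / r ^ 2) - k ^ 2 * RtoC (1 + q r)) * psi k r)%C).
Context (Hfree : forall k r, upper k -> b <= r -> psi k r = free_psi n k r).

(** Beyond the support every outgoing solution is the free wave, so Bessel's
    equation can be read off from the radial equation at [r = b + 1]. *)
Lemma bessel_equation (z : C) :
  z <> 0%C -> 0 <= Im z ->
  (H2 z + H1 z / z + (1 - RtoC (INR n ^ 2) / z ^ 2) * HankelH n z = 0)%C.
Proof.
  intros Z1 Z2; set (r := b + 1); assert (Hr : 0 < r) by (unfold r; lra).
  assert (Nr : RtoC r <> 0%C) by (apply RtoC_neq_0; lra).
  set (k := (z * RtoC (/ r))%C).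
  assert (Hk : upper k) by (apply upper_scal; [now split | now apply Rinv_0_lt_compat]).
  assert (Ez : (k * RtoC r)%C = z).
  { unfold k; rewrite <- Cmult_assoc, <- RtoC_mult, Rinv_l by lra; ring. }
  assert (Loc : locally r (fun s => b < s)).
  { exists (mkposreal 1 Rlt_0_1); intros s Hs; change (Rabs (s - r) < 1) in Hs.
    apply Rabs_def2 in Hs; unfold r in Hs; lra. }
  assert (E1 : forall s, b < s -> psi1 k s = free_psi1 n H1 k s).
  { intros s Hs.
    rewrite <- (is_CDerive_unique (psi k) s (psi1 k s)) by (apply Hpsi; [exact Hk | lra]).
    apply is_CDerive_unique, (is_CDerive_ext_loc (free_psi n k)).
    - assert (P : 0 < s - b) by lra.
      exists (mkposreal _ P); intros u Hu; symmetry; apply Hfree; [exact Hk|].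
      change (Rabs (u - s) < s - b) in Hu; apply Rabs_def2 in Hu; lra.
    - apply (is_CDerive_free_psi n H1 H2 HD); [exact Hk | lra]. }
  assert (D1 := is_CDerive_free_psi1 n H1 H2 HD k r Hk Hr).
  assert (D2 : is_CDerive (free_psi1 n H1 k) r
    ((RtoC ((INR n ^ 2 - 1 / 4) / r ^ 2) - k ^ 2 * RtoC (1 + q r)) * psi k r)%C).
  { apply (is_CDerive_ext_loc (psi1 k)); [|now apply Hpsi1].
    revert Loc; apply filter_imp; exact E1. }
  assert (E : free_psi2 n H1 H2 k r =
    ((RtoC ((INR n ^ 2 - 1 / 4) / r ^ 2) - k ^ 2 * RtoC (1 + q r)) * psi k r)%C).
  { rewrite <- (is_CDerive_unique _ _ _ D1); exact (is_CDerive_unique _ _ _ D2). }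
  rewrite q_right, Rplus_0_r, Hfree in E by (auto; unfold r; lra).
  unfold free_psi2, free_psi in E; rewrite Ez in E.
  assert (Hs : 0 < sqrt r) by now apply sqrt_lt_R0.
  assert (Ns : RtoC (sqrt r) <> 0%C) by (apply RtoC_neq_0; lra).
  assert (Ev : RtoC ((INR n ^ 2 - 1 / 4) / r ^ 2) = ((RtoC (INR n ^ 2) - / 4) / RtoC r ^ 2)%C).
  { rewrite RtoC_div by (apply pow_nonzero; lra).
    rewrite (RtoC_pow r), RtoC_minus, RtoC_div by lra; unfold Cdiv; ring. }
  rewrite Ev in E.
  assert (Nk : k <> 0%C) by apply Hk.
  set (h := HankelH n z) in *; set (h1 := H1 z) in *; set (h2 := H2 z) in *.
  replace (h2 + h1 / z + (1 - RtoC (INR n ^ 2) / z ^ 2) * h)%C with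
    ((RtoC (sqrt r) * (k ^ 2 * h2 + k * h1 / RtoC r - h / (4 * RtoC r ^ 2)) -
      ((RtoC (INR n ^ 2) - / 4) / RtoC r ^ 2 - k ^ 2 * 1) * (RtoC (sqrt r) * h))
      / (RtoC (sqrt r) * k ^ 2))%C.
  - rewrite E; unfold Cdiv; ring.
  - rewrite <- Ez; field; auto.
Qed.

End BesselEquation.

(** The support condition speaks only of points beyond [b]. The values at [b] of [q] and of its
    derivative, needed for matching the WKB ansatz, follow by continuity. *)
Lemma zero_at_right_end (g : R -> R) (b : R) :
  continuous g b -> (forall x, b < x -> g x = 0) -> g b = 0.
Proof.
  intros Hc Hz; destruct (Req_dec (g b) 0) as [E|N]; [exact E|exfalso].
  assert (P : 0 < Rabs (g b)) by now apply Rabs_pos_lt.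
  destruct (proj1 (filterlim_locally g (g b)) Hc (mkposreal _ P)) as [d Hd].
  assert (Pd := cond_pos d).
  specialize (Hd (b + d / 2)).
  assert (B : ball b d (b + d / 2)).
  { change (Rabs (b + d / 2 - b) < d); rewrite Rabs_pos_eq; lra. }
  specialize (Hd B); change (Rabs (g (b + d / 2) - g b) < Rabs (g b)) in Hd.
  rewrite Hz, Rminus_0_l, Rabs_Ropp in Hd by lra; lra.
Qed.

Lemma Ci_sqr : (Ci * Ci)%C = (- (1))%C.
Proof. apply C_ext; unfold Re, Im; simpl; ring. Qed.

Theorem theorem4p1
  (a b : R) (hab : 0 < a < b) (n : nat)
  (q : R -> R) (hqC2 : is_C2 q)
  (hqsupp : forall r : R, r < a \/ b < r -> q r = 0)
  (q0 q1 : R) (hq0 : -1 < q0)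
  (hqbounds : forall r : R, a <= r <= b -> q0 <= q r <= q1)
  (psi : R -> C -> C)
  (hpsi : forall k : C, k <> RtoC 0 -> 0 <= Im k ->
            is_psi n q b k (fun r => psi r k)) :
  forall r : R, a <= r <= b ->
  exists I : C,
    is_RInt_symmetric
      (fun k : R =>
         (impedance (RtoC k) (fun t => psi t (RtoC k)) r
          - CDerive (fun t => RtoC (sqrt t) * HankelH n (RtoC k * RtoC t)) r
            / (Ci * RtoC k * (RtoC (sqrt r) * HankelH n (RtoC k * RtoC r)))
          + 1 - RtoC (sqrt (1 + q r)))%C) I /\
    RtoC (Derive q r / (1 + q r)) = (RtoC (4 / PI) * I)%C.
Proof.
  intros r Hr.
  destruct (ex_Cdiff2_HankelH n) as (H1 & H2 & HD).
  set (ps := fun (k : C) (s : R) => psi s k).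
  set (ps1 := fun (k : C) (s : R) => CDerive (fun t => psi t k) s).
  assert (Hps : forall k s, upper k -> 0 < s -> is_CDerive (ps k) s (ps1 k s)).
  { intros k s [K1 K2] Hs; destruct (hpsi k K1 K2) as [O _].
    now apply ex_CDerive_is_CDerive, O. }
  assert (Hps1 : forall k s, upper k -> 0 < s -> is_CDerive (ps1 k) s
    ((RtoC ((INR n ^ 2 - 1 / 4) / s ^ 2) - k ^ 2 * RtoC (1 + q s)) * ps k s)%C).
  { intros k s [K1 K2] Hs; destruct (hpsi k K1 K2) as [O _]; destruct (O s Hs) as (_ & O2 & O3).
    eapply is_CDerive_eq; [apply ex_CDerive_is_CDerive, O2|].
    cbv beta in O3; fold (ps k s) in O3; fold (ps1 k) in O3 |- *.
    set (x := CDerive (ps1 k) s) in *.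
    assert (O3' : (x + k ^ 2 * RtoC (1 + q s) * ps k s
      - RtoC ((INR n ^ 2 - 1 / 4) / s ^ 2) * ps k s = 0)%C) by exact O3.
    replace x with ((x + k ^ 2 * RtoC (1 + q s) * ps k s
      - RtoC ((INR n ^ 2 - 1 / 4) / s ^ 2) * ps k s)
      + (RtoC ((INR n ^ 2 - 1 / 4) / s ^ 2) - k ^ 2 * RtoC (1 + q s)) * ps k s)%C by ring.
    rewrite O3'; ring. }
  assert (Hfree : forall k s, upper k -> b <= s -> ps k s = free_psi n k s).
  { intros k s [K1 K2] Hs; destruct (hpsi k K1 K2) as [_ O]; now apply O. }
  assert (hb : 0 < b) by lra; assert (Hrb : 0 < r <= b) by lra.
  assert (bessel := bessel_equation n H1 H2 HD q b hb (fun s Hs => hqsupp s (or_intror Hs))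
    ps ps1 Hps Hps1 Hfree).
  assert (Hq : forall t, is_derive q t (Derive q t)).
  { intros t; apply Derive_correct; exact (proj1 (hqC2 1%nat ltac:(lia) t)). }
  assert (Hq1 : forall t, is_derive (Derive q) t (Derive_n q 2 t)).
  { intros t; exact (Derive_correct _ _ (proj1 (hqC2 2%nat ltac:(lia) t))). }
  assert (Hq2 : forall t, continuous (Derive_n q 2) t)
    by (intros t; exact (proj2 (hqC2 2%nat ltac:(lia) t))).
  assert (Hqc : forall t, continuous q t) by (intros t; eapply is_derive_continuous, Hq).
  (* The bound by [q0] holds on [[a, b]] only; outside, [1 + q = 1]. *)
  set (c0 := Rmin 1 (1 + q0)).
  assert (hc0 : 0 < c0) by (apply Rmin_pos; lra).
  assert (q_low : forall t, c0 <= 1 + q t).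
  { intros t; destruct (Rle_lt_dec a t) as [Ha|Ha]; [destruct (Rle_lt_dec t b) as [Hb|Hb]|].
    - eapply Rle_trans; [apply Rmin_r|]; assert (X := hqbounds t (conj Ha Hb)); lra.
    - rewrite hqsupp by lra; eapply Rle_trans; [apply Rmin_l | lra].
    - rewrite hqsupp by lra; eapply Rle_trans; [apply Rmin_l | lra]. }
  assert (q_pos : forall t, 0 < 1 + q t) by (intros t; specialize (q_low t); lra).
  assert (qb : q b = 0) by (apply zero_at_right_end; auto).
  assert (q1b : Derive q b = 0).
  { apply zero_at_right_end; [eapply is_derive_continuous, Hq1|].
    intros x Hx; rewrite (Derive_ext_loc q (fun _ => 0)); [apply Derive_const|].
    assert (P : 0 < x - b) by lra.
    exists (mkposreal _ P); intros u Hu; apply hqsupp; right.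
    change (Rabs (u - x) < x - b) in Hu; apply Rabs_def2 in Hu; lra. }
  set (fr := free_psi n); set (fr1 := free_psi1 n H1).
  assert (Hfr : forall k s, upper k -> 0 < s -> is_CDerive (fr k) s (fr1 k s))
    by (intros k s Hk Hs; now apply (is_CDerive_free_psi n H1 H2 HD)).
  assert (Hfr1 : forall k s, upper k -> 0 < s -> is_CDerive (fr1 k) s
    ((RtoC ((INR n ^ 2 - 1 / 4) / s ^ 2) - k ^ 2 * RtoC (1 + 0)) * fr k s)%C)
    by (intros k s Hk Hs; now apply (is_CDerive_free_psi1_ode n H1 H2 HD bessel)).
  assert (zero_pos : forall t : R, 0 < 1 + (fun _ : R => 0) t) by (intros; lra).
  assert (zero_cont : forall t : R, continuous (fun _ : R => 0) t)
    by (intros; apply continuous_const).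
  set (p := sqrt (1 + q r)).
  set (G := fun k => (- Ci * (ps1 k r / ps k r - fr1 k r / fr k r) + k * (1 - RtoC p))%C).
  (* At [k = 0] the quotients in [G] carry no information, so the limit value [0] furnished by the
     low-frequency estimate is imposed. *)
  set (F := fun k : C => if Ceq_dec k 0%C then RtoC 0 else G k).
  set (dF := fun k => (- Ci * (dlog H1 H2 q b ps ps1 r k - dlog H1 H2 (fun _ => 0) b fr fr1 r k)
    + 1 * (1 - RtoC p))%C).
  assert (FG : forall k, upper k -> F k = G k).
  { intros k [Hk _]; unfold F; destruct (Ceq_dec k 0%C) as [E|_]; [contradiction (Hk E) | reflexivity]. }
  assert (HF : forall k, upper k -> is_Cdiff upper F k (dF k)).
  { intros k Hk; apply (is_Cdiff_ext upper G); [exact Hk | intros; symmetry; now apply FG|].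
    apply (is_Cdiff_plus upper (fun k => - Ci * (ps1 k r / ps k r - fr1 k r / fr k r))%C
      (fun k => k * (1 - RtoC p))%C).
    - apply (is_Cdiff_scal upper (- Ci) (fun k => ps1 k r / ps k r - fr1 k r / fr k r)%C).
      apply (is_Cdiff_minus upper (fun k => ps1 k r / ps k r)%C (fun k => fr1 k r / fr k r)%C).
      + now apply (is_Cdiff_log_derivative n H1 H2 HD bessel).
      + apply (is_Cdiff_log_derivative n H1 H2 HD bessel (fun _ => 0)); auto.
    - eapply is_Cdiff_eq.
      + apply (is_Cdiff_mult upper (fun k => k) (fun _ => 1 - RtoC p)%C);
          [apply is_Cdiff_id | apply is_Cdiff_const].
      + cbv beta; ring. }
  assert (HdF : forall k, upper k -> Ccont upper dF k).
  { intros k Hk; apply Ccont_plus; [|apply Ccont_const].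
    apply (Ccont_mult upper (fun _ => - Ci)%C); [apply Ccont_const|].
    apply Ccont_minus.
    - now apply (Ccont_dlog n H1 H2 HD bessel).
    - apply (Ccont_dlog n H1 H2 HD bessel (fun _ => 0)); auto. }
  assert (F0 : F 0%C = 0%C) by
    (unfold F; destruct (Ceq_dec 0 0) as [_|E]; [reflexivity | contradiction (E eq_refl)]).
  destruct (low_frequency n H1 H2 HD bessel q q_pos Hqc b hb ps ps1 Hps Hps1 Hfree r Hrb)
    as (Kl & dl & PKl & Pdl & Low).
  assert (FGl : forall k, upper k -> Cmod k <= dl ->
    Cmod (G k - k * (1 - RtoC p)) <= Kl * Cmod k ^ 2).
  { intros k Hk Hkd.
    replace (G k - k * (1 - RtoC p))%C with (- Ci * (ps1 k r / ps k r - fr1 k r / fr k r))%C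
      by (unfold G; ring).
    rewrite Cmod_mult, Cmod_opp, Cmod_Ci, Rmult_1_l; now apply Low. }
  assert (CF0 : Ccont closed_upper F 0%C).
  { intros eps Heps.
    set (A := Kl + Cmod (1 - RtoC p) + 1).
    assert (Pp := Cmod_ge_0 (1 - RtoC p)).
    assert (PA : 0 < A) by (unfold A; lra).
    exists (Rmin (Rmin 1 dl) (eps / A)); split.
    { repeat apply Rmin_pos; try lra; now apply Rdiv_lt_0_compat. }
    intros w Dw Hw; rewrite F0.
    replace (F w - 0)%C with (F w) by ring; replace (w - 0)%C with w in Hw by ring.
    destruct (Ceq_dec w 0%C) as [->|Nw]; [rewrite F0, Cmod_0; exact Heps|].
    assert (Hw' : upper w) by now split.
    assert (W1 := Rlt_le_trans _ _ _ (Rlt_le_trans _ _ _ Hw (Rmin_l _ _)) (Rmin_l _ _)).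
    assert (W2 := Rlt_le_trans _ _ _ (Rlt_le_trans _ _ _ Hw (Rmin_l _ _)) (Rmin_r _ _)).
    assert (W3 := Rlt_le_trans _ _ _ Hw (Rmin_r _ _)).
    rewrite (FG w Hw'); specialize (FGl w Hw' ltac:(lra)).
    replace (G w) with ((G w - w * (1 - RtoC p)) + w * (1 - RtoC p))%C by ring.
    eapply Rle_lt_trans; [apply Cmod_triangle|]; rewrite (Cmod_mult w).
    assert (Pw := Cmod_ge_0 w).
    apply Rle_lt_trans with (Cmod w * A).
    - unfold A; assert (Kl * Cmod w ^ 2 <= Kl * Cmod w) by (apply Rmult_le_compat_l; nra); nra.
    - apply (Rmult_lt_compat_r A) in W3; [|exact PA].
      unfold Rdiv in W3; rewrite Rmult_assoc, Rinv_l in W3; lra. }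
  destruct (high_frequency n H1 H2 HD bessel q (Derive q) (Derive_n q 2) c0 hc0 q_low Hq Hq1 Hq2
    b hb qb q1b ps ps1 Hps Hps1 Hfree r Hrb) as (Kh & K0 & PKh & PK0 & High).
  set (S := wkb_shift q (Derive q) r) in *.
  set (nu := INR n ^ 2 - 1 / 4) in *.
  set (c := Rabs nu / r ^ 2).
  assert (Pnu := Rabs_pos nu).
  assert (Pc : 0 <= c) by (apply Rmult_le_pos; [lra | left; apply Rinv_0_lt_compat; nra]).
  (* A common threshold: [K0] serves the scattered wave, the last term the free wave at radius [r],
     and the summand [1] gives [c / |k| <= c]. *)
  set (KK := K0 + 1 + (2 + 2 * Rabs nu) / r).
  assert (PKr : 0 <= (2 + 2 * Rabs nu) / r)
    by (apply Rmult_le_pos; [lra | left; apply Rinv_0_lt_compat; lra]).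
  assert (Free : forall k, upper k -> KK <= Cmod k ->
    Cmod (fr1 k r / fr k r - Ci * k) <= c / Cmod k).
  { intros k Hk HK.
    (* For [q = 0] the matching radius can be [r] itself, so the asymptotics of the free wave hold
       at [r] although [r <= b]. *)
    destruct (flux_far n H1 H2 HD bessel (fun _ => 0) r ltac:(lra) k Hk (fr k) (fr1 k)
      (fun s Hs => Hfr k s Hk Hs) (fun s Hs => Hfr1 k s Hk Hs) (fun _ _ => eq_refl) r (Rle_refl r))
      as (_ & _ & B).
    - apply Rle_trans with ((2 + 2 * Rabs nu) / r * r); [apply Req_le; unfold nu; field; lra|].
      apply Rmult_le_compat_r; unfold KK in HK; lra.
    - eapply Rle_trans; [exact B|]; apply Req_le; unfold c, nu; field; split; [lra|].
      unfold KK in HK; lra. }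
  set (L := (Ci * RtoC S)%C).
  assert (Diff : forall k, upper k -> Cmod (F k - L) <=
    Cmod (ps1 k r / ps k r - (Ci * k * RtoC p - RtoC S)) + Cmod (fr1 k r / fr k r - Ci * k)).
  { intros k Hk; rewrite FG by exact Hk.
    replace (G k - L)%C with (- Ci * (ps1 k r / ps k r - (Ci * k * RtoC p - RtoC S)) +
      Ci * (fr1 k r / fr k r - Ci * k))%C.
    - eapply Rle_trans; [apply Cmod_triangle|].
      rewrite !Cmod_mult, Cmod_opp, !Cmod_Ci; lra.
    - unfold G, L.
      set (m := (ps1 k r / ps k r)%C); set (m0 := (fr1 k r / fr k r)%C).
      transitivity (- Ci * (m - m0) + (Ci * Ci) * k * (RtoC p - 1) - Ci * RtoC S)%C; [ring|].
      rewrite Ci_sqr; ring. }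
  assert (PKK : 1 <= KK) by (unfold KK; lra).
  assert (Main := half_plane_integral F dF HF HdF F0 CF0 L (Kh + c) KK).
  assert (Hbd : forall k, upper k -> KK <= Cmod k -> Cmod (F k - L) <= Kh + c).
  { intros k Hk HK.
    destruct (High k Hk ltac:(unfold KK in HK; lra)) as [B _].
    assert (B2 := Free k Hk HK); eapply Rle_trans; [now apply Diff|].
    apply Rplus_le_compat; [exact B|]; eapply Rle_trans; [exact B2|].
    apply Rle_div_l; [lra | nra]. }
  assert (Hdec : forall k, upper k -> KK <= Im k -> Cmod (F k - L) <= (Kh + c) / Im k).
  { intros k Hk HK; assert (X := Im_le_Cmod k).
    destruct (High k Hk ltac:(unfold KK in HK; lra)) as [_ B].
    specialize (B ltac:(unfold KK in HK; lra)).
    assert (B2 := Free k Hk ltac:(lra)); eapply Rle_trans; [now apply Diff|].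
    replace ((Kh + c) / Im k) with (Kh / Im k + c / Im k) by (field; lra).
    apply Rplus_le_compat; [exact B|]; eapply Rle_trans; [exact B2|].
    apply Rmult_le_compat_l; [exact Pc | apply Rinv_le_contravar; lra]. }
  (* The logarithmic derivatives differ by [O(k^2)], so near the origin only the linear part
     [k (1 - p)] of [F] contributes to the limit of [F (k) / k]. *)
  assert (Hl0 : forall eps, 0 < eps -> exists delta, 0 < delta /\
    forall rho : R, rho <> 0 -> Rabs rho < delta ->
    Cmod (F (RtoC rho) / RtoC rho - (1 - RtoC p)) < eps).
  { intros eps Heps; exists (Rmin dl (eps / (Kl + 1))); split.
    { apply Rmin_pos; [exact Pdl | apply Rdiv_lt_0_compat; lra]. }
    intros rho Nrho Hrho; assert (U := RtoC_upper rho Nrho).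
    assert (W1 := Rlt_le_trans _ _ _ Hrho (Rmin_l _ _)).
    assert (W2 := Rlt_le_trans _ _ _ Hrho (Rmin_r _ _)).
    assert (Pr : 0 < Rabs rho) by now apply Rabs_pos_lt.
    assert (Nr : RtoC rho <> 0%C) by now apply RtoC_neq_0.
    rewrite (FG _ U).
    assert (B := FGl _ U ltac:(rewrite Cmod_R; lra)).
    replace (G (RtoC rho) / RtoC rho - (1 - RtoC p))%C with
      ((G (RtoC rho) - RtoC rho * (1 - RtoC p)) / RtoC rho)%C by (field; exact Nr).
    rewrite Cmod_div by exact Nr; rewrite Cmod_R in *.
    apply Rle_lt_trans with (Kl * Rabs rho).
    - apply Rle_div_l; [exact Pr|]; lra.
    - apply Rlt_div_r in W2; lra. }
  exists (- (Ci * RtoC PI * L))%C; split.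
  - apply (Main ltac:(lra) ltac:(lra) Hbd Hdec (1 - RtoC p)%C Hl0).
    intros rho Nrho; assert (U := RtoC_upper rho Nrho); set (k := RtoC rho) in *.
    rewrite (FG _ U).
    assert (Nk : k <> 0%C) by apply U.
    assert (N1 : ps k r <> 0%C)
      by (apply (psi_nonzero n H1 H2 HD bessel q q_pos b hb ps ps1 Hps Hps1 Hfree); [exact U | lra]).
    assert (N2 : fr k r <> 0%C)
      by (apply (free_psi_nonzero n H1 H2 HD bessel); [exact U | lra]).
    assert (Ni : Ci <> 0%C) by (intros E; assert (X := Cmod_Ci); rewrite E, Cmod_0 in X; lra).
    unfold impedance.
    change (CDerive (fun t => psi t k) r) with (ps1 k r); change (psi r k) with (ps k r).
    change (RtoC (sqrt r) * HankelH n (k * RtoC r))%C with (fr k r).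
    assert (E : CDerive (fun t => RtoC (sqrt t) * HankelH n (k * RtoC t))%C r = fr1 k r)
      by (apply (is_CDerive_unique (fr k)), Hfr; [exact U | lra]).
    rewrite E; fold p; unfold G.
    (* The factor [- i] in [F] is the [1 / i] of the impedance; dividing by [k] then restores the
       integrand. *)
    replace (- Ci)%C with (/ Ci)%C.
    + field; auto.
    + replace (/ Ci)%C with (/ Ci * (- (Ci * Ci)))%C; [field; exact Ni | rewrite Ci_sqr; ring].
  (* As [L = i S], the value [- i PI L] is [PI S], and [S] contains the quarter that the factor
     [4 / PI] compensates. *)
  - assert (P := PI_RGT_0); specialize (q_pos r).
    unfold L, S, wkb_shift.
    replace (RtoC (4 / PI) * - (Ci * RtoC PI * (Ci * RtoC (Derive q r / (4 * (1 + q r))))))%C with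
      (- (Ci * Ci) * (RtoC (4 / PI) * RtoC PI * RtoC (Derive q r / (4 * (1 + q r)))))%C by ring.
    rewrite Ci_sqr, <- !RtoC_mult.
    replace (4 / PI * PI * (Derive q r / (4 * (1 + q r)))) with (Derive q r / (1 + q r))
      by (field; lra).
    ring.
Qed.
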